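(* Consider the following twelve classes of infinite subsets of $\omega$: uniformly majorreducible, uniformly majorenumerable, majorreducible, majorenumerable, uniformly introreducible, uniformly introenumerable, introreducible, introenumerable, regressive, retraceable, c.e., and computable sets. Any two of these classes are distinct, i.e., for any two different classes $P,Q$ among them there is an infinite set belonging to one of $P,Q$ but not to the other. Moreover, for any two classes $P,Q$ among the four classes majorreducible, majorenumerable, uniformly majorreducible, uniformly majorenumerable, $P$ is refinable to $Q$: every set in $P$ has an infinite subset which is in $Q$.
   Context: For infinite $A\subseteq\omega$, $[A]^\omega$ is the set of infinite subsets of $A$, and $p_A$ is the principal function of $A$ ($p_A(n)$ is the $n$-th element of $A$ in increasing order). An enumeration operator $\Theta$ is a c.e. set of pairs $\langle u,n\rangle$; $\Theta(X)=\{n:\exists u\,(D_u\subseteq X \wedge \langle u,n\rangle\in\Theta)\}$ where $D_u$ is the finite set with canonical index $u$; $A\le_e X$ if $A=\Theta(X)$ for some enumeration operator $\Theta$. An infinite set $A$ is: introreducible if every $C\in[A]^\omega$ computes $A$; uniformly introreducible if there is a single Turing functional $\Phi$ with $\Phi^C=A$ for all $C\in[A]^\omega$; introenumerable if $A\le_e C$ for every $C\in[A]^\omega$; uniformly introenumerable if a single enumeration operator $\Theta$ has $\Theta(C)=A$ for all $C\in[A]^\omega$; majorreducible if every function $f$ with $f(n)\ge p_A(n)$ for all $n$ computes $A$ (the oracle being the graph of $f$); majorenumerable if $A\le_e \mathrm{graph}(f)$ for every such $f$; uniformly majorreducible / uniformly majorenumerable if this holds via a single Turing functional / enumeration operator for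 all such $f$. $A$ is regressive if $A$ can be written as $\{a_0,a_1,\dots\}$ with distinct $a_i$ and there is a partial computable $\varphi$ with $\varphi(a_{n+1})=a_n$ for all $n$ and $\varphi(a_0)=a_0$; $A$ is retraceable if this can be done with $a_0<a_1<\cdots$. *)

(* Defs.v *)
From mathcomp Require Import all_boot.
From mathcomp Require Import boolp classical_sets cardinality.
From Stdlib Require Cantor.
Set Implicit Arguments.
Unset Strict Implicit.
Unset Printing Implicit Defensive.

Local Open Scope classical_set_scope.

Definition pair_code (x y : nat) : nat := Cantor.to_nat (x, y).

Definition characteristic (X : set nat) (n : nat) : nat := (n \in X : bool).

(* Kleene's schemes for the partial recursive functions, in their unary form
   (several arguments are coded by pairing), with one extra instruction that
   queries an oracle. A program is read as a Turing functional. *)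
Inductive program : Type :=
| Zero
| Succ
| Fst
| Snd
| Query
| Pair of program & program
| Comp of program & program
| Prec of program & program
| Mu of program.

(* [run X e x y]: with oracle X, the program e on input x halts with value y.
   Divergence is the absence of any such y. Writing e^X for the partial
   function computed by e,
     (Prec f g)^X <a, 0>     = f^X a,
     (Prec f g)^X <a, n + 1> = g^X <a, <n, (Prec f g)^X <a, n>>>,
     (Mu f)^X x = the least y with f^X <x, y> = 0, provided that f^X <x, k>
                  converges for every k < y. *)
Fixpoint run (X : set nat) (e : program) (x y : nat) {struct e} : Prop :=
  match e with
  | Zero => y = 0
  | Succ => y = x.+1
  | Fst => y = (Cantor.of_nat x).1
  | Snd => y = (Cantor.of_nat x).2
  | Query => y = characteristic X x
  | Pair f g => exists u v, [/\ run X f x u, run X g x v & y = pair_code u v]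
  | Comp f g => exists2 z, run X g x z & run X f z y
  | Prec f g =>
      let a := (Cantor.of_nat x).1 in
      (fix loop (n r : nat) {struct n} : Prop :=
         match n with
         | 0 => run X f a r
         | n'.+1 => exists2 s, loop n' s &
                      run X g (pair_code a (pair_code n' s)) r
         end) (Cantor.of_nat x).2 y
  | Mu f => run X f (pair_code x y) 0 /\
      forall k, k < y -> exists z, run X f (pair_code x k) z.+1
  end.

Definition computes_via (e : program) (X A : set nat) : Prop :=
  forall n, run X e n (characteristic A n).

Definition turing_reducible (A X : set nat) : Prop :=
  exists e, computes_via e X A.

(* Absolute computability is computability with the empty oracle, for which
   [Query] is just the constant 0. *)
Definition computable (A : set nat) : Prop := turing_reducible A set0.

Definition ce (A : set nat) : Prop :=
  exists e, A = [set n | exists y, run set0 e n y].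

(* D_u: the finite set whose canonical index u is the sum of the 2 ^ i for i
   in the set. *)
Definition canonical_set (u : nat) : set nat := [set i | odd (u %/ 2 ^ i)].

Definition enum_apply (Theta X : set nat) : set nat :=
  [set n | exists u, canonical_set u `<=` X /\ Theta (pair_code u n)].

(* An enumeration operator is a c.e. set Theta, acting by [enum_apply]. *)
Definition enum_reducible (A X : set nat) : Prop :=
  exists2 Theta, ce Theta & enum_apply Theta X = A.

(* The element of A with exactly n elements of A below it, so counting starts
   at n = 0. The default value 0 is not used when A is infinite. *)
Definition principal (A : set nat) (n : nat) : nat :=
  xget 0 [set m | A m /\ count (mem A) (iota 0 m) = n].

Definition graph (f : nat -> nat) : set nat :=
  range (fun n => pair_code n (f n)).

Definition majorizes (f : nat -> nat) (A : set nat) : Prop :=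
  forall n, principal A n <= f n.

Definition introreducible (A : set nat) : Prop :=
  forall C, C `<=` A -> infinite_set C -> turing_reducible A C.

Definition unif_introreducible (A : set nat) : Prop :=
  exists e, forall C, C `<=` A -> infinite_set C -> computes_via e C A.

Definition introenumerable (A : set nat) : Prop :=
  forall C, C `<=` A -> infinite_set C -> enum_reducible A C.

Definition unif_introenumerable (A : set nat) : Prop :=
  exists2 Theta, ce Theta &
    forall C, C `<=` A -> infinite_set C -> enum_apply Theta C = A.

Definition majorreducible (A : set nat) : Prop :=
  forall f, majorizes f A -> turing_reducible A (graph f).

Definition unif_majorreducible (A : set nat) : Prop :=
  exists e, forall f, majorizes f A -> computes_via e (graph f) A.

Definition majorenumerable (A : set nat) : Prop :=
  forall f, majorizes f A -> enum_reducible A (graph f).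

Definition unif_majorenumerable (A : set nat) : Prop :=
  exists2 Theta, ce Theta &
    forall f, majorizes f A -> enum_apply Theta (graph f) = A.

(* The partial computable function computed by phi maps a (n + 1) to a n and
   fixes a 0. *)
Definition steps_back (phi : program) (a : nat -> nat) : Prop :=
  run set0 phi (a 0) (a 0) /\ forall n, run set0 phi (a n.+1) (a n).

Definition regressive (A : set nat) : Prop :=
  exists a : nat -> nat,
    [/\ injective a, range a = A & exists phi, steps_back phi a].

Definition retraceable (A : set nat) : Prop :=
  exists a : nat -> nat,
    [/\ forall n, a n < a n.+1, range a = A & exists phi, steps_back phi a].

Inductive class_name : Type :=
| UnifMajorreducible
| UnifMajorenumerable
| Majorreducible
| Majorenumerable
| UnifIntroreducible
| UnifIntroenumerable
| Introreducible
| Introenumerable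
| Regressive
| Retraceable
| CE
| Computable.

Definition class_property (P : class_name) : set nat -> Prop :=
  match P with
  | UnifMajorreducible => unif_majorreducible
  | UnifMajorenumerable => unif_majorenumerable
  | Majorreducible => majorreducible
  | Majorenumerable => majorenumerable
  | UnifIntroreducible => unif_introreducible
  | UnifIntroenumerable => unif_introenumerable
  | Introreducible => introreducible
  | Introenumerable => introenumerable
  | Regressive => regressive
  | Retraceable => retraceable
  | CE => ce
  | Computable => computable
  end.

Definition in_class (P : class_name) (A : set nat) : Prop :=
  infinite_set A /\ class_property P A.

Definition major_class (P : class_name) : bool :=
  match P with
  | Majorreducible | Majorenumerable
  | UnifMajorreducible | UnifMajorenumerable => true
  | _ => false
  end.

Definition refinable (P Q : class_name) : Prop :=
  forall A, in_class P A -> exists2 B, B `<=` A & in_class Q B.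

(* Main.v *)
(* Five sets separate the classes: a noncomputable c.e. set that contains the even
   numbers; the initial segments of a real [X], which form a retraceable set that
   is not majorenumerable for some [X] because there are only countably many
   majorenumerable sets; a set whose elements code an initial part of it but not
   their predecessor, built to defeat all regressing functions; a majorreducible
   set built by finite injury to defeat all enumeration operators; and a uniformly
   majorreducible subset of the latter.

   In the finite injury construction a stage acts with a finite set [F] when an
   operator enumerates from [F] a number outside [F].  A function that majorizes
   the resulting set either bounds the acting stages at almost all nodes, and then
   it recovers the true path, or it fails to do so at infinitely many nodes; since
   the set is kept sparse relative to the cancelled stages, those nodes are true.

   For refinability, Hechler forcing shows that a majorenumerable set [A] consists
   of the [n] for which some computable tree [T_n] is well founded.  The product of
   the [T_n] is then well founded too, and infinitely many [n] have [T_n] of rank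
   at most that of this product.  Comparing ranks amounts to playing a well-founded
   game, and any function that majorizes the winning strategy computes it; a subset
   that is sparse relative to the strategy is uniformly majorreducible. *)

Require Import Defs.
From mathcomp Require Import all_boot.
From mathcomp Require Import boolp classical_sets cardinality.
From mathcomp Require Import zify.
From Stdlib Require Cantor.

Set Implicit Arguments.
Unset Strict Implicit.
Unset Printing Implicit Defensive.

Local Open Scope classical_set_scope.
Local Open Scope nat_scope.

#[global] Arguments pair_code : simpl never.
#[global] Arguments Cantor.of_nat : simpl never.

(** The operator that enumerates a majorenumerable set may change with the majorizing function.
    Forcing removes this dependence, but the criterion it leaves, well-foundedness of [T_n], is not
    confirmed by any finite search. The comparison with the product avoids deciding it: every second
    move descends in the product, so the game is well founded for every [n], and a tree of rank at
    most that of the product is itself well founded. In the finite injury construction two demands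
    compete: few elements below a cancelled stage, so that majorizing functions can recognize true
    stages, and freedom to act against every operator. They are reconciled because an operator has
    to be correct on all infinite subsets, and a very sparse subset, with at most one element
    between consecutive true stages, can be offered to it. *)

(** * The Cantor pairing *)

Definition unpair1 (n : nat) : nat := (Cantor.of_nat n).1.
Definition unpair2 (n : nat) : nat := (Cantor.of_nat n).2.

#[global] Arguments unpair1 : simpl never.
#[global] Arguments unpair2 : simpl never.

Lemma pair_codeK1 x y : unpair1 (pair_code x y) = x.
Proof. by rewrite /unpair1 /pair_code Cantor.cancel_of_to. Qed.

Lemma pair_codeK2 x y : unpair2 (pair_code x y) = y.
Proof. by rewrite /unpair2 /pair_code Cantor.cancel_of_to. Qed.

Lemma unpairK n : pair_code (unpair1 n) (unpair2 n) = n.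
Proof.
by rewrite /unpair1 /unpair2 /pair_code -surjective_pairing Cantor.cancel_to_of.
Qed.

Definition unpairE := (pair_codeK1, pair_codeK2).

Lemma pair_code_inj x y x' y' :
  pair_code x y = pair_code x' y' -> x = x' /\ y = y'.
Proof.
move=> e; move: (congr1 unpair1 e) (congr1 unpair2 e).
by rewrite !unpairE.
Qed.

Lemma leq_pair_code x y : x + y <= pair_code x y.
Proof. by have := Cantor.to_nat_non_decreasing x y; rewrite /pair_code; lia. Qed.

Lemma leq_pair1 x y : x <= pair_code x y.
Proof. by have := leq_pair_code x y; lia. Qed.

Lemma leq_pair2 x y : y <= pair_code x y.
Proof. by have := leq_pair_code x y; lia. Qed.

Lemma leq_unpair1 n : unpair1 n <= n.
Proof. by rewrite -{2}(unpairK n) leq_pair1. Qed.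

Lemma leq_unpair2 n : unpair2 n <= n.
Proof. by rewrite -{2}(unpairK n) leq_pair2. Qed.

(** * Uniform computability on a class of oracles *)

(** A class of oracles lets uniform and nonuniform reductions share one calculus: a class of subsets
    or of graphs for the former, a singleton for the latter, and [[set set0]] for absolute
    computability. *)
Definition computable_on (D : set (set nat)) (F : set nat -> nat -> nat) : Prop :=
  exists e, forall X, D X -> forall x, run X e x (F X x).

Lemma computable_on_ext D F G :
  (forall X x, D X -> F X x = G X x) ->
  computable_on D F -> computable_on D G.
Proof. by move=> FG [e he]; exists e => X DX x; rewrite -FG //; exact: he. Qed.

Lemma computable_on_sub (D D' : set (set nat)) F :
  D' `<=` D -> computable_on D F -> computable_on D' F.
Proof. by move=> DD' [e he]; exists e => X /DD' DX x; exact: he. Qed.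

Lemma co_id D : computable_on D (fun X x => x).
Proof.
exists (Pair Fst Snd) => X _ x; exists (unpair1 x), (unpair2 x).
by split=> //; rewrite unpairK.
Qed.

Lemma co_const D c : computable_on D (fun X x => c).
Proof.
exists (iter c (Comp Succ) Zero) => X _ x.
by elim: c => [//|c IH] /=; exists c.
Qed.

Lemma co_comp D F G :
  computable_on D F -> computable_on D G ->
  computable_on D (fun X x => F X (G X x)).
Proof.
move=> [f hf] [g hg]; exists (Comp f g) => X DX x /=.
by exists (G X x); [exact: hg | exact: hf].
Qed.

Lemma co_fst D F : computable_on D F -> computable_on D (fun X x => unpair1 (F X x)).
Proof. by apply: (@co_comp D (fun _ => unpair1)); exists Fst. Qed.

Lemma co_snd D F : computable_on D F -> computable_on D (fun X x => unpair2 (F X x)).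
Proof. by apply: (@co_comp D (fun _ => unpair2)); exists Snd. Qed.

Lemma co_succ D F : computable_on D F -> computable_on D (fun X x => (F X x).+1).
Proof. by apply: (@co_comp D (fun _ => S)); exists Succ. Qed.

Lemma co_query D F :
  computable_on D F -> computable_on D (fun X x => characteristic X (F X x)).
Proof. by apply: (@co_comp D characteristic); exists Query. Qed.

Lemma co_pair D F G :
  computable_on D F -> computable_on D G ->
  computable_on D (fun X x => pair_code (F X x) (G X x)).
Proof.
move=> [f hf] [g hg]; exists (Pair f g) => X DX x /=.
by exists (F X x), (G X x); split; [exact: hf | exact: hg |].
Qed.

Lemma co_app2 D (F : set nat -> nat -> nat -> nat) G H :
  computable_on D (fun X z => F X (unpair1 z) (unpair2 z)) ->
  computable_on D G -> computable_on D H ->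
  computable_on D (fun X x => F X (G X x) (H X x)).
Proof.
move=> cF cG cH; have := co_comp cF (co_pair cG cH).
by apply: computable_on_ext => X x _; rewrite !unpairE.
Qed.

Lemma co_nat_rect D N F (G : set nat -> nat -> nat -> nat -> nat) :
  computable_on D N -> computable_on D F ->
  computable_on D
    (fun X z => G X (unpair1 z) (unpair1 (unpair2 z)) (unpair2 (unpair2 z))) ->
  computable_on D
    (fun X x => nat_rect (fun _ => nat) (F X x) (G X x) (N X x)).
Proof.
move=> [n hn] [f hf] [g hg].
exists (Comp (Prec f g) (Pair (Pair Fst Snd) n)) => X DX x.
exists (pair_code x (N X x)).
  exists x, (N X x); split=> //.
    by exists (unpair1 x), (unpair2 x); split=> //; rewrite unpairK.
  exact: hn.
rewrite /= -/(unpair1 _) -/(unpair2 _) !unpairE.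
elim: (N X x) => [|k IH] /=; first exact: hf.
eexists; first exact: IH.
by have := hg X DX (pair_code x (pair_code k
  (nat_rect (fun _ => nat) (F X x) (G X x) k))); rewrite !unpairE.
Qed.

Lemma co_iter D N F (G : set nat -> nat -> nat -> nat) :
  computable_on D N -> computable_on D F ->
  computable_on D (fun X z => G X (unpair1 z) (unpair2 z)) ->
  computable_on D (fun X x => iter (N X x) (G X x) (F X x)).
Proof.
move=> cN cF cG.
apply: (@computable_on_ext _ (fun X x =>
  nat_rect (fun _ => nat) (F X x) (fun _ s => G X x s) (N X x))).
  by move=> X x _; elim: (N X x) => [//|k /= ->].
apply: (@co_nat_rect D N F (fun X x _ s => G X x s)) => //.
by apply: (co_app2 cG); [apply/co_fst/co_id | apply/co_snd/co_snd/co_id].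
Qed.

Lemma co_if D (B : set nat -> nat -> bool) F G :
  computable_on D (fun X x => B X x) -> computable_on D F -> computable_on D G ->
  computable_on D (fun X x => if B X x then F X x else G X x).
Proof.
move=> cB cF cG.
apply: (@computable_on_ext _ (fun X x =>
  nat_rect (fun _ => nat) (G X x) (fun _ _ => F X x) (B X x))).
  by move=> X x _; case: (B X x).
apply: (@co_nat_rect D _ _ (fun X x _ _ => F X x)) => //.
by apply: (@co_comp D F) => //; apply/co_fst; exact: co_id.
Qed.

Lemma co_ifb D (B P Q : set nat -> nat -> bool) :
  computable_on D (fun X x => B X x) -> computable_on D (fun X x => P X x) ->
  computable_on D (fun X x => Q X x) ->
  computable_on D (fun X x => if B X x then P X x else Q X x).
Proof.
move=> cB cP cQ.
apply: (@computable_on_ext _ (fun X x => if B X x then P X x : nat else Q X x)).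
  by move=> X x _; case: (B X x).
exact: co_if.
Qed.

Lemma co_neg D (B : set nat -> nat -> bool) :
  computable_on D (fun X x => B X x) -> computable_on D (fun X x => ~~ B X x).
Proof.
move=> cB; apply: (@computable_on_ext _ (fun X x => if B X x then 0 else 1)).
  by move=> X x _; case: (B X x).
by apply: co_if => //; exact: co_const.
Qed.

Lemma co_and D (B C : set nat -> nat -> bool) :
  computable_on D (fun X x => B X x) -> computable_on D (fun X x => C X x) ->
  computable_on D (fun X x => B X x && C X x).
Proof.
move=> cB cC.
apply: (@computable_on_ext _ (fun X x => if B X x then (C X x : nat) else 0)).
  by move=> X x _; case: (B X x).
by apply: co_if => //; exact: co_const.
Qed.

Lemma co_or D (B C : set nat -> nat -> bool) :
  computable_on D (fun X x => B X x) -> computable_on D (fun X x => C X x) ->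
  computable_on D (fun X x => B X x || C X x).
Proof.
move=> cB cC.
apply: (@computable_on_ext _ (fun X x => if B X x then 1 else (C X x : nat))).
  by move=> X x _; case: (B X x).
by apply: co_if => //; exact: co_const.
Qed.

Lemma co_imp D (B C : set nat -> nat -> bool) :
  computable_on D (fun X x => B X x) -> computable_on D (fun X x => C X x) ->
  computable_on D (fun X x => B X x ==> C X x).
Proof.
move=> cB cC.
apply: (@computable_on_ext _ (fun X x => if B X x then (C X x : nat) else 1)).
  by move=> X x _; case: (B X x).
by apply: co_if => //; exact: co_const.
Qed.

Lemma co_eqb D (B C : set nat -> nat -> bool) :
  computable_on D (fun X x => B X x) -> computable_on D (fun X x => C X x) ->
  computable_on D (fun X x => B X x == C X x).
Proof.
move=> cB cC.
apply: (@computable_on_ext _ (fun X x => if B X x then C X x else ~~ C X x)).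
  by move=> X x _; case: (B X x); case: (C X x).
by apply: co_ifb => //; exact: co_neg.
Qed.

Lemma co_add D F G :
  computable_on D F -> computable_on D G -> computable_on D (fun X x => F X x + G X x).
Proof.
move=> cF cG.
apply: (@computable_on_ext _ (fun X x => iter (G X x) S (F X x))).
  by move=> X x _; elim: (G X x) => [|k /= ->]; rewrite ?addn0 ?addnS.
apply: (@co_iter D _ _ (fun _ _ s => s.+1)) => //.
by apply/co_succ/co_snd/co_id.
Qed.

Lemma co_pred D F : computable_on D F -> computable_on D (fun X x => (F X x).-1).
Proof.
move=> cF.
apply: (@computable_on_ext _ (fun X x =>
  nat_rect (fun _ => nat) 0 (fun n _ => n) (F X x))).
  by move=> X x _; case: (F X x).
apply: (@co_nat_rect D _ _ (fun _ _ n _ => n)) => //; first exact: co_const.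
by apply/co_fst/co_snd/co_id.
Qed.

Lemma co_sub D F G :
  computable_on D F -> computable_on D G -> computable_on D (fun X x => F X x - G X x).
Proof.
move=> cF cG.
apply: (@computable_on_ext _ (fun X x => iter (G X x) predn (F X x))).
  by move=> X x _; elim: (G X x) => [|k /= ->]; rewrite ?subn0 ?subnS.
apply: (@co_iter D _ _ (fun _ _ s => s.-1)) => //.
by apply/co_pred/co_snd/co_id.
Qed.

Lemma co_eq0 D F : computable_on D F -> computable_on D (fun X x => F X x == 0).
Proof.
move=> cF.
apply: (@computable_on_ext _ (fun X x =>
  nat_rect (fun _ => nat) 1 (fun _ _ => 0) (F X x))).
  by move=> X x _; case: (F X x).
by apply: (@co_nat_rect D _ _ (fun _ _ _ _ => 0)) => //; exact: co_const.
Qed.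

Lemma co_leq D F G :
  computable_on D F -> computable_on D G -> computable_on D (fun X x => F X x <= G X x).
Proof. by move=> cF cG; apply/co_eq0/co_sub. Qed.

Lemma co_eqn D F G :
  computable_on D F -> computable_on D G -> computable_on D (fun X x => F X x == G X x).
Proof.
move=> cF cG.
apply: (@computable_on_ext _ (fun X x => (F X x <= G X x) && (G X x <= F X x))).
  by move=> X x _; rewrite eqn_leq.
by apply: co_and; exact: co_leq.
Qed.

Lemma count_iotaS (p : pred nat) k :
  count p (iota 0 k.+1) = count p (iota 0 k) + p k.
Proof. by rewrite -addn1 iotaD count_cat /= addn0 add0n. Qed.

Lemma co_count D (P : set nat -> nat -> nat -> bool) N :
  computable_on D N ->
  computable_on D (fun X z => P X (unpair1 z) (unpair2 z)) ->
  computable_on D (fun X x => count (P X x) (iota 0 (N X x))).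
Proof.
move=> cN cP.
apply: (@computable_on_ext _ (fun X x =>
  nat_rect (fun _ => nat) 0 (fun n s => s + P X x n) (N X x))).
  by move=> X x _; elim: (N X x) => [//|k IH]; rewrite count_iotaS -IH.
apply: (@co_nat_rect D _ _ (fun X x n s => s + P X x n)) => //; first exact: co_const.
apply: co_add; first by apply/co_snd/co_snd/co_id.
apply: (@co_app2 D (fun X a b => P X a b)) => //; first by apply/co_fst/co_id.
by apply/co_fst/co_snd/co_id.
Qed.

Lemma co_has D (P : set nat -> nat -> nat -> bool) N :
  computable_on D N ->
  computable_on D (fun X z => P X (unpair1 z) (unpair2 z)) ->
  computable_on D (fun X x => has (P X x) (iota 0 (N X x))).
Proof.
move=> cN cP.
apply: (@computable_on_ext _ (fun X x => 0 < count (P X x) (iota 0 (N X x)))).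
  by move=> X x _; rewrite has_count.
apply: co_leq; first exact: co_const.
exact: co_count.
Qed.

Lemma co_all D (P : set nat -> nat -> nat -> bool) N :
  computable_on D N ->
  computable_on D (fun X z => P X (unpair1 z) (unpair2 z)) ->
  computable_on D (fun X x => all (P X x) (iota 0 (N X x))).
Proof.
move=> cN cP.
apply: (@computable_on_ext _ (fun X x =>
   count (P X x) (iota 0 (N X x)) == N X x)).
  by move=> X x _; rewrite all_count size_iota.
by apply: co_eqn => //; exact: co_count.
Qed.

Lemma run_functional X e x y y' : run X e x y -> run X e x y' -> y = y'.
Proof.
elim: e x y y' => [|||||f IHf g IHg|f IHf g IHg|f IHf g IHg|f IHf] x y y' /=.
- by move=> -> ->.
- by move=> -> ->.
- by move=> -> ->.
- by move=> -> ->.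
- by move=> -> ->.
- move=> [u [v [fu gv ->]]] [u' [v' [fu' gv' ->]]].
  by rewrite (IHf _ _ _ fu fu') (IHg _ _ _ gv gv').
- by move=> [z gz fz] [z' gz' fz']; apply: (IHf z) => //; rewrite (IHg _ _ _ gz gz').
- elim: (Cantor.of_nat x).2 y y' => [|n IHn] y y' /=; first exact: IHf.
  move=> [s ns gs] [s' ns' gs'].
  by have ss' := IHn _ _ ns ns'; move: gs'; rewrite -ss'; exact: IHg.
- move=> [fy ky] [fy' ky']; apply/eqP; rewrite eqn_leq; apply/andP; split.
    rewrite leqNgt; apply/negP => /ky[z] fz.
    by have := IHf _ _ _ fy' fz.
  rewrite leqNgt; apply/negP => /ky'[z] fz.
  by have := IHf _ _ _ fy fz.
Qed.

(** [Mu] looks for a zero, so the program tests the negation of [P]. The search diverges where [P]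
    has no witness; c.e. sets and partial functions enter in this way. *)
Lemma partial_search D (P : set nat -> nat -> nat -> bool) :
  computable_on D (fun X z => P X (unpair1 z) (unpair2 z)) ->
  exists e, forall X, D X -> forall x y,
    run X e x y <-> P X x y /\ forall k, k < y -> ~~ P X x k.
Proof.
move=> /co_neg[e he]; exists (Mu e) => X DX x y /=.
have runE a b v : run X e (pair_code a b) v <-> v = ~~ P X a b.
  have := he X DX (pair_code a b); rewrite !unpairE => h.
  by split=> [h'|->//]; exact: run_functional h' h.
split=> [[/runE p0 pk]|[p0 pk]]; split.
- by case: (P X x y) p0.
- by move=> k /pk[z /runE]; case: (P X x k).
- by apply/runE; rewrite p0.
- by move=> k /pk npk; exists 0; apply/runE; rewrite npk.
Qed.

Lemma co_search D (P : set nat -> nat -> nat -> bool) (m : set nat -> nat -> nat) :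
  computable_on D (fun X z => P X (unpair1 z) (unpair2 z)) ->
  (forall X x, D X -> P X x (m X x) /\ forall k, k < m X x -> ~~ P X x k) ->
  computable_on D m.
Proof.
move=> /partial_search[e he] hm; exists e => X DX x.
by apply/he => //; exact: hm.
Qed.

Create HintDb co discriminated.
#[global] Hint Constants Opaque : co.
#[global] Hint Resolve co_id co_const co_fst co_snd co_succ co_query co_pair
  co_if co_ifb co_neg co_and co_or co_imp co_eqb co_add co_pred co_sub co_leq co_eqn
  co_count co_has co_all co_iter co_nat_rect : co.

Ltac co := solve [auto 100 with co nocore].

Lemma co_mul D F G :
  computable_on D F -> computable_on D G -> computable_on D (fun X x => F X x * G X x).
Proof.
move=> cF cG.
apply: (@computable_on_ext _ (fun X x => iter (G X x) (fun s => F X x + s) 0)).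
  by move=> X x _; elim: (G X x) => [|k /= ->]; rewrite ?muln0 ?mulnS.
apply: co_iter => //; first by co.
by apply: co_add; [apply: (co_comp cF); co | co].
Qed.

Lemma co_odd D F : computable_on D F -> computable_on D (fun X x => odd (F X x)).
Proof.
move=> cF.
apply: (@computable_on_ext _ (fun X x => iter (F X x) (fun s => 1 - s) 0)).
  by move=> X x _; elim: (F X x) => [//|k /= ->]; case: odd.
by co.
Qed.
#[global] Hint Resolve co_mul co_odd : co.

Lemma co_half D F : computable_on D F -> computable_on D (fun X x => (F X x)./2).
Proof.
move=> cF.
apply: (@computable_on_ext _ (fun X x =>
  nat_rect (fun _ => nat) 0 (fun n s => s + odd n) (F X x))).
  move=> X x _; elim: (F X x) => [//|k IH] /=; rewrite IH /= uphalf_half addnC //.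
by co.
Qed.
#[global] Hint Resolve co_half : co.

Lemma co_exp2 D F : computable_on D F -> computable_on D (fun X x => 2 ^ F X x).
Proof.
move=> cF.
apply: (@computable_on_ext _ (fun X x => iter (F X x) (fun s => s + s) 1)).
  by move=> X x _; elim: (F X x) => [//|k /= ->]; rewrite expnS mul2n addnn.
by co.
Qed.
#[global] Hint Resolve co_exp2 : co.

(** * Canonical indices of finite sets *)

Definition bit (u i : nat) : bool := odd (u %/ 2 ^ i).

Lemma co_bit D F G :
  computable_on D F -> computable_on D G -> computable_on D (fun X x => bit (F X x) (G X x)).
Proof.
move=> cF cG.
apply: (@computable_on_ext _ (fun X x => odd (iter (G X x) half (F X x)))).
  move=> X x _; congr (nat_of_bool (odd _)).
  elim: (G X x) => [|k IH] /=; first by rewrite expn0 divn1.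
  by rewrite IH -divn2 -divnMA expnS mulnC.
by co.
Qed.
#[global] Hint Resolve co_bit : co.

Lemma all_iotaP (p : pred nat) n :
  reflect (forall i, i < n -> p i) (all p (iota 0 n)).
Proof.
apply: (iffP allP) => h i; first by move=> lt_in; apply: h; rewrite mem_iota.
by rewrite mem_iota /= add0n; exact: h.
Qed.

Lemma has_iotaP (p : pred nat) n :
  reflect (exists2 i, i < n & p i) (has p (iota 0 n)).
Proof.
apply: (iffP hasP) => -[i]; first by rewrite mem_iota => lt_in pi; exists i.
by move=> lt_in pi; exists i; rewrite // mem_iota.
Qed.

Lemma bit0 u : bit u 0 = odd u.
Proof. by rewrite /bit expn0 divn1. Qed.

Lemma bitS u i : bit u i.+1 = bit u./2 i.
Proof. by rewrite /bit -divn2 -divnMA expnS. Qed.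

Lemma bit_ltn u i : bit u i -> i < u.
Proof.
elim: i u => [|i IH] u; first by rewrite bit0; case: u.
by rewrite bitS => /IH; lia.
Qed.

Definition bitmask (p : pred nat) (n : nat) : nat :=
  nat_rect (fun _ => nat) 0 (fun k s => s + p k * 2 ^ k) n.

Lemma bitmaskSr p n : bitmask p n.+1 = bitmask p n + p n * 2 ^ n.
Proof. by []. Qed.

Lemma bitmaskS p n : bitmask p n.+1 = p 0 + (bitmask (fun i => p i.+1) n).*2.
Proof.
elim: n => [|n IH]; first by rewrite /bitmask /= expn0 muln1 addn0.
rewrite bitmaskSr IH [in RHS]bitmaskSr expnS; lia.
Qed.

Lemma bit_bitmask p n i : bit (bitmask p n) i = (i < n) && p i.
Proof.
elim: n p i => [|n IH] p i; first by rewrite /bit div0n.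
rewrite bitmaskS; case: i => [|i]; first by rewrite bit0 oddD odd_double oddb addbF.
by rewrite bitS half_bit_double IH.
Qed.

(** * Programs with a relation as oracle *)

(** A relation may leave queries unanswered. This covers a true oracle, an oracle cut off at the use
    of a computation, and queries answered by a partial program. *)
Fixpoint grun (Q : nat -> nat -> Prop) (e : program) (x y : nat) {struct e} : Prop :=
  match e with
  | Zero => y = 0
  | Succ => y = x.+1
  | Fst => y = unpair1 x
  | Snd => y = unpair2 x
  | Query => Q x y
  | Pair f g => exists u v, [/\ grun Q f x u, grun Q g x v & y = pair_code u v]
  | Comp f g => exists2 z, grun Q g x z & grun Q f z y
  | Prec f g =>
      (fix loop (n r : nat) {struct n} : Prop :=
         match n with
         | 0 => grun Q f (unpair1 x) r
         | n'.+1 => exists2 s, loop n' s &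
                      grun Q g (pair_code (unpair1 x) (pair_code n' s)) r
         end) (unpair2 x) y
  | Mu f => grun Q f (pair_code x y) 0 /\
      forall k, k < y -> exists z, grun Q f (pair_code x k) z.+1
  end.

Lemma run_grun X e : run X e = grun (fun x y => y = characteristic X x) e.
Proof.
by elim: e => //= [f -> g -> | f -> g -> | f -> g -> | f ->].
Qed.

Lemma bounded_choice (P : nat -> nat -> Prop) n :
  (forall k m m', m <= m' -> P k m -> P k m') ->
  (forall k, k < n -> exists m, P k m) -> exists m, forall k, k < n -> P k m.
Proof.
move=> Pmono; elim: n => [|n IH] Pn; first by exists 0.
have [k /ltnW lt_kn|m Pm] := IH; first exact: Pn.
have [m' Pm'] := Pn n (ltnSn n).
exists (maxn m m') => k; rewrite ltnS leq_eqVlt => /predU1P[->|lt_kn].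
  exact: Pmono (leq_maxr _ _) Pm'.
exact: Pmono (leq_maxl _ _) (Pm _ lt_kn).
Qed.

Lemma grun_mono (Q Q' : nat -> nat -> Prop) e x y :
  (forall z v, Q z v -> Q' z v) -> grun Q e x y -> grun Q' e x y.
Proof.
move=> QQ'.
elim: e x y => [|||||f IHf g IHg|f IHf g IHg|f IHf g IHg|f IHf] x y //=.
- exact: QQ'.
- by move=> [u [v [fu gv ->]]]; exists u, v; split=> //; [exact: IHf | exact: IHg].
- by move=> [z gz fz]; exists z; [exact: IHg | exact: IHf].
- elim: (unpair2 x) y => [|n IHn] y /=; first exact: IHf.
  by move=> [s /IHn ns gs]; exists s => //; exact: IHg.
- move=> [f0 fk]; split=> [|k /fk[z fz]]; first exact: IHf.
  by exists z; exact: IHf.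
Qed.

Lemma grun_use Q e x y :
  grun Q e x y -> exists m, grun (fun z v => z < m /\ Q z v) e x y.
Proof.
pose R m z v := z < m /\ Q z v.
have Rmono m m' e' x' y' : m <= m' -> grun (R m) e' x' y' -> grun (R m') e' x' y'.
  move=> mm'; apply: grun_mono => z v [zm Qzv]; split=> //.
  exact: leq_trans mm'.
rewrite -/(R _).
elim: e x y => [|||||f IHf g IHg|f IHf g IHg|f IHf g IHg|f IHf] x y /=;
  try by exists 0.
- by move=> Qxy; exists x.+1; split.
- move=> [u [v [/IHf[m fu] /IHg[m' gv] ->]]]; exists (maxn m m'), u, v.
  by split=> //; [apply: Rmono fu; exact: leq_maxl | apply: Rmono gv; exact: leq_maxr].
- move=> [z /IHg[m gz] /IHf[m' fz]]; exists (maxn m m'), z.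
    by apply: Rmono gz; exact: leq_maxl.
  by apply: Rmono fz; exact: leq_maxr.
- elim: (unpair2 x) y => [|n IHn] y /=; first exact: IHf.
  move=> [s /IHn[m ns] /IHg[m' gs]]; exists (maxn m m'), s; last first.
    by apply: Rmono gs; exact: leq_maxr.
  move: (maxn m m') (leq_maxl m m') => M mM {gs IHn}.
  elim: n s ns => [|n IHn] s /=; first exact: Rmono.
  by move=> [t /IHn nt gt]; exists t => //; exact: Rmono gt.
- move=> [/IHf[m f0] fk].
  pose P k m := exists z, grun (R m) f (pair_code x k) z.+1.
  have [||m' fm'] := @bounded_choice P y.
  + by move=> k m1 m2 m12 [z fz]; exists z; apply: Rmono fz.
  + by move=> k /fk[z /IHf[m1 fz]]; exists m1, z.
  exists (maxn m m'); split; first by apply: Rmono f0; exact: leq_maxl.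
  by move=> k /fm'[z fz]; exists z; apply: Rmono fz; exact: leq_maxr.
Qed.

Lemma run_use X e x y :
  run X e x y ->
  exists m, forall Y,
    (forall z, z < m -> characteristic X z = characteristic Y z) -> run Y e x y.
Proof.
rewrite run_grun => /grun_use[m em]; exists m => Y XY.
by rewrite run_grun; apply: grun_mono em => z v [zm ->]; exact: XY.
Qed.

(* [psubst q e] runs [e] on the second component of its input, with queries
   answered by [q], which also sees the first component. *)
Fixpoint psubst (q e : program) : program :=
  match e with
  | Zero => Zero
  | Succ => Comp Succ Snd
  | Fst => Comp Fst Snd
  | Snd => Comp Snd Snd
  | Query => q
  | Pair f g => Pair (psubst q f) (psubst q g)
  | Comp f g => Comp (psubst q f) (Pair Fst (psubst q g))
  | Prec f g =>
      Comp (Prec (psubst q f)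
                 (Comp (psubst q g)
                       (Pair (Comp Fst Fst) (Pair (Comp Snd Fst) Snd))))
           (Pair (Pair Fst (Comp Fst Snd)) (Comp Snd Snd))
  | Mu f =>
      Mu (Comp (psubst q f) (Pair (Comp Fst Fst) (Pair (Comp Snd Fst) Snd)))
  end.

Lemma run_psubst X q e u x y :
  run X (psubst q e) (pair_code u x) y <->
  grun (fun z v => run X q (pair_code u z) v) e x y.
Proof.
have ofE : (forall a b, (Cantor.of_nat (pair_code a b)).1 = a) *
           (forall a b, (Cantor.of_nat (pair_code a b)).2 = b).
  by split=> a b; rewrite /pair_code Cantor.cancel_of_to.
(* [Prec] and [Mu] attach their counter outside the pair of parameter and argument; [rearr]
   reassociates, so that the parameter stays the first component. *)
pose rearr := Pair (Comp Fst Fst) (Pair (Comp Snd Fst) Snd).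
have rearrE a b c z : run X rearr (pair_code (pair_code a b) c) z <->
    z = pair_code a (pair_code b c).
  split=> [h|->].
    apply: run_functional h _; exists a, (pair_code b c); split=> //.
      by exists (pair_code a b) => /=; rewrite -/(unpair1 _) unpairE.
    exists b, c; split=> //=; rewrite -?/(unpair2 _) ?unpairE //.
    by exists (pair_code a b) => /=; rewrite -?/(unpair1 _) -?/(unpair2 _) unpairE.
  exists a, (pair_code b c); split=> //.
    by exists (pair_code a b) => /=; rewrite -/(unpair1 _) unpairE.
  exists b, c; split=> //=; rewrite -?/(unpair2 _) ?unpairE //.
  by exists (pair_code a b) => /=; rewrite -?/(unpair1 _) -?/(unpair2 _) unpairE.
have compE g a b c z :
    run X (Comp (psubst q g) rearr) (pair_code (pair_code a b) c) z <->
    run X (psubst q g) (pair_code a (pair_code b c)) z.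
  split=> [[t /rearrE -> //]|gz].
  by exists (pair_code a (pair_code b c)); first exact/rearrE.
elim: e x y => [|||||f IHf g IHg|f IHf g IHg|f IHf g IHg|f IHf] x y //=.
- by split=> [[z -> ->]|->]; [|exists x]; rewrite ?ofE.
- by split=> [[z -> ->]|->]; [|exists x]; rewrite ?ofE.
- by split=> [[z -> ->]|->]; [|exists x]; rewrite ?ofE.
- by split=> -[v [w [/IHf fv /IHg gw ->]]]; exists v, w.
- split=> [[z [v [w [-> /IHg gw ->]]]]|[w /IHg gw /IHf fy]].
    by rewrite ofE => /IHf fy; exists w.
  by exists (pair_code u w) => //; exists u, w; rewrite ofE.
- have loopE b n r :
    ((fix loop (n r : nat) {struct n} : Prop :=
       match n with
       | 0 => run X (psubst q f) (pair_code u b) r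
       | n'.+1 => exists2 s, loop n' s &
           run X (Comp (psubst q g) rearr)
             (pair_code (pair_code u b) (pair_code n' s)) r
       end) n r) <->
    ((fix loop (n r : nat) {struct n} : Prop :=
       match n with
       | 0 => grun (fun z v => run X q (pair_code u z) v) f b r
       | n'.+1 => exists2 s, loop n' s &
           grun (fun z v => run X q (pair_code u z) v) g
             (pair_code b (pair_code n' s)) r
       end) n r).
    elim: n r => [|n IHn] r; first exact: IHf.
    by split=> -[s /IHn ns gs]; exists s => //; [apply/IHg/compE | apply/compE/IHg].
  split=> [[z [v [w [[v1 [v2 [-> [v3 -> ->] ->]]] [w1 -> ->] ->]]]]|h].
    by rewrite !ofE; exact: (iffLR (loopE _ _ _)).
  exists (pair_code (pair_code u (unpair1 x)) (unpair2 x)); last first.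
    by rewrite !ofE; exact: (iffRL (loopE _ _ _)).
  exists (pair_code u (unpair1 x)), (unpair2 x); split=> //.
    exists u, (unpair1 x); rewrite ofE.
    by split=> //; exists x; rewrite // ofE.
  by exists x; rewrite // ofE.
- have fE k v : run X (Comp (psubst q f) rearr) (pair_code (pair_code u x) k) v <->
      grun (fun z v => run X q (pair_code u z) v) f (pair_code x k) v.
    by rewrite compE; exact: IHf.
  split=> -[f0 fk]; split.
  + exact: (iffLR (fE _ _) f0).
  + by move=> k /fk[z fz]; exists z; exact: (iffLR (fE _ _) fz).
  + exact: (iffRL (fE _ _) f0).
  + by move=> k /fk[z fz]; exists z; exact: (iffRL (fE _ _) fz).
Qed.

Lemma characteristicP X n : characteristic X n = `[<X n>].
Proof. by rewrite /characteristic. Qed.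

Lemma characteristic_bit u n : characteristic (canonical_set u) n = bit u n.
Proof. by rewrite characteristicP; congr nat_of_bool; apply/asboolP/idP. Qed.

Lemma characteristic_set0 n : characteristic set0 n = 0.
Proof. by rewrite characteristicP; case: asboolP. Qed.

Lemma characteristic_eq X Y n : (X n <-> Y n) -> characteristic X n = characteristic Y n.
Proof. by move=> XY; rewrite !characteristicP; congr nat_of_bool; apply/asboolP/asboolP => /XY. Qed.

Lemma co_oracle D (Y : set nat -> set nat) F :
  computable_on D (fun X => characteristic (Y X)) ->
  computable_on (Y @` D) F -> computable_on D (fun X => F (Y X)).
Proof.
move=> [q hq] [e he].
exists (Comp (psubst (Comp q Snd) e) (Pair Zero (Pair Fst Snd))) => X DX x /=.
exists (pair_code 0 x).
  exists 0, x; split=> //; exists (unpair1 x), (unpair2 x).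
  by split=> //; rewrite unpairK.
apply/run_psubst; apply: (@grun_mono (fun z v => v = characteristic (Y X) z)).
  move=> z v -> /=; exists z => //; last exact: hq.
  by rewrite -/(unpair2 _) unpairE.
by rewrite -run_grun; apply: he; exists X.
Qed.

(** With the finite oracle made part of the input, the axioms of a Turing functional form a c.e.
    set, that is, an enumeration operator. *)
Lemma run_canonical_oracle e :
  exists e', forall X u x y,
    run X e' (pair_code u x) y <-> run (canonical_set u) e x y.
Proof.
have [q hq] : computable_on setT (fun X z => bit (unpair1 z) (unpair2 z)) by co.
exists (psubst q e) => X u x y; rewrite run_psubst (run_grun (canonical_set u)).
have qE z v : run X q (pair_code u z) v <-> v = characteristic (canonical_set u) z.
  have := hq X I (pair_code u z); rewrite !unpairE characteristic_bit => h.
  by split=> [h'|->//]; exact: run_functional h' h.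
by split; apply: grun_mono => z v /qE.
Qed.

(** * A universal machine *)

Fixpoint program_code (e : program) : nat :=
  match e with
  | Zero => pair_code 0 0
  | Succ => pair_code 1 0
  | Fst => pair_code 2 0
  | Snd => pair_code 3 0
  | Query => pair_code 4 0
  | Pair f g => pair_code 5 (pair_code (program_code f) (program_code g))
  | Comp f g => pair_code 6 (pair_code (program_code f) (program_code g))
  | Prec f g => pair_code 7 (pair_code (program_code f) (program_code g))
  | Mu f => pair_code 8 (program_code f)
  end.

(* What remains to be done with the current value: run a program on it, or
   finish a [Pair], [Prec] or [Mu] whose next component it is. *)
Inductive frame : Type :=
| Eval of program
| PairFst of program & nat
| PairSnd of nat
| PrecLoop of program & nat & nat & nat
| MuLoop of program & nat & nat.

Definition frame_code (fr : frame) : nat :=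
  match fr with
  | Eval e => program_code e
  | PairFst g x => pair_code 9 (pair_code (program_code g) x)
  | PairSnd u => pair_code 10 u
  | PrecLoop g a n i =>
      pair_code 11 (pair_code (program_code g) (pair_code (pair_code a n) i))
  | MuLoop f x i => pair_code 12 (pair_code (program_code f) (pair_code x i))
  end.

Definition push (fr k : nat) : nat := (pair_code fr k).+1.

Fixpoint stack_code (k : seq frame) : nat :=
  if k is fr :: k' then push (frame_code fr) (stack_code k') else 0.

(** A state pairs a stack with the current value. The successor in [push] tells a nonempty stack
    from the empty one, 0. Tag 4, a query, gets the answer 0 of the empty oracle; the last branch is
    [MuLoop]. *)
Definition machine_step (st : nat) : nat :=
  let k := (unpair1 st).-1 in let v := unpair2 st in
  let t := unpair1 (unpair1 k) in let d := unpair2 (unpair1 k) in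
  let d1 := unpair1 d in let d2 := unpair2 d in
  let r := unpair2 k in
  if unpair1 st == 0 then st
  else if t == 0 then pair_code r 0
  else if t == 1 then pair_code r v.+1
  else if t == 2 then pair_code r (unpair1 v)
  else if t == 3 then pair_code r (unpair2 v)
  else if t == 4 then pair_code r 0
  else if t == 5 then
    pair_code (push d1 (push (pair_code 9 (pair_code d2 v)) r)) v
  else if t == 6 then pair_code (push d2 (push d1 r)) v
  else if t == 7 then
    pair_code (push d1 (push (pair_code 11 (pair_code d2 (pair_code v 0))) r))
              (unpair1 v)
  else if t == 8 then
    pair_code (push d (push (pair_code 12 (pair_code d (pair_code v 0))) r))
              (pair_code v 0)
  else if t == 9 then pair_code (push d1 (push (pair_code 10 v) r)) d2
  else if t == 10 then pair_code r (pair_code d v)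
  else if t == 11 then
    if unpair2 d2 == unpair2 (unpair1 d2) then pair_code r v
    else pair_code
      (push d1 (push (pair_code 11 (pair_code d1
         (pair_code (unpair1 d2) (unpair2 d2).+1))) r))
      (pair_code (unpair1 (unpair1 d2)) (pair_code (unpair2 d2) v))
  else if v == 0 then pair_code r (unpair2 d2)
  else pair_code
    (push d1 (push (pair_code 12 (pair_code d1
       (pair_code (unpair1 d2) (unpair2 d2).+1))) r))
    (pair_code (unpair1 d2) (unpair2 d2).+1).

Lemma co_machine_step D F :
  computable_on D F -> computable_on D (fun X x => machine_step (F X x)).
Proof.
apply: (@co_comp D (fun _ => machine_step)).
by rewrite /machine_step /push; co.
Qed.
#[global] Hint Resolve co_machine_step : co.

(** [run] unfolds [Prec] downwards from the last index, the machine works upwards; this is the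
    upward reading, with [k] rounds left from the value [s] at index [i]. *)
Fixpoint prec_from (g : program) (a k i s r : nat) : Prop :=
  if k is k'.+1 then
    exists2 s', run set0 g (pair_code a (pair_code i s)) s' &
      prec_from g a k' i.+1 s' r
  else r = s.

Definition frame_run (fr : frame) (v r : nat) : Prop :=
  match fr with
  | Eval e => run set0 e v r
  | PairFst g x => exists2 w, run set0 g x w & r = pair_code v w
  | PairSnd u => r = pair_code u v
  | PrecLoop g a n i => i <= n /\ prec_from g a (n - i) i v r
  | MuLoop f x i =>
      if v == 0 then r = i else
        [/\ i < r, run set0 f (pair_code x r) 0 &
          forall k, i < k < r -> exists z, run set0 f (pair_code x k) z.+1]
  end.

Fixpoint stack_run (k : seq frame) (v r : nat) : Prop :=
  if k is fr :: k' then exists2 w, frame_run fr v w & stack_run k' w r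
  else r = v.

Lemma machine_stepE fr r v :
  machine_step (pair_code (push fr r) v) =
  let t := unpair1 fr in let d := unpair2 fr in
  let d1 := unpair1 d in let d2 := unpair2 d in
  if t == 0 then pair_code r 0
  else if t == 1 then pair_code r v.+1
  else if t == 2 then pair_code r (unpair1 v)
  else if t == 3 then pair_code r (unpair2 v)
  else if t == 4 then pair_code r 0
  else if t == 5 then
    pair_code (push d1 (push (pair_code 9 (pair_code d2 v)) r)) v
  else if t == 6 then pair_code (push d2 (push d1 r)) v
  else if t == 7 then
    pair_code (push d1 (push (pair_code 11 (pair_code d2 (pair_code v 0))) r))
              (unpair1 v)
  else if t == 8 then
    pair_code (push d (push (pair_code 12 (pair_code d (pair_code v 0))) r))
              (pair_code v 0)
  else if t == 9 then pair_code (push d1 (push (pair_code 10 v) r)) d2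
  else if t == 10 then pair_code r (pair_code d v)
  else if t == 11 then
    if unpair2 d2 == unpair2 (unpair1 d2) then pair_code r v
    else pair_code
      (push d1 (push (pair_code 11 (pair_code d1
         (pair_code (unpair1 d2) (unpair2 d2).+1))) r))
      (pair_code (unpair1 (unpair1 d2)) (pair_code (unpair2 d2) v))
  else if v == 0 then pair_code r (unpair2 d2)
  else pair_code
    (push d1 (push (pair_code 12 (pair_code d1
       (pair_code (unpair1 d2) (unpair2 d2).+1))) r))
    (pair_code (unpair1 d2) (unpair2 d2).+1).
Proof. by rewrite /machine_step /push !unpairE /= ?unpairE. Qed.

Lemma prec_from_value f g a k i s r :
  run set0 (Prec f g) (pair_code a i) s -> prec_from g a k i s r ->
  run set0 (Prec f g) (pair_code a (i + k)) r.
Proof.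
elim: k i s => [|k IH] i s fs /=; first by move=> ->; rewrite addn0.
move=> [s' gs' ps']; rewrite -addSnnS; apply: IH ps'.
move: fs; rewrite /= -!/(unpair1 _) -!/(unpair2 _) !unpairE /= => fs.
by exists s.
Qed.

Lemma prec_from_rcons g a k i s t r :
  prec_from g a k i s t -> run set0 g (pair_code a (pair_code (i + k) t)) r ->
  prec_from g a k.+1 i s r.
Proof.
elim: k i s => [|k IH] i s /=; first by move=> -> gr; exists r => //; rewrite addn0 in gr.
move=> [s' gs' ps'] gr; exists s' => //; apply: IH => //.
by rewrite addSnnS.
Qed.

Lemma prec_value_from f g x y :
  run set0 (Prec f g) x y ->
  exists2 s, run set0 f (unpair1 x) s & prec_from g (unpair1 x) (unpair2 x) 0 s y.
Proof.
rewrite /= -/(unpair1 x) -/(unpair2 x).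
elim: (unpair2 x) y => [|n IH] y; first by exists y.
move=> [s /IH[s' fs' ps'] gs]; exists s' => //.
exact: (prec_from_rcons ps' gs).
Qed.

Lemma machine_step_sound fr k v :
  exists k' v',
    machine_step (pair_code (stack_code (fr :: k)) v) =
      pair_code (stack_code k') v' /\
    forall y, stack_run k' v' y -> stack_run (fr :: k) v y.
Proof.
rewrite /= machine_stepE.
case: fr => [[||||| f g | f g | f g | f] | g x | u | g a n i | f x i] /=;
  rewrite ?unpairE /=.
- by exists k, 0; split=> // y ky; exists 0.
- by exists k, v.+1; split=> // y ky; exists v.+1.
- by exists k, (unpair1 v); split=> // y ky; exists (unpair1 v).
- by exists k, (unpair2 v); split=> // y ky; exists (unpair2 v).
- exists k, 0; split=> // y ky; exists 0 => //.
  by rewrite characteristic_set0.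
- exists (Eval f :: PairFst g v :: k), v; split=> // y [w fw [w' [w'' gw'' ->] kw']].
  by exists (pair_code w w'') => //; exists w, w''.
- exists (Eval g :: Eval f :: k), v; split=> // y [w gw [w' fw' kw']].
  by exists w' => //; exists w.
- exists (Eval f :: PrecLoop g (unpair1 v) (unpair2 v) 0 :: k), (unpair1 v).
  split; first by rewrite /= unpairK.
  move=> y [w fw [w' [_ pw'] kw']]; exists w' => //=.
  rewrite subn0 in pw'; have := @prec_from_value f g (unpair1 v) _ 0 w w' _ pw'.
  rewrite add0n unpairK; apply.
  by rewrite /= -!/(unpair1 _) -!/(unpair2 _) !unpairE.
- exists (Eval f :: MuLoop f v 0 :: k), (pair_code v 0).
  split=> // y [w fw [w' mw' kw']]; exists w' => //=.
  rewrite /= in mw' fw; case: (w =P 0) mw' fw => [-> /= -> f0|w0 /= [w'0 fw' fk] fw]; first by split.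
  split=> // -[|j] lt_jw'; last exact: fk.
  by exists w.-1; rewrite prednK // lt0n; apply/eqP.
- exists (Eval g :: PairSnd v :: k), x; split=> // y [w gw [w' -> kw']].
  by exists (pair_code v w) => //; exists w.
- by exists k, (pair_code u v); split=> // y ky; exists (pair_code u v).
- case: (i =P n) => [->|ne_in].
    by exists k, v; split=> // y ky; exists v; rewrite // subnn.
  exists (Eval g :: PrecLoop g a n i.+1 :: k), (pair_code a (pair_code i v)).
  split=> // y [w gw [w' [lt_in pw'] kw']]; exists w' => //; split; first exact: ltnW.
  by rewrite -subnSK //; exists w.
- case: (v =P 0) => [_|v0].
    by exists k, i; split=> // y ky; exists i.
  exists (Eval f :: MuLoop f x i.+1 :: k), (pair_code x i.+1).
  split=> // y [w fw [w' mw' kw']]; exists w' => //.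
  rewrite /= in mw' fw; case: (w =P 0) mw' fw => [-> /= -> f0|w0 /= [w'0 fw' fk] fw].
    by split=> // j; rewrite ltnS => /andP[h1 h2]; move: (leq_trans h1 h2); rewrite ltnn.
  split=> // [|j /andP[]]; first exact: ltnW.
  rewrite leq_eqVlt => /predU1P[<- _|lt_ij lt_jw']; last by apply: fk; rewrite lt_ij.
  by exists w.-1; rewrite prednK // lt0n; apply/eqP.
Qed.

Lemma machine_sound k v t y :
  iter t machine_step (pair_code (stack_code k) v) = pair_code 0 y -> stack_run k v y.
Proof.
elim: t k v => [|t IH] k v /=.
  by move=> /pair_code_inj[]; case: k => [_ ->|fr k].
rewrite -iterS iterSr; case: k => [|fr k].
  by rewrite /machine_step unpairE /=; exact: (IH [::]).
by have [k' [v' [-> kk']]] := machine_step_sound fr k v; move=> /IH /kk'.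
Qed.

Definition machine_reaches st st' := exists t, iter t machine_step st = st'.

Lemma machine_reaches_step st st' :
  machine_reaches (machine_step st) st' -> machine_reaches st st'.
Proof. by move=> [t <-]; exists t.+1; rewrite iterSr. Qed.

Lemma machine_reaches_trans st st' st'' :
  machine_reaches st st' -> machine_reaches st' st'' -> machine_reaches st st''.
Proof. by move=> [t <-] [t' <-]; exists (t' + t); rewrite iterD. Qed.

Lemma machine_complete e r x y :
  run set0 e x y ->
  machine_reaches (pair_code (push (program_code e) r) x) (pair_code r y).
Proof.
elim: e r x y => [|||||f IHf g IHg|f IHf g IHg|f IHf g IHg|f IHf] r x y /=.
- by move=> ->; exists 1; rewrite /= machine_stepE ?unpairE /= ?unpairE.
- by move=> ->; exists 1; rewrite /= machine_stepE ?unpairE /= ?unpairE.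
- by move=> ->; exists 1; rewrite /= machine_stepE ?unpairE /= ?unpairE.
- by move=> ->; exists 1; rewrite /= machine_stepE ?unpairE /= ?unpairE.
- by move=> ->; exists 1; rewrite /= machine_stepE ?unpairE /= ?unpairE characteristic_set0.
- move=> [u [v [/IHf fu /IHg gv ->]]]; apply: machine_reaches_step.
  rewrite machine_stepE ?unpairE /= ?unpairE /=; apply: machine_reaches_trans (fu _) _.
  apply: machine_reaches_step; rewrite machine_stepE ?unpairE /= ?unpairE /=.
  apply: machine_reaches_trans (gv _) _.
  by exists 1; rewrite /= machine_stepE ?unpairE /= ?unpairE.
- move=> [z /IHg gz /IHf fz]; apply: machine_reaches_step.
  rewrite machine_stepE ?unpairE /= ?unpairE /=; apply: machine_reaches_trans (gz _) _.
  exact: fz.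
- move=> /(@prec_value_from f g)[s fs gs]; apply: machine_reaches_step.
  rewrite machine_stepE ?unpairE /= ?unpairE.
  apply: machine_reaches_trans (IHf _ _ _ fs) _.
  suff loop k i s' : i + k = unpair2 x -> prec_from g (unpair1 x) k i s' y ->
      machine_reaches (pair_code (push (pair_code 11
        (pair_code (program_code g) (pair_code x i))) r) s') (pair_code r y).
    exact: loop gs.
  elim: k i s' {s fs gs} => [|k IH] i s' ik /=.
    move=> ->; exists 1.
    by rewrite /= machine_stepE ?unpairE /= ?unpairE -ik addn0 eqxx.
  move=> [t /IHg gt pt]; apply: machine_reaches_step.
  rewrite machine_stepE ?unpairE /= ?unpairE ltn_eqF; last by lia.
  by apply: machine_reaches_trans (gt _) _; apply: IH => //; lia.
- move=> [f0 fk]; apply: machine_reaches_step; rewrite machine_stepE ?unpairE /= ?unpairE /=.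
  have {f0}: exists2 v, run set0 f (pair_code x y) v & machine_reaches (pair_code
      (push (pair_code 12 (pair_code (program_code f) (pair_code x y))) r) v)
      (pair_code r y).
    by exists 0 => //; exists 1; rewrite /= machine_stepE ?unpairE /= ?unpairE.
  (* Downward induction from the least zero [y] to index 0: a nonzero value at [n] passes the search
     on to [n.+1]. *)
  have : y <= y by [].
  elim: {1 3 4}y => [|n IHn] le_n [v fv hv].
    exact: machine_reaches_trans (IHf _ _ _ fv) hv.
  apply: IHn; first exact: ltnW.
  have [z fz] := fk n le_n; exists z.+1 => //.
  apply: machine_reaches_step; rewrite machine_stepE ?unpairE /= ?unpairE /=.
  exact: machine_reaches_trans (IHf _ _ _ fv) hv.
Qed.

Definition universal (z : nat) : nat :=
  let st := iter (unpair2 (unpair2 z)) machine_step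
    (pair_code (push (unpair1 z) 0) (unpair1 (unpair2 z))) in
  if unpair1 st == 0 then (unpair2 st).+1 else 0.

(* [0] if the program with code [c] has not halted on [x] within [s] steps, and
   one more than its value otherwise. *)
Definition univ c x s : nat := universal (pair_code c (pair_code x s)).

Lemma co_univ D F G H :
  computable_on D F -> computable_on D G -> computable_on D H ->
  computable_on D (fun X x => univ (F X x) (G X x) (H X x)).
Proof.
move=> cF cG cH; apply: (@co_comp D (fun _ => universal)); last by co.
by rewrite /universal /push; co.
Qed.
#[global] Hint Resolve co_univ : co.

Lemma univP e x y :
  run set0 e x y <-> exists s, univ (program_code e) x s = y.+1.
Proof.
rewrite /univ /universal; split.
  move=> /(@machine_complete _ 0)[t ht]; exists t.
  by rewrite !unpairE ht !unpairE.
move=> [s]; rewrite !unpairE; case: eqP => // st0 [sty].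
have [w ew yw] : stack_run [:: Eval e] x y.
  by apply: (@machine_sound _ _ s); rewrite -[LHS]unpairK st0 sty.
by rewrite yw.
Qed.

Lemma univ_mono c x s s' y :
  s <= s' -> univ c x s = y.+1 -> univ c x s' = y.+1.
Proof.
rewrite /univ /universal !unpairE => /subnK <-; case: eqP => // st0 [sty].
have step0 t v : iter t machine_step (pair_code 0 v) = pair_code 0 v.
  by elim: t => [//|t /= ->]; rewrite /machine_step unpairE.
by rewrite iterD -[iter s _ _]unpairK st0 step0 !unpairE sty.
Qed.

(** * Computably enumerable sets and infinite sets *)

Lemma computable_absolute D (f : nat -> nat) :
  computable_on [set set0] (fun _ => f) -> computable_on D (fun _ => f).
Proof.
move=> cf; apply: (@co_oracle D (fun _ => set0) (fun _ => f)).
  by apply: computable_on_ext (co_const D 0) => X x _; rewrite characteristic_set0.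
by apply: computable_on_sub cf => _ [X _ <-].
Qed.

Lemma turing_reducibleP A X :
  turing_reducible A X <-> computable_on [set X] (fun _ => characteristic A).
Proof.
by split=> -[e he]; exists e; [move=> _ -> | exact: he].
Qed.

Lemma ce_search (r : nat -> nat -> bool) :
  computable_on [set set0] (fun _ z => r (unpair1 z) (unpair2 z)) ->
  ce [set n | exists s, r n s].
Proof.
move=> /(@partial_search _ (fun _ => r))[e he]; exists e.
apply/seteqP; split=> n [s].
  move=> rns; exists (ex_minn (ex_intro _ s rns)); apply/he => //.
  case: ex_minnP => m rm min; split=> // k; apply: contraLR.
  by rewrite negbK -leqNgt; exact: min.
by move=> /(iffLR (he _ erefl _ _))[rns _]; exists s.
Qed.

Lemma ce_univ A :
  ce A -> exists c, forall n, A n <-> exists s, 0 < univ c n s.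
Proof.
move=> [e ->]; exists (program_code e) => n; split=> [[y /univP[s hs]]|[s]].
  by exists s; rewrite hs.
by case en: (univ _ _ _) => [//|y] _; exists y; apply/univP; exists s.
Qed.

Lemma ce_run e y : ce [set z | run set0 e z y].
Proof.
have -> : [set z | run set0 e z y] =
    [set z | exists s, univ (program_code e) z s == y.+1].
  apply/seteqP; split=> z /=; first by move=> /univP[s hs]; exists s; rewrite hs.
  by move=> [s /eqP zs]; apply/univP; exists s.
by apply: ce_search; co.
Qed.

Lemma infinite_natP (C : set nat) :
  infinite_set C <-> forall m, exists2 n, m <= n & C n.
Proof.
split=> [infC m|h /finite_seqP[s Cs]].
  apply: contrapT => nC; apply: infC; apply: (@sub_finite_set _ _ `I_m).
    move=> n Cn /=; rewrite ltnNge; apply/negP => le_mn.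
    by apply: nC; exists n.
  exact: finite_II.
have [n le_n Cn] := h (foldr maxn 0 s).+1.
have : n \in s by move: Cn; rewrite Cs.
move: le_n; elim: s {Cs} => [//|x s IH] /=; rewrite inE gtn_max => /andP[xn sn].
by move=> /predU1P[nx|/(IH sn)//]; move: xn; rewrite nx ltnn.
Qed.

Definition trunc (X : set nat) (m : nat) : nat := bitmask (fun i => `[<X i>]) m.

#[global] Arguments trunc : simpl never.

Lemma bit_trunc X m i : bit (trunc X m) i = (i < m) && `[<X i>].
Proof. exact: bit_bitmask. Qed.

Lemma canonical_setE u i : canonical_set u i <-> bit u i.
Proof. by []. Qed.

Lemma trunc_sub X m : canonical_set (trunc X m) `<=` X.
Proof. by move=> i /canonical_setE; rewrite bit_trunc => /andP[_ /asboolP]. Qed.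

Definition splice (u m : nat) (C : set nat) : set nat :=
  canonical_set u `|` (C `&` [set i | m <= i]).

Lemma splice_sub u m C A :
  canonical_set u `<=` A -> C `<=` A -> splice u m C `<=` A.
Proof. by move=> uA CA i [/uA //|[/CA]]. Qed.

Lemma splice_infinite u m C : infinite_set C -> infinite_set (splice u m C).
Proof.
move=> /infinite_natP infC; apply/infinite_natP => k.
have [n] := infC (maxn m k); rewrite geq_max => /andP[mn kn] Cn.
by exists n => //; right.
Qed.

Lemma splice_bit u m C i : i < m -> splice u m C i <-> bit u i.
Proof.
move=> im; split=> [[//|[_ /=]]|ui]; first by rewrite leqNgt im.
by left.
Qed.

(** * Principal functions *)

Definition below (A : set nat) (m : nat) : nat := count (mem A) (iota 0 m).

Lemma belowS A m : below A m.+1 = below A m + `[<A m>].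
Proof. by rewrite /below count_iotaS. Qed.

Lemma below_mono A m n : m <= n -> below A m <= below A n.
Proof.
move=> /subnKC <-; elim: (n - m) => [|k IH]; first by rewrite addn0.
by rewrite addnS belowS (leq_trans IH) // leq_addr.
Qed.

Lemma below_leq A m : below A m <= m.
Proof. by rewrite -[leqRHS](size_iota 0 m) count_size. Qed.

Lemma below_sub A B m : A `<=` B -> below A m <= below B m.
Proof.
move=> AB; elim: m => [//|m IH]; rewrite !belowS leq_add //.
by case: asboolP => // /AB Bm; case: asboolP.
Qed.

Lemma below_unbounded A : infinite_set A -> forall n, exists m, n <= below A m.
Proof.
move=> /infinite_natP infA; elim=> [|n [m nm]]; first by exists 0.
have [k mk Ak] := infA m; exists k.+1; rewrite belowS asboolT // addn1 ltnS.
exact: leq_trans nm (below_mono _ mk).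
Qed.

Lemma below_inj A m m' : A m -> A m' -> below A m = below A m' -> m = m'.
Proof.
wlog lt_mm' : m m' / m < m'.
  move=> wlg Am Am' e; case: (ltngtP m m') => // lt; first exact: wlg.
  by apply/esym/wlg.
move=> Am _ e; have := @below_mono A _ _ lt_mm'.
by rewrite belowS asboolT // e addn1 ltnn.
Qed.

Lemma principalP A n :
  infinite_set A -> A (principal A n) /\ below A (principal A n) = n.
Proof.
move=> infA; suff [m [Am nm]] : exists m, A m /\ below A m = n.
  by apply: (@xgetPex _ 0 [set m | A m /\ count (mem A) (iota 0 m) = n]); exists m.
have [m0 h0] := below_unbounded infA n.+1.
have [m] := ex_minnP (ex_intro (fun m => n < below A m) m0 h0).
case: m => [//|m]; rewrite belowS => nm min; exists m.
case: asboolP nm => [Am|_] /=; last by rewrite addn0 => /min; rewrite ltnn.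
rewrite addn1 ltnS leq_eqVlt => /predU1P[->//|/min]; by rewrite ltnn.
Qed.

Lemma principalE A n m : infinite_set A -> A m -> below A m = n -> principal A n = m.
Proof.
move=> infA Am nm; have [Ap np] := principalP n infA.
by apply: below_inj Ap Am _; rewrite np nm.
Qed.

Lemma principal_ltn A n k : infinite_set A -> (principal A n < k) = (n < below A k).
Proof.
move=> infA; have [Ap np] := principalP n infA; apply/idP/idP => [lt_pk|].
  by have := @below_mono A _ _ lt_pk; rewrite belowS asboolT // np addn1.
by apply: contraTltn => le_kp; rewrite -leqNgt -[leqRHS]np below_mono.
Qed.

Lemma principal_lt_mono A n : infinite_set A -> principal A n < principal A n.+1.
Proof. by move=> infA; rewrite principal_ltn // (principalP n.+1 infA).2. Qed.

Lemma principal_sub A C n :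
  C `<=` A -> infinite_set C -> principal A n <= principal C n.
Proof.
move=> CA infC; have infA : infinite_set A := sub_infinite_set CA infC.
rewrite -ltnS principal_ltn //; apply: leq_trans (below_sub _ CA).
by rewrite -principal_ltn // ltnSn.
Qed.

Lemma majorizes_principal A C :
  C `<=` A -> infinite_set C -> majorizes (principal C) A.
Proof. by move=> CA infC n; exact: principal_sub. Qed.

(** * Implications between the classes *)

Lemma computable_ce A : computable A -> ce A.
Proof.
move=> /turing_reducibleP cA.
have -> : A = [set n | exists s : nat, (fun n _ => `[<A n>]) n s].
  by apply/seteqP; split=> n; [move=> An; exists 0; apply/asboolP | case=> _ /asboolP].
apply: ce_search.
apply: (@computable_on_ext _ (fun _ z => characteristic A (unpair1 z))).
  by move=> _ z _; rewrite characteristicP.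
by apply: (@co_comp _ (fun _ => characteristic A)) => //; co.
Qed.

Lemma ce_enum A :
  ce A -> exists2 Theta, ce Theta & forall X, enum_apply Theta X = A.
Proof.
move=> /ce_univ[c Ac].
exists [set z | exists s, 0 < univ c (unpair2 z) s]; first by apply: ce_search; co.
move=> X; apply/seteqP; split=> n.
  by move=> [u [_ /= [s]]]; rewrite unpairE => cns; apply/Ac; exists s.
move=> /Ac[s cns]; exists 0; split; first by move=> i /canonical_setE/bit_ltn.
by exists s; rewrite unpairE.
Qed.

Lemma ce_unif_majorenumerable A : ce A -> unif_majorenumerable A.
Proof. by move=> /ce_enum[Theta cT TA]; exists Theta. Qed.

Lemma ce_unif_introenumerable A : ce A -> unif_introenumerable A.
Proof. by move=> /ce_enum[Theta cT TA]; exists Theta. Qed.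

Lemma characteristic1 A n : characteristic A n = 1 <-> A n.
Proof. by rewrite characteristicP; case: asboolP. Qed.

Lemma functional_enum e :
  exists2 Theta, ce Theta & forall X n,
    enum_apply Theta X n <->
    exists u, canonical_set u `<=` X /\ run (canonical_set u) e n 1.
Proof.
have [e' he'] := run_canonical_oracle e.
exists [set z | run set0 e' z 1]; first exact: ce_run.
by move=> X n; split=> -[u [uX un]]; exists u; split=> //; apply/(he' set0).
Qed.

Lemma truncE X m i : i < m -> bit (trunc X m) i <-> X i.
Proof. by move=> im; rewrite bit_trunc im; split=> [/asboolP//|?]; exact/asboolP. Qed.

Lemma run_trunc X e n y : run X e n y -> exists m, run (canonical_set (trunc X m)) e n y.
Proof.
move=> /run_use[m hm]; exists m; apply: hm => z zm; apply: characteristic_eq.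
by rewrite canonical_setE truncE.
Qed.

(* A computation from a finite part of [C] is also one from an infinite subset of
   [C], which continues that part beyond the use. *)
Lemma unif_introreducible_introenumerable A :
  unif_introreducible A -> unif_introenumerable A.
Proof.
move=> [e he]; have [Theta cT hT] := functional_enum e.
exists Theta => // C CA infC; apply/seteqP; split=> n; last first.
  move=> An; apply/hT; have := he C CA infC n.
  rewrite (iffRL (characteristic1 A n)) // => /run_trunc[m hm].
  by exists (trunc C m); split=> //; exact: trunc_sub.
move=> /hT[u [uC /run_use[m um]]]; apply/characteristic1.
have spA : splice u m C `<=` A by apply: splice_sub => // i /uC /CA.
apply: (run_functional (he _ spA (splice_infinite infC) n)); apply: um => z zm.
by apply: characteristic_eq; rewrite splice_bit.
Qed.

Lemma graphE f x y : graph f (pair_code x y) <-> f x = y.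
Proof. by split=> [[n _ /pair_code_inj[-> //]]|<-]; exists x. Qed.

Lemma graph_unpair f z : graph f z <-> f (unpair1 z) = unpair2 z.
Proof. by rewrite -{1}(unpairK z) graphE. Qed.

(** A computation from a part [D_u] of the graph of [f] also occurs with a full oracle: [g] keeps
    the values recorded in [D_u] and raises the others by the use [m], so that its graph agrees with
    [D_u] below [m] while [g] still majorizes [A]. *)
Lemma unif_majorreducible_majorenumerable A :
  unif_majorreducible A -> unif_majorenumerable A.
Proof.
move=> [e he]; have [Theta cT hT] := functional_enum e.
exists Theta => // f fA; apply/seteqP; split=> n; last first.
  move=> An; apply/hT; have := he f fA n.
  rewrite (iffRL (characteristic1 A n)) // => /run_trunc[m hm].
  by exists (trunc (graph f) m); split=> //; exact: trunc_sub.
move=> /hT[u [uf /run_use[m um]]]; apply/characteristic1.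
pose g i := if `[<exists v, bit u (pair_code i v)>] then f i else f i + m.
have gA : majorizes g A.
  by move=> i; rewrite /g; case: ifP => // _; apply: leq_trans (fA i) (leq_addr _ _).
apply: (run_functional (he _ gA n)); apply: um => z zm.
apply: characteristic_eq; rewrite graph_unpair canonical_setE /g.
case: asboolP => [[v uv]|nv].
  have /graphE fv := uf _ uv; rewrite -{1}(unpairK z).
  by split=> [/uf/graphE //|fz]; rewrite -fz fv.
split=> [uz|mz]; first by case: nv; exists (unpair2 z); rewrite unpairK.
by have := leq_unpair2 z; lia.
Qed.

(** [inside u] reads [D_u] as an initial segment of [C] and yields pieces of its principal function.
    If [D_u] has gaps these are wrong for [C], but they are right for [splice u u C], another
    infinite subset of [A], so nothing outside [A] is enumerated. *)
Lemma unif_majorenumerable_introenumerable A :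
  unif_majorenumerable A -> unif_introenumerable A.
Proof.
move=> [Theta /ce_univ[c hc] hT].
pose inside u z := bit u (unpair2 z) &&
  (count (bit u) (iota 0 (unpair2 z)) == unpair1 z).
pose r z w := (0 < univ c (pair_code (unpair1 w) (unpair2 z)) (unpair2 w)) &&
  all (fun i => bit (unpair1 w) i ==> inside (unpair1 z) i) (iota 0 (unpair1 w)).
have insideE u m C i : infinite_set C -> (forall j, j < m -> C j <-> bit u j) ->
    unpair2 i < m -> inside u i <-> graph (principal C) i.
  move=> infC Cu i2m; rewrite graph_unpair /inside.
  have -> : count (bit u) (iota 0 (unpair2 i)) = below C (unpair2 i).
    apply: eq_in_count => j; rewrite mem_iota => /andP[_ jm].
    by apply/idP/asboolP => /(Cu _ (ltn_trans jm i2m)).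
  split=> [/andP[ui /eqP]|pi].
    by apply: principalE => //; exact/Cu.
  have [Cp <-] := principalP (unpair1 i) infC.
  by rewrite pi eqxx andbT; apply/Cu => //; rewrite -pi.
exists [set z | exists w, r z w]; first by apply: ce_search; rewrite /r /inside; co.
move=> C CA infC; apply/seteqP; split=> n.
  move=> [u [uC [w /andP[]]]]; rewrite !unpairE => cw /all_iotaP inw.
  pose C' := splice u u C.
  have C'A : C' `<=` A by apply: splice_sub => // i /uC /CA.
  have infC' : infinite_set C' by exact: splice_infinite.
  rewrite -(hT _ (majorizes_principal C'A infC')).
  exists (unpair1 w); split; last by apply/hc; exists (unpair2 w).
  move=> i /canonical_setE wi; have := inw i (bit_ltn wi); rewrite wi /= => ui.
  have i2u : unpair2 i < u by case/andP: ui => /bit_ltn.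
  by apply/(insideE u u C') => // j ju; exact: splice_bit.
move=> An; have majC := majorizes_principal CA infC.
move: (An); rewrite -{1}(hT _ majC) => -[v [vC /hc[s vs]]].
exists (trunc C v); split; first exact: trunc_sub.
exists (pair_code v s); rewrite /r !unpairE vs /=; apply/all_iotaP => i iv.
apply/implyP => vi; apply/(insideE _ v C) => //; last exact: vC.
  by move=> j jv; rewrite truncE.
exact: leq_ltn_trans (leq_unpair2 i) iv.
Qed.

Lemma majorreducible_introreducible A : majorreducible A -> introreducible A.
Proof.
move=> hA C CA infC; apply/turing_reducibleP.
have /turing_reducibleP cA := hA _ (majorizes_principal CA infC).
apply: (@co_oracle [set C] (fun C => graph (principal C)) (fun _ => characteristic A));
  last by apply: computable_on_sub cA => _ [_ -> <-].
pose F X z := (characteristic X (unpair2 z) == 1) &&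
  (count (fun i => characteristic X i == 1) (iota 0 (unpair2 z)) == unpair1 z).
apply: (@computable_on_ext _ F); last by rewrite /F; co.
move=> _ z ->; rewrite characteristicP /F; congr nat_of_bool.
have -> : count (fun i => characteristic C i == 1) (iota 0 (unpair2 z)) = below C (unpair2 z).
  by apply: eq_count => i; rewrite characteristicP eqb1.
rewrite characteristicP eqb1; apply/andP/asboolP => [[/asboolP Cz /eqP zC]|].
  by apply/graph_unpair; exact: principalE.
move=> /graph_unpair pz; have [Cp zp] := principalP (unpair1 z) infC.
by rewrite -pz zp eqxx; split=> //; exact/asboolP.
Qed.

(** Negative facts about the graph of a function follow from positive ones: [(x, y)] is absent once
    another [(x, y')] is present. A query is therefore answered only if [D_u] contains some value at
    [x], which is what [known] tests. *)
Lemma turing_graph_enum A f : turing_reducible A (graph f) -> enum_reducible A (graph f).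
Proof.
move=> [e he].
pose known u z := has (fun w => bit u w && (unpair1 w == unpair1 z)) (iota 0 u).
have [q hq] : exists q, forall X, setT X -> forall x y, run X q x y <->
    known (unpair1 x) (unpair2 x) && (y == bit (unpair1 x) (unpair2 x)) /\ forall k, k < y -> ~~ (known (unpair1 x) (unpair2 x) &&
                           (k == bit (unpair1 x) (unpair2 x))).
  by apply: partial_search; rewrite /known; co.
have {}hq u z v : run set0 q (pair_code u z) v <-> known u z /\ v = bit u z.
  rewrite hq // !unpairE; split=> [[/andP[-> /eqP]]//|[-> ->]].
  by split=> [|k kb]; rewrite ?eqxx // ltn_eqF.
exists [set z | run set0 (psubst q e) z 1]; first exact: ce_run.
apply/seteqP; split=> n.
  move=> [u [uf /run_psubst un]]; apply/characteristic1.
  apply: (run_functional (he n)); rewrite run_grun; apply: grun_mono un.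
  move=> z v /hq[/has_iotaP[w _ /andP[uw /eqP wz]] ->].
  rewrite characteristicP; congr nat_of_bool; apply/idP/asboolP => [/uf //|].
  have /graph_unpair := uf _ uw; rewrite wz => fw /graph_unpair; rewrite fw => w2.
  by rewrite -(unpairK z) -wz -w2 unpairK.
move=> /characteristic1 An; have := he n; rewrite An run_grun => /grun_use[m hm].
have [||M hM] := @bounded_choice (fun i M => pair_code i (f i) < M) m.
- by move=> i M M' MM' /leq_trans; apply.
- by move=> i _; exists (pair_code i (f i)).+1.
exists (trunc (graph f) M); split; first exact: trunc_sub.
apply/run_psubst; apply: grun_mono hm => z v [zm ->]; apply/hq.
have zM : pair_code (unpair1 z) (f (unpair1 z)) < M.
  by apply: hM; exact: leq_ltn_trans (leq_unpair1 z) zm.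
split.
  have bz : bit (trunc (graph f) M) (pair_code (unpair1 z) (f (unpair1 z))).
    by apply/truncE => //; exact/graphE.
  apply/has_iotaP; exists (pair_code (unpair1 z) (f (unpair1 z))); first exact: bit_ltn.
  by rewrite bz unpairE eqxx.
rewrite characteristicP; congr nat_of_bool; rewrite bit_trunc.
case: asboolP => [/graph_unpair fz|]; last by rewrite andbF.
by rewrite andbT -(unpairK z) -fz zM.
Qed.

Lemma majorreducible_majorenumerable A : majorreducible A -> majorenumerable A.
Proof. by move=> hA f fA; apply: turing_graph_enum; exact: hA. Qed.

(* Iterates [s]-step approximations of the partial function with code [c];
   [0] stands for a computation that has not converged, [x.+1] for [x]. *)
Definition univ_iter (c s j x : nat) : nat :=
  iter j (fun v => if v == 0 then 0 else univ c v.-1 s) x.+1.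

Lemma co_univ_iter D F G H K :
  computable_on D F -> computable_on D G -> computable_on D H -> computable_on D K ->
  computable_on D (fun X x => univ_iter (F X x) (G X x) (H X x) (K X x)).
Proof.
move=> cF cG cH cK.
apply: (@computable_on_ext _ (fun X x =>
  (fun z => univ_iter (unpair1 z) (unpair1 (unpair2 z))
    (unpair1 (unpair2 (unpair2 z))) (unpair2 (unpair2 (unpair2 z))))
  (pair_code (F X x) (pair_code (G X x) (pair_code (H X x) (K X x)))))).
  by move=> X x _; rewrite !unpairE.
apply: (@co_comp D (fun _ z => univ_iter (unpair1 z) (unpair1 (unpair2 z))
    (unpair1 (unpair2 (unpair2 z))) (unpair2 (unpair2 (unpair2 z))))); last by co.
by rewrite /univ_iter; co.
Qed.
#[global] Hint Resolve co_univ_iter : co.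

Definition minimize (P : pred nat) : nat :=
  xget 0 [set y | P y /\ forall k, k < y -> ~~ P k].

Lemma minimizeP (P : pred nat) :
  (exists y, P y) -> P (minimize P) /\ forall k, k < minimize P -> ~~ P k.
Proof.
move=> exP; apply: (@xgetPex _ 0 [set y | P y /\ forall k, k < y -> ~~ P k]).
case: (ex_minnP exP) => m Pm min; exists m; split=> // k.
by apply: contraTN => /min; rewrite -leqNgt.
Qed.

Lemma co_minimize D (P : set nat -> nat -> pred nat) :
  computable_on D (fun X z => P X (unpair1 z) (unpair2 z)) ->
  (forall X x, D X -> exists y, P X x y) ->
  computable_on D (fun X x => minimize (P X x)).
Proof.
by move=> cP exP; apply: co_search cP _ => X x DX; apply: minimizeP; exact: exP.
Qed.

Section Backwards.
Variables (phi : program) (a : nat -> nat).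
Hypothesis back : steps_back phi a.
Let c := program_code phi.

Lemma univ_steps_back n s : univ c (a n) s = 0 \/ univ c (a n) s = (a n.-1).+1.
Proof.
case e: (univ _ _ _) => [|y]; [by left | right; congr _.+1].
have /(@run_functional set0 phi (a n) y) : run set0 phi (a n) y.
  by apply/univP; exists s.
by apply; case: n {e} => [|n]; apply back.
Qed.

Lemma univ_iter_steps_back n s j :
  univ_iter c s j (a n) = 0 \/ univ_iter c s j (a n) = (a (n - j)).+1.
Proof.
elim: j => [|j IH]; first by right; rewrite subn0.
rewrite /univ_iter iterS -/(univ_iter c s j (a n)).
by case: IH => ->; [left | rewrite subnS /=; exact: univ_steps_back].
Qed.

Lemma univ_iter_converges n :
  exists s, forall j, univ_iter c s j (a n) = (a (n - j)).+1.
Proof.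
have [||s hs] := @bounded_choice (fun k s => univ c (a k) s = (a k.-1).+1) n.+1.
- by move=> k s s' ss' h; exact: univ_mono h.
- by move=> k _; apply/univP; case: k => [|k]; apply back.
exists s; elim=> [|j IH]; first by rewrite subn0.
rewrite /univ_iter iterS -/(univ_iter c s j (a n)) IH /= hs; last by rewrite ltnS leq_subr.
by rewrite subnS.
Qed.

End Backwards.

Lemma univ_iter0 c s j j' x :
  j <= j' -> univ_iter c s j x = 0 -> univ_iter c s j' x = 0.
Proof.
move=> /subnK <-; rewrite /univ_iter iterD => ->.
by elim: (j' - j) => [//|k /= ->].
Qed.

(** An element [a i] of [C] yields every [a j] with [j <= i] by iteration, and [C] contains elements
    of arbitrarily large index. Nothing else appears, since the iteration stays at [a 0]. *)
Lemma regressive_unif_introenumerable A : regressive A -> unif_introenumerable A.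
Proof.
move=> [a [_ aA [phi back]]]; pose c := program_code phi.
exists [set z | exists w, bit (unpair1 z) (unpair1 w) &&
    (univ_iter c (unpair2 (unpair2 w)) (unpair1 (unpair2 w)) (unpair1 w)
       == (unpair2 z).+1)].
  by apply: ce_search; co.
move=> C CA infC; apply/seteqP; split=> n.
  move=> [u [uC [w /andP[]]]]; rewrite !unpairE => /uC/CA.
  rewrite -aA => -[i _ <-] /eqP wn.
  case: (univ_iter_steps_back back i (unpair2 (unpair2 w)) (unpair1 (unpair2 w))).
    by rewrite wn.
  by rewrite wn => -[->]; exists (i - unpair1 (unpair2 w)).
rewrite -{1}aA => -[k _ <-].
have [||m hm] := @bounded_choice (fun i m => a i < m) k.
- by move=> i m m' mm' /leq_trans; apply.
- by move=> i _; exists (a i).+1.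
have [x mx Cx] := iffLR (infinite_natP C) infC m.
have : A x by exact: CA.
rewrite -aA => -[i _ ix].
have ki : k <= i by rewrite leqNgt; apply/negP => /hm; rewrite ix ltnNge mx.
have [s hs] := univ_iter_converges back i.
exists (trunc C x.+1); split; first exact: trunc_sub.
exists (pair_code x (pair_code (i - k) s)); rewrite !unpairE.
have := hs (i - k); rewrite ix => ->.
by rewrite subKn // eqxx andbT; apply/truncE.
Qed.

Lemma increasing_ltn_mono (a : nat -> nat) :
  (forall n, a n < a n.+1) -> forall m n, (a m < a n) = (m < n).
Proof.
move=> inc.
have incr m n : m < n -> a m < a n.
  elim: n => [//|n IH]; rewrite ltnS leq_eqVlt => /predU1P[-> //|/IH].
  by move=> /ltn_trans; apply.
move=> m n; case: (ltngtP m n) => [/incr //|/incr /ltnW|->]; last by rewrite ltnn.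
by rewrite leqNgt => /negbTE.
Qed.

Lemma increasing_geq (a : nat -> nat) :
  (forall n, a n < a n.+1) -> forall n, n <= a n.
Proof. by move=> inc; elim=> [//|n IH]; exact: leq_ltn_trans IH (inc n). Qed.

Lemma retraceable_regressive A : retraceable A -> regressive A.
Proof.
move=> [a [inc aA back]]; exists a; split=> // m n e.
by case: (ltngtP m n) => //; rewrite -(increasing_ltn_mono inc) e ltnn.
Qed.

(** In increasing order one element [x >= n] of [C] decides [n], because the elements of [A] up to
    [x] are its iterates. As [i <= a i], [x] itself bounds the number of iterations. *)
Lemma retraceable_unif_introreducible A : retraceable A -> unif_introreducible A.
Proof.
move=> [a [inc aA [phi back]]]; pose c := program_code phi.
pose P X n w := [&& characteristic X (unpair1 w) == 1, n <= unpair1 w &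
  0 < univ_iter c (unpair2 w) (unpair1 w) (unpair1 w)].
pose F X n := let w := minimize (P X n) in
  has (fun j => univ_iter c (unpair2 w) j (unpair1 w) == n.+1) (iota 0 (unpair1 w).+1).
pose D := [set C | C `<=` A /\ infinite_set C].
have exP C n : D C -> exists w, P C n w.
  move=> [CA /infinite_natP/(_ n)[x nx Cx]].
  have : A x by exact: CA.
  rewrite -aA => -[i _ ix]; have [s hs] := univ_iter_converges back i.
  exists (pair_code x s); rewrite /P !unpairE nx (iffRL (characteristic1 C x) Cx) /=.
  by have := hs x; rewrite ix => ->.
suff [e he] : computable_on D (fun _ => characteristic A).
  by exists e => C CA infC; apply: he.
have cP : computable_on D (fun X x => minimize (P X x)).
  by apply: co_minimize => //; rewrite /P; co.
apply: (@computable_on_ext _ F); last first.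
  rewrite /F.
  apply: (@co_has D (fun X n j => univ_iter c (unpair2 (minimize (P X n))) j
    (unpair1 (minimize (P X n))) == n.+1)); first by co.
  have cP' : computable_on D (fun X z => minimize (P X (unpair1 z))).
    by apply: (co_comp cP); co.
  by co.
move=> C n DC; rewrite characteristicP /F; congr nat_of_bool.
have [] := minimizeP (exP C n DC); move: (minimize _) => w.
move=> /and3P[/eqP/characteristic1 Cw nw wpos] _.
have : A (unpair1 w) by case: DC => CA _; exact: CA.
rewrite -aA => -[i _ iw]; move: wpos; rewrite -{1 2}iw => wpos.
have valE j : j <= unpair1 w -> univ_iter c (unpair2 w) j (unpair1 w) = (a (i - j)).+1.
  move=> jw; rewrite -iw; case: (univ_iter_steps_back back i (unpair2 w) j) => // w0.
  by rewrite -iw in jw; move: wpos; rewrite /c (univ_iter0 jw w0).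
apply/has_iotaP/asboolP => [[j jw]|].
  by rewrite valE // => /eqP[<-]; exists (i - j).
move=> [k _ kn]; have ki : k <= i.
  by rewrite leqNgt -(increasing_ltn_mono inc) iw kn -leqNgt.
have iw' : i <= unpair1 w by rewrite -iw increasing_geq.
exists (i - k); first by rewrite ltnS (leq_trans (leq_subr _ _)).
by rewrite valE ?subKn ?kn // (leq_trans (leq_subr _ _)).
Qed.

(** * Forcing with a finite stem and a lower bound *)

(* The condition [(k, g)] fixes the values of [g] below [k] and bounds the
   remaining values from below by [g]. *)
Definition meets (k : nat) (g f : nat -> nat) : Prop :=
  (forall i, i < k -> f i = g i) /\ (forall i, g i <= f i).

Lemma meets_refl k g : meets k g g.
Proof. by []. Qed.

Lemma meets_trans k k' g g' f : k <= k' -> meets k g g' -> meets k' g' f -> meets k g f.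
Proof.
move=> kk' [e1 l1] [e2 l2]; split=> i; last exact: leq_trans (l1 i) (l2 i).
by move=> ik; rewrite e2 ?e1 // (leq_trans ik).
Qed.

Lemma meets_weaken k k' g f : k <= k' -> meets k' g f -> meets k g f.
Proof. by move=> kk'; exact: meets_trans. Qed.

(** A generic function: requirements are met one at a time by longer conditions with bounds in [S],
    and the limit reads its values off the stems. *)
Lemma fusion (S : (nat -> nat) -> Prop) (P : nat -> (nat -> nat) -> Prop) k0 g0 :
  S g0 ->
  (forall e k g, S g -> meets k0 g0 g -> exists k' g',
     [/\ k <= k', S g', meets k g g' & forall f, meets k' g' f -> P e f]) ->
  exists2 f, meets k0 g0 f & forall e, P e f.
Proof.
move=> S0 ext.
pose cond := (nat * (nat -> nat))%type.
pose good (p : cond) := [/\ S p.2, k0 <= p.1 & meets k0 g0 p.2].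
have next (ep : nat * cond) : exists p' : cond, good ep.2 ->
    [/\ good p', ep.2.1 < p'.1, meets ep.2.1 ep.2.2 p'.2 &
        forall f, meets p'.1 p'.2 f -> P ep.1 f].
  case: ep => e [k g] /=; have [Sg|] := pselect (good (k, g)); last first.
    by exists (0, g0).
  case: Sg => /= Sg k0k g0g; have [k' [g' [kk' Sg' gg' Pf]]] := ext e k g Sg g0g.
  (* The successor makes every stem strictly longer, so that the limit is total. *)
  exists (k'.+1, g') => _; split=> //=.
    split=> //=; first by lia.
    exact: meets_trans k0k g0g gg'.
  by move=> f /(meets_weaken (leqnSn k')); exact: Pf.
have [nx nxP] := choice next.
pose c := fix c n : cond := if n is n'.+1 then nx (n', c n') else (k0, g0).
have goodc n : good (c n).
  by elim: n => [|n IH] /=; [split | case: (nxP (n, c n) IH)].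
have cS n : (c n).1 < (c n.+1).1 /\ meets (c n).1 (c n).2 (c n.+1).2.
  by have [_ ? ? _] := nxP (n, c n) (goodc n).
have ck n : n <= (c n).1.
  by elim: n => [//|n IH]; exact: leq_ltn_trans IH (cS n).1.
have cm m n : m <= n -> (c m).1 <= (c n).1 /\ meets (c m).1 (c m).2 (c n).2.
  move=> /subnK <-; elim: (n - m) => [//|d [IH1 IH2]]; rewrite addSn.
  have [lt mt] := cS (d + m); split; first by lia.
  exact: meets_trans IH2 mt.
pose f i := (c i.+1).2 i.
have fc n i : i < n -> f i = (c n).2 i.
  move=> lt_in; have [_ [e _]] := cm _ _ lt_in.
  by rewrite /f e // (leq_trans _ (ck i.+1)).
have cf n : meets (c n).1 (c n).2 f.
  split=> i.
    move=> ic; rewrite (fc (maxn i.+1 n) i); last by rewrite leq_max ltnSn.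
    by have [_ [-> //]] := cm n (maxn i.+1 n) (leq_maxr _ _).
  rewrite (fc (maxn i.+1 n) i); last by rewrite leq_max ltnSn.
  by have [_ [_ ->]] := cm n (maxn i.+1 n) (leq_maxr _ _).
exists f; first exact: (cf 0).
by move=> e; have [_ _ _ h] := nxP (e, c e) (goodc e); apply: h; exact: (cf e.+1).
Qed.

(* [D_v] is a finite part of a function that meets [(k, g)]. *)
Definition compatible (k : nat) (g : nat -> nat) (v : nat) : Prop :=
  forall z, bit v z ->
    [/\ forall z', bit v z' -> unpair1 z' = unpair1 z -> z' = z,
        unpair1 z < k -> unpair2 z = g (unpair1 z) & g (unpair1 z) <= unpair2 z].

Lemma meets_compatible k g f v :
  meets k g f -> canonical_set v `<=` graph f -> compatible k g v.
Proof.
move=> [fk gf] vf z vz; have /graph_unpair fz := vf _ vz.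
split; rewrite -?fz //; last exact: fk.
move=> z' vz' zz'; have /graph_unpair fz' := vf _ vz'.
by rewrite -(unpairK z) -(unpairK z') -fz' -fz zz'.
Qed.

Lemma compatible_extend k g v :
  compatible k g v ->
  exists k' g', [/\ k <= k', meets k g g', forall i, k' <= i -> g' i = g i &
    forall f, meets k' g' f -> canonical_set v `<=` graph f].
Proof.
move=> gv.
pose g' i := if pselect (exists y, bit v (pair_code i y)) is left h
  then projT1 (cid h) else g i.
have g'v z : bit v z -> g' (unpair1 z) = unpair2 z.
  move=> vz; rewrite /g'; case: pselect => [h|]; last first.
    by case; exists (unpair2 z); rewrite unpairK.
  case: cid => /= y vy; have [zu _ _] := gv _ vz.
  have := zu _ vy; rewrite unpairE => /(_ erefl) <-.
  by rewrite unpairE.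
have g'P i : g' i = g i \/ bit v (pair_code i (g' i)).
  by rewrite /g'; case: pselect => [h|_]; [right; exact: projT2 (cid h) | left].
exists (maxn k v), g'; split; first exact: leq_maxl.
- split=> i.
    move=> ik; case: (g'P i) => // /gv[_]; rewrite !unpairE => h _.
    exact: h.
  by case: (g'P i) => [->//|/gv[_ _]]; rewrite !unpairE.
- move=> i; rewrite geq_max => /andP[_ vi]; case: (g'P i) => // /bit_ltn.
  by have := leq_pair1 i (g' i); lia.
move=> f [fg _] z vz; apply/graph_unpair; rewrite fg ?g'v //.
by rewrite leq_max (leq_ltn_trans (leq_unpair1 z) (bit_ltn vz)) orbT.
Qed.

Lemma majorenumerable_condition A (S : (nat -> nat) -> Prop) g0 :
  majorenumerable A -> S g0 -> (forall g, S g -> majorizes g A) ->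
  (forall g g', S g -> meets 0 g g' -> (exists m, forall i, m <= i -> g' i = g i) ->
     S g') ->
  exists c k g, [/\ S g,
    forall n v s, 0 < univ c (pair_code v n) s -> compatible k g v -> A n &
    forall k' g' n, k <= k' -> S g' -> meets k g g' -> A n ->
      exists v s, 0 < univ c (pair_code v n) s /\ compatible k' g' v].
Proof.
move=> meA S0 Smaj Sfin.
pose Theta c := [set z | exists s, 0 < univ c z s].
apply: contrapT => nocond.
have [|e k g Sg g0g|f g0f fA] := @fusion S
    (fun c f => enum_apply (Theta c) (graph f) <> A) 0 g0 => //; last first.
  have [Th /ce_univ[c Thc] Thf] : enum_reducible A (graph f).
    by apply: meA => n; apply: leq_trans (Smaj _ S0 n) (g0f.2 n).
  case: (fA c); rewrite -Thf; congr enum_apply; apply/seteqP.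
  by split=> n /Thc.
apply: contrapT => noext; apply: nocond; exists e, k, g; split=> //.
  move=> n v s vs gv; apply: contrapT => nAn; apply: noext.
  have [k' [g' [kk' gg' g'g vg']]] := compatible_extend gv.
  exists k', g'; split=> //.
    by apply: Sfin (Sg) _ _; [exact: meets_weaken gg' | exists k'].
  move=> f /vg' vf fA; apply: nAn; rewrite -fA; exists v; split=> //.
  by exists s.
move=> k' g' n kk' Sg' gg' An; apply: contrapT => nv; apply: noext.
exists k', g'; split=> // f g'f fA.
move: An; rewrite -fA => -[v [vf [s vs]]]; apply: nv; exists v, s; split=> //.
exact: meets_compatible g'f vf.
Qed.

Definition table (g : nat -> nat) (k i : nat) : nat := if i < k then g i else 0.

Lemma co_table D F g k :
  computable_on D F -> computable_on D (fun X x => table g k (F X x)).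
Proof.
rewrite /table.
move=> cF; elim: k => [|k IH].
  by apply: computable_on_ext (co_const D 0).
apply: (@computable_on_ext _ (fun X x => if F X x == k then g k else
   if F X x < k then g (F X x) else 0)); last by co.
by move=> X x _; rewrite ltnS; case: ltngtP => // ->.
Qed.
#[global] Hint Resolve co_table : co.

(** The bounds are the functions above [principal C] that eventually equal it. The deciding
    condition is then a finite table followed by [principal C], and [principal C i <= y] is a
    positive fact about [C]: more than [i] of its elements are at most [y]. *)
Lemma majorenumerable_introenumerable A : majorenumerable A -> introenumerable A.
Proof.
move=> meA C CA infC.
pose S g := (forall i, principal C i <= g i) /\
  exists m, forall i, m <= i -> g i = principal C i.
have [|g Sg n|g g' [Cg [m gC]] [_ gg'] [m' g'g]|c [k [g [[Cg [m gC]] sound complete]]]] :=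
  @majorenumerable_condition A S (principal C) meA.
- by split=> //; exists 0.
- by apply: leq_trans (principal_sub n CA infC) _; case: Sg.
- split=> [i|]; first exact: leq_trans (gg' i).
  exists (maxn m m') => i; rewrite geq_max => /andP[mi mi'].
  by rewrite g'g // gC.
pose K := maxn k m.
pose okv u v z := (if unpair1 z < K then unpair2 z == table g K (unpair1 z)
    else unpair1 z < count (bit u) (iota 0 (unpair2 z).+1)) &&
  all (fun z' => bit v z' ==> (unpair1 z' == unpair1 z) ==> (z' == z)) (iota 0 v).
pose r z w := (0 < univ c (pair_code (unpair1 w) (unpair2 z)) (unpair2 w)) &&
  all (fun y => bit (unpair1 w) y ==> okv (unpair1 z) (unpair1 w) y) (iota 0 (unpair1 w)).
exists [set z | exists w, r z w].
  by apply: ce_search; rewrite /r /okv; co.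
apply/seteqP; split=> n.
  move=> [u [uC [w /andP[]]]]; rewrite !unpairE => cw /all_iotaP okw.
  apply: sound cw _ => z wz; have := okw z (bit_ltn wz); rewrite wz /=.
  rewrite /okv /table => /andP[zK /all_iotaP uniqz]; split.
  - move=> z' wz' zz'; have := uniqz z' (bit_ltn wz').
    by rewrite wz' zz' eqxx /= => /eqP.
  - by move=> zk; move: zK; rewrite leq_max zk /= => /eqP.
  move: zK; case: ifP => [zK /eqP ->|/negbT]; first by rewrite zK.
  rewrite -leqNgt geq_max => /andP[_ mz] zc; rewrite gC // -ltnS principal_ltn //.
  apply: leq_trans zc _; apply: (@leq_trans (count (mem (canonical_set u)) (iota 0 (unpair2 z).+1))).
    by apply: sub_count => i ui; exact: mem_set.
  exact: below_sub.
move=> An; have [v [s [vs gv]]] := complete K g n (leq_maxl _ _) (conj Cg (ex_intro _ m gC)) (meets_refl k g) An.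
exists (trunc C v.+1); split; first exact: trunc_sub.
exists (pair_code v s); rewrite /r !unpairE vs /=; apply/all_iotaP => z _.
apply/implyP => vz; have [zu zK gz] := gv z vz; apply/andP; split; last first.
  by apply/all_iotaP => z' _; apply/implyP => vz'; apply/implyP => /eqP zz'; apply/eqP/zu.
rewrite /table; case: ifP => [zk|/negbT]; first by rewrite zK ?zk.
rewrite -leqNgt geq_max => /andP[_ mz]; rewrite gC // -ltnS principal_ltn // in gz.
apply: leq_trans gz _; rewrite leq_eqVlt; apply/orP; left; apply/eqP.
apply: eq_in_count => i; rewrite mem_iota /= add0n ltnS => iz.
have iv : i < v.+1 by have := bit_ltn vz; have := leq_unpair2 z; lia.
by rewrite bit_trunc iv.
Qed.

(** * Majorenumerable sets and well-founded trees *)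

(** Every number codes an infinite sequence; the relevant length is kept apart. *)
Definition item (l i : nat) : nat := unpair1 (iter i unpair2 l).

Lemma co_item D F G :
  computable_on D F -> computable_on D G -> computable_on D (fun X x => item (F X x) (G X x)).
Proof. by move=> cF cG; rewrite /item; co. Qed.
#[global] Hint Resolve co_item : co.

Lemma item_exists (a : nat -> nat) n : exists l, forall i, i < n -> item l i = a i.
Proof.
elim: n a => [|n IH] a; first by exists 0.
have [l hl] := IH (fun i => a i.+1); exists (pair_code (a 0) l) => -[|i] lt_in.
  by rewrite /item unpairE.
by rewrite /item iterSr unpairE; exact: hl.
Qed.

Definition has_stem (k l v : nat) : bool :=
  all (fun z => bit v z ==>
    all (fun z' => bit v z' ==> (unpair1 z' == unpair1 z) ==> (z' == z)) (iota 0 v) &&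
    ((unpair1 z < k) ==> (unpair2 z == item l (unpair1 z)))) (iota 0 v).

(* The set enumerated by the condition with stem [item l] of length [k] and the
   enumeration operator with code [c], whatever the lower bound [h] is. *)
Definition forced_set (c k l : nat) : set nat :=
  [set n | forall h : nat -> nat, exists v s,
    [/\ 0 < univ c (pair_code v n) s, has_stem k l v &
        forall z, bit v z -> k <= unpair1 z -> h (unpair1 z) <= unpair2 z]].

Lemma majorenumerable_forced A :
  majorenumerable A -> exists c k l, A = forced_set c k l.
Proof.
move=> meA.
have [//|//|g g' gA [_ gg'] _ n|c [k [g [gA sound complete]]]] :=
  @majorenumerable_condition A (fun g => majorizes g A) (principal A) meA.
  exact: leq_trans (gA n) (gg' n).
have [l hl] := item_exists g k.
exists c, k, l; apply/seteqP; split=> n.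
  move=> An h; pose g' i := if i < k then g i else maxn (g i) (h i).
  have gg' i : g i <= g' i by rewrite /g'; case: ifP => // _; exact: leq_maxl.
  have [||v [s [vs vg']]] := complete k g' n (leqnn k) _ _ An.
  + by move=> i; exact: leq_trans (gA i) (gg' i).
  + by split=> // i ik; rewrite /g' ik.
  exists v, s; split=> //.
    apply/all_iotaP => z _; apply/implyP => /vg'[zu zk _]; apply/andP; split.
      by apply/all_iotaP => z' _; apply/implyP => vz'; apply/implyP => /eqP zz';
        apply/eqP/zu.
    by apply/implyP => lt_zk; rewrite zk // hl // /g' lt_zk.
  move=> z /vg'[_ _ gz] kz; apply: leq_trans gz; rewrite /g' ltnNge kz /=.
  exact: leq_maxr.
move=> /(_ g)[v [s [vs /all_iotaP stem gv]]]; apply: sound vs _ => z vz.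
have := stem z (bit_ltn vz); rewrite vz /= => /andP[/all_iotaP zu /implyP zk].
have zk' : unpair1 z < k -> unpair2 z = g (unpair1 z).
  by move=> lt_zk; rewrite -hl //; apply/eqP/zk.
split=> //.
  move=> z' vz' zz'; have := zu z' (bit_ltn vz'); rewrite vz' zz' eqxx /=.
  by move/eqP.
by case: (ltnP (unpair1 z) k) => [/zk' ->//|]; exact: gv.
Qed.

Lemma not_Acc_chain (T : Type) (R : T -> T -> Prop) x :
  ~ Acc R x -> exists s : nat -> T, s 0 = x /\ forall i, R (s i.+1) (s i).
Proof.
move=> nx.
have next y : exists y', ~ Acc R y -> R y' y /\ ~ Acc R y'.
  have [|ny] := pselect (Acc R y); first by exists y.
  apply: contrapT => h; apply: ny; constructor=> y' y'y; apply: contrapT => ny'.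
  by apply: h; exists y'.
have [f fP] := choice next.
have sP i : ~ Acc R (iter i f x) by elim: i => [//|i /fP[]].
by exists (fun i => iter i f x); split=> // i; have [] := fP _ (sP i).
Qed.

(** [r n y x] says that [y] is a child of [x] in the tree of index [n], whose root is 0. For members
    all nodes are accessible, even those not reached from the root, because coordinates of the
    product are arbitrary nodes. *)
Definition wf_family (A : set nat) (r : nat -> rel nat) : Prop :=
  [/\ computable_on [set set0]
        (fun _ z => r (unpair1 z) (unpair1 (unpair2 z)) (unpair2 (unpair2 z))),
      forall n, A n -> well_founded (r n) &
      forall n, ~ A n -> ~ Acc (r n) 0].

(** A node is a finite part of a bound [h] with its length, and [R n w x] says that the axiom coded
    by [w] puts [n] into the set against every [h] extending [x]. Children admit no such [w] below
    their length, so the infinite branches from the root are the bounds that keep [n] out. *)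
Lemma forced_set_wf_family c k l : exists r, wf_family (forced_set c k l) r.
Proof.
pose R n w x := [&& 0 < univ c (pair_code (unpair1 w) n) (unpair2 w),
  has_stem k l (unpair1 w) &
  all (fun z => bit (unpair1 w) z ==> (k <= unpair1 z) ==>
    (unpair1 z < unpair1 x) && (item (unpair2 x) (unpair1 z) <= unpair2 z))
    (iota 0 (unpair1 w))].
pose r n x' x := [&& unpair1 x' == (unpair1 x).+1,
  all (fun i => item (unpair2 x') i == item (unpair2 x) i) (iota 0 (unpair1 x)) &
  all (fun w => ~~ R n w x') (iota 0 (unpair1 x'))].
exists r; split.
- by rewrite /r /R /has_stem; co.
- move=> n An x; apply: contrapT => nacc; have [s [_ sr]] := not_Acc_chain nacc.
  have lenS i : unpair1 (s i.+1) = (unpair1 (s i)).+1 by case/and3P: (sr i) => /eqP.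
  have len i : unpair1 (s i) = unpair1 (s 0) + i.
    by elim: i => [|i IH]; rewrite ?addn0 // lenS IH addnS.
  have itemS i j : j < unpair1 (s i) -> item (unpair2 (s i.+1)) j = item (unpair2 (s i)) j.
    by case/and3P: (sr i) => _ /all_iotaP h _ /h/eqP.
  have itemD i d j : j < unpair1 (s i) ->
      item (unpair2 (s (d + i))) j = item (unpair2 (s i)) j.
    move=> ji; elim: d => [//|d IH]; rewrite addSn itemS // len; rewrite len in ji.
    by lia.
  pose h j := item (unpair2 (s j.+1)) j.
  have [v [t [vt stem hv]]] := An h.
  (* [i] exceeds [w] and every argument occurring in [v], so the node [s i.+1] tests this axiom
     against the values of [h]. *)
  pose w := pair_code v t; pose i := w.+1.
  have wl : w < unpair1 (s i.+1) by rewrite len /i; lia.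
  case/and3P: (sr i) => _ _ /all_iotaP/(_ w wl)/negP; apply.
  rewrite /R !unpairE vt stem /=; apply/all_iotaP => z zv.
  apply/implyP => vz; apply/implyP => kz; rewrite len.
  have zi : unpair1 z < i.
    have := leq_unpair1 z; have := leq_pair1 v t; rewrite /i /w; lia.
  apply/andP; split; first by lia.
  have -> : i.+1 = (i - unpair1 z) + (unpair1 z).+1 by lia.
  rewrite itemD; last by rewrite len; lia.
  by have := hv z vz kz.
move=> n nAn.
have [h hP] : exists h : nat -> nat, forall v s, 0 < univ c (pair_code v n) s ->
    has_stem k l v ->
    exists z, [/\ bit v z, k <= unpair1 z & unpair2 z < h (unpair1 z)].
  apply: contrapT => nh; apply: nAn => h; apply: contrapT => nv; apply: nh.
  exists h => v s vs stem; apply: contrapT => nz; apply: nv; exists v, s.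
  split=> // z vz kz; rewrite leqNgt; apply/negP => zh; apply: nz.
  by exists z.
suff noacc x : Acc (r n) x -> (forall i, i < unpair1 x -> item (unpair2 x) i = h i) -> False.
  by move=> /noacc; apply.
elim=> {}x _ IH xh.
have [a ah] := item_exists h (unpair1 x).+1.
apply: (IH (pair_code (unpair1 x).+1 a)); last first.
  by move=> i; rewrite !unpairE; exact: ah.
apply/and3P; rewrite !unpairE; split=> //.
  by apply/all_iotaP => i ix; rewrite xh // ah // ltnW.
apply/all_iotaP => w _; apply/negP => /and3P[ws stem /all_iotaP wz].
have [z [vz kz zh]] := hP _ _ ws stem.
have := wz z (bit_ltn vz); rewrite vz kz /= !unpairE => /andP[zx].
by rewrite ah // leqNgt zh.
Qed.

(** * Well-founded games *)

Section Game.
Variable move : rel nat.  (* [move p' p]: from [p] to [p'] *)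
Hypothesis move_wf : well_founded move.

Definition winning (p : nat) : Prop :=
  Fix move_wf (fun _ => Prop)
    (fun p rec => exists p', exists h : move p' p, ~ rec p' h) p.

Lemma winningE p : winning p <-> exists2 p', move p' p & ~ winning p'.
Proof.
rewrite /winning Fix_eq; first by split=> [[p' [h np']]|[p' h np']]; exists p' => //; exists h.
move=> q f g fg; apply/propext; split=> -[p' [h np']]; exists p', h.
  by rewrite -fg.
by rewrite fg.
Qed.

(** The successor makes any function above it a strict bound for the search for a winning move. *)
Definition strategy (p : nat) : nat :=
  if `[<winning p>] then (minimize (fun p' => move p' p && ~~ `[<winning p'>])).+1 else 0.

Lemma strategy_winning (f : nat -> nat) p :
  (forall p, strategy p <= f p) ->
  winning p <-> exists2 p', p' < f p & move p' p /\ ~ winning p'.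
Proof.
move=> leZf; split=> [wp|[p' _ [mp' np']]]; last by apply/winningE; exists p'.
have [|/andP[mp' /asboolP np'] _] :=
    @minimizeP (fun p' => move p' p && ~~ `[<winning p'>]).
  have /winningE[p' mp' np'] := wp; exists p'; rewrite mp' /=.
  exact/asboolP.
exists (minimize (fun p' => move p' p && ~~ `[<winning p'>])) => //.
by apply: leq_trans (leZf p); rewrite /strategy asboolT.
Qed.

Definition closed_position (f : nat -> nat) (S : nat) : bool :=
  all (fun q => bit S q ==>
    all (fun p' => move p' q ==> bit S p') (iota 0 (f q))) (iota 0 S).

(** A labelling [c] of [S] that obeys the recursive equation of [winning] for moves below [f]:
    together with [S], a finite certificate that can be searched for. *)
Definition solution (f : nat -> nat) (S c : nat) : bool :=
  all (fun q => bit S q ==>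
    (bit c q == has (fun p' => move p' q && ~~ bit c p') (iota 0 (f q)))) (iota 0 S).

Inductive reachable (f : nat -> nat) : nat -> nat -> Prop :=
| reachable_refl p : reachable f p p
| reachable_step p p' q :
    p' < f p -> move p' p -> reachable f p' q -> reachable f p q.

Lemma reachable_closed f p q q' :
  reachable f p q -> q' < f q -> move q' q -> reachable f p q'.
Proof.
elim=> [{}p|{}p p' {}q lt_p' mp' _ IH] lt_q' mq'.
  by apply: reachable_step lt_q' mq' _; exact: reachable_refl.
by apply: reachable_step lt_p' mp' _; exact: IH.
Qed.

(** Koenig's lemma: the moves below [f] branch finitely and the game is well founded. *)
Lemma reachable_bounded f p : exists m, forall q, reachable f p q -> q < m.
Proof.
elim/(well_founded_induction move_wf): p => p IH.
have [||m hm] := @bounded_choice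
    (fun p' m => move p' p -> forall q, reachable f p' q -> q < m) (f p).
- by move=> p' m m' mm' h /h{}h q /h/leq_trans; apply.
- move=> p' _; have [/IH[m hm]|] := boolP (move p' p); first by exists m.
  by exists 0.
exists (maxn p.+1 m) => q pq; rewrite leq_max.
case: pq hm IH => [{}p|{}p p' {}q lt_p' mp' pq] hm _; first by rewrite ltnSn.
by rewrite (hm p') ?orbT.
Qed.

Lemma closed_position_exists f p : exists S, closed_position f S /\ bit S p.
Proof.
have [m hm] := reachable_bounded f p.
exists (trunc (reachable f p) m); split; last first.
  by have := reachable_refl f p => pp; apply/truncE => //; exact: hm.
apply/all_iotaP => q _; apply/implyP; rewrite bit_trunc => /andP[_ /asboolP pq].
apply/all_iotaP => p' lt_p'; apply/implyP => mp'.
by have pp' := reachable_closed pq lt_p' mp'; apply/truncE => //; exact: hm.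
Qed.

Lemma solution_exists f S :
  (forall p, strategy p <= f p) -> closed_position f S -> exists c, solution f S c.
Proof.
move=> leZf /all_iotaP Scl; exists (trunc winning S).
apply/all_iotaP => q qS; apply/implyP => Sq; have := Scl q qS; rewrite Sq /=.
move=> /all_iotaP Sq'; apply/eqP; rewrite bit_trunc qS /=.
apply/asboolP/has_iotaP => [/(strategy_winning _ leZf)[p' lt_p' [mp' np']]|].
  exists p' => //; rewrite mp' bit_trunc negb_and; apply/orP; right.
  exact/asboolP.
move=> [p' lt_p' /andP[mp' np']]; apply/(strategy_winning _ leZf).
exists p' => //; split=> // wp'; move: np'; rewrite bit_trunc asboolT // andbT.
by have := Sq' p' lt_p'; rewrite mp' /= => /bit_ltn ->.
Qed.

Lemma solution_winning f S c q :
  (forall p, strategy p <= f p) -> closed_position f S -> solution f S c ->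
  bit S q -> bit c q = `[<winning q>].
Proof.
move=> leZf /all_iotaP Scl /all_iotaP sol.
elim/(well_founded_induction move_wf): q => q IH Sq.
have := sol q (bit_ltn Sq); have := Scl q (bit_ltn Sq).
rewrite Sq /= => /all_iotaP Sq' /eqP ->.
apply/has_iotaP/asboolP => [[p' lt_p' /andP[mp' np']]|].
  apply/(strategy_winning _ leZf); exists p' => //; split=> //.
  have Sp' : bit S p' by have := Sq' p' lt_p'; rewrite mp'.
  by move=> wp'; move: np'; rewrite (IH p' mp' Sp') asboolT.
move=> /(strategy_winning _ leZf)[p' lt_p' [mp' np']]; exists p' => //.
have Sp' : bit S p' by have := Sq' p' lt_p'; rewrite mp'.
by rewrite mp' (IH p' mp' Sp') asboolF.
Qed.

End Game.

Definition oracle_fun (X : set nat) (i : nat) : nat :=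
  minimize (fun y => characteristic X (pair_code i y) == 1).

Lemma oracle_funE f : oracle_fun (graph f) =1 f.
Proof.
move=> i; have [|/eqP/characteristic1/graphE -> //] :=
  @minimizeP (fun y => characteristic (graph f) (pair_code i y) == 1).
by exists (f i); apply/eqP/characteristic1/graphE.
Qed.

Lemma co_oracle_fun (M : set (nat -> nat)) F :
  computable_on (graph @` M) F -> computable_on (graph @` M) (fun X x => oracle_fun X (F X x)).
Proof.
apply: co_comp; apply: co_minimize; first by co.
move=> _ i [f _ <-]; exists (f i).
by apply/eqP/characteristic1/graphE.
Qed.
#[global] Hint Resolve co_oracle_fun : co.

(* A function above the strategy makes the game finitely branching, so that a
   finite set of positions closed under the bounded moves can be searched for. *)
Lemma co_winning (M : set (nat -> nat)) (move : rel nat) (move_wf : well_founded move) :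
  computable_on [set set0] (fun _ z => move (unpair1 z) (unpair2 z)) ->
  (forall f, M f -> forall p, strategy move_wf p <= f p) ->
  computable_on (graph @` M) (fun _ p => `[<winning move_wf p>]).
Proof.
move=> cmove leZ; set D := graph @` M.
have {}cmove F G : computable_on D F -> computable_on D G ->
    computable_on D (fun X x => move (F X x) (G X x)).
  move=> cF cG; apply: (@co_app2 D (fun _ a b => move a b)) => //.
  exact: (computable_absolute _ cmove).
have cf F : computable_on D F -> computable_on D (fun X x => oracle_fun X (F X x)).
  exact: co_oracle_fun.
pose P X p w := [&& closed_position move (oracle_fun X) (unpair1 w),
  solution move (oracle_fun X) (unpair1 w) (unpair2 w) & bit (unpair1 w) p].
have cP : computable_on D (fun X p => minimize (P X p)).
  apply: co_minimize.
    by rewrite /P /closed_position /solution; co.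
  move=> _ p [f Mf <-]; have leZf := leZ f Mf.
  have [S [Scl Sp]] := closed_position_exists move_wf f p.
  have [c sol] := solution_exists leZf Scl.
  exists (pair_code S c); rewrite /P !unpairE Sp andbT.
  by rewrite (_ : oracle_fun _ = f) ?Scl //; apply/funext/oracle_funE.
apply: (@computable_on_ext _ (fun X p => bit (unpair2 (minimize (P X p))) p));
  last by co.
move=> _ p [f Mf <-]; congr nat_of_bool; have leZf := leZ f Mf.
have [|/and3P[]] := @minimizeP (P (graph f) p).
  have [S [Scl Sp]] := closed_position_exists move_wf f p.
  have [c sol] := solution_exists leZf Scl.
  exists (pair_code S c); rewrite /P !unpairE Sp andbT.
  by rewrite (_ : oracle_fun _ = f) ?Scl //; apply/funext/oracle_funE.
rewrite (_ : oracle_fun (graph f) = f); last by apply/funext/oracle_funE.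
by move=> Scl sol Sp _; exact: solution_winning leZf Scl sol Sp.
Qed.

(** * Sparse subsets *)

Lemma leq_principal_range (b : nat -> nat) :
  (forall k, b k < b k.+1) -> infinite_set (range b) ->
  forall k, b k <= principal (range b) k.
Proof.
move=> inc infB k.
suff [i ki pi] : exists2 i, k <= i & principal (range b) k = b i.
  by rewrite pi leqNgt (increasing_ltn_mono inc) -leqNgt.
elim: k => [|k [i ki pi]].
  by have [[i _ pi] _] := principalP 0 infB; exists i.
have [[j _ pj] _] := principalP k.+1 infB; exists j => //.
have := principal_lt_mono k infB; rewrite pi -pj (increasing_ltn_mono inc).
exact: leq_ltn_trans.
Qed.

(* The subset is chosen greedily with a principal function above [Z], so that
   whatever majorizes it computes [Z], hence the choice itself. *)
Lemma unif_majorreducible_subset (Z : nat -> nat) (B : set nat) :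
  let D := graph @` [set f | forall p, Z p <= f p] in
  computable_on D (fun _ => Z) -> computable_on D (fun _ => characteristic B) ->
  infinite_set B ->
  exists B', [/\ B' `<=` B, infinite_set B' & unif_majorreducible B'].
Proof.
move=> D cZ cB infB.
pose next k s := minimize (fun x => [&& characteristic B x == 1, s <= x & Z k <= x]).
have nextP k s : [/\ B (next k s), s <= next k s & Z k <= next k s].
  have [|/and3P[/eqP/characteristic1 ? ? ?] _] :=
    @minimizeP (fun x => [&& characteristic B x == 1, s <= x & Z k <= x]); last by [].
  have [x] := iffLR (infinite_natP B) infB (maxn s (Z k)).
  rewrite geq_max => /andP[sx zx] Bx; exists x; rewrite sx zx !andbT.
  exact/eqP/characteristic1.
pose b k := nat_rect (fun _ => nat) (next 0 0) (fun k s => next k.+1 s.+1) k.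
have bZ k : Z k <= b k by case: k => [|k]; [case: (nextP 0 0) | case: (nextP k.+1 (b k).+1)].
have bB k : B (b k) by case: k => [|k]; [case: (nextP 0 0) | case: (nextP k.+1 (b k).+1)].
have inc k : b k < b k.+1 by case: (nextP k.+1 (b k).+1).
have infB' : infinite_set (range b).
  by apply/infinite_natP => m; exists (b m); [exact: increasing_geq | exists m].
exists (range b); split=> //; first by move=> _ [k _ <-].
suff [e he] : computable_on D (fun _ => characteristic (range b)).
  exists e => f fb; apply: he; exists f => // p.
  exact: leq_trans (bZ p) (leq_trans (leq_principal_range inc infB' p) (fb p)).
have cZ' F : computable_on D F -> computable_on D (fun X x => Z (F X x)).
  exact: co_comp cZ.
have cB' F : computable_on D F -> computable_on D (fun X x => characteristic B (F X x)).
  exact: co_comp cB.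
have cnext : computable_on D (fun _ z => next (unpair1 z) (unpair2 z)).
  apply: (@co_minimize D (fun _ z x => [&& characteristic B x == 1, unpair2 z <= x
    & Z (unpair1 z) <= x])); first by co.
  move=> _ z _; have [Bn sn zn] := nextP (unpair1 z) (unpair2 z).
  exists (next (unpair1 z) (unpair2 z)); rewrite sn zn !andbT.
  exact/eqP/characteristic1.
have cb : computable_on D (fun _ k => b k).
  apply: (@co_nat_rect D (fun _ k => k) (fun _ _ => next 0 0)
    (fun _ _ k s => next k.+1 s.+1)); [co | co |].
  by apply: (@co_app2 D (fun _ k s => next k s)); co.
have cb' F : computable_on D F -> computable_on D (fun X x => b (F X x)).
  exact: co_comp cb.
apply: (@computable_on_ext _ (fun _ n => has (fun k => b k == n) (iota 0 n.+1)));
  last by co.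
move=> _ n _; rewrite characteristicP; congr nat_of_bool.
apply/has_iotaP/asboolP => [[k _ /eqP <-]|[k _ bk]]; first by exists k.
by exists k; [rewrite ltnS -bk increasing_geq | rewrite bk].
Qed.

(** * Comparison of ranks *)

Section Ranks.
Variables (A : set nat) (r : nat -> rel nat).
Hypothesis rA : wf_family A r.
Hypothesis infA : infinite_set A.

(* Node [(k, (L, l))] of the product of the trees of index at least [k]: its
   coordinates are the nodes [item l i] of the trees [k + i] for [i < L].  A child
   has a child of each coordinate and one more coordinate, at the root. *)
Definition product_child (y' y : nat) : bool :=
  let L := unpair1 (unpair2 y) in
  [&& unpair1 y' == unpair1 y, unpair1 (unpair2 y') == L.+1,
      item (unpair2 (unpair2 y')) L == 0 &
      all (fun i => r (unpair1 y + i) (item (unpair2 (unpair2 y')) i)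
                      (item (unpair2 (unpair2 y)) i)) (iota 0 L)].

(** Some [n] in [A] is at least the starting index. Each move adds a coordinate, so the tree of
    index [n] joins after finitely many moves, and from then on its coordinate descends. *)
Lemma product_child_wf : well_founded product_child.
Proof.
move=> y; have [n yn An] := iffLR (infinite_natP A) infA (unpair1 y).
have [_ wf _] := rA; have rn := wf n An.
have acc1 x : forall y, unpair1 y <= n -> n - unpair1 y < unpair1 (unpair2 y) ->
    item (unpair2 (unpair2 y)) (n - unpair1 y) = x -> Acc product_child y.
  elim/(well_founded_induction rn): x => x IH {yn}y yn ny yx.
  constructor=> y' /and4P[/eqP y'1 /eqP y'2 _ /all_iotaP y'l].
  apply: (IH (item (unpair2 (unpair2 y')) (n - unpair1 y'))) => //; rewrite ?y'1 //.
    by have := y'l _ ny; rewrite subnKC // yx.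
  by rewrite y'2 ltnW.
have [d] := ubnP (n.+1 - (unpair1 y + unpair1 (unpair2 y))).
elim: d y yn => [//|d IH] y yn yd.
have [ny|ny] := ltnP (n - unpair1 y) (unpair1 (unpair2 y)); first exact: acc1.
constructor=> y' /and4P[/eqP y'1 /eqP y'2 _ _]; apply: IH; first by rewrite y'1.
by rewrite y'1 y'2; lia.
Qed.

(* Positions [(t, (n, (x, y)))]: the players move alternately from [x] to a
   child in tree [n] (if [t = 0]) and from [y] to a child in the product (if
   [t = 1]); a player who cannot move loses. *)
Definition position (t n x y : nat) : nat :=
  pair_code t (pair_code n (pair_code x y)).

Definition rank_move (p' p : nat) : bool :=
  let n := unpair1 (unpair2 p) in
  let x := unpair1 (unpair2 (unpair2 p)) in
  let y := unpair2 (unpair2 (unpair2 p)) in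
  let x' := unpair1 (unpair2 (unpair2 p')) in
  let y' := unpair2 (unpair2 (unpair2 p')) in
  (unpair1 (unpair2 p') == n) &&
  (if unpair1 p == 0 then [&& unpair1 p' == 1, y' == y & r n x' x]
   else [&& unpair1 p == 1, unpair1 p' == 0, x' == x & product_child y' y]).

Lemma positionK p : p = position (unpair1 p) (unpair1 (unpair2 p))
  (unpair1 (unpair2 (unpair2 p))) (unpair2 (unpair2 (unpair2 p))).
Proof. by rewrite /position !unpairK. Qed.

Lemma rank_move0 p' n x y :
  rank_move p' (position 0 n x y) <-> exists2 x', r n x' x & p' = position 1 n x' y.
Proof.
rewrite /rank_move /position !unpairE /=; split.
  move=> /and4P[/eqP pn /eqP p1 /eqP py rx].
  exists (unpair1 (unpair2 (unpair2 p'))) => //.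
  by rewrite -p1 -{1}pn -py -!/(position _ _ _ _) -positionK.
by move=> [x' rx ->]; rewrite !unpairE !eqxx rx.
Qed.

Lemma rank_move1 p' n x y :
  rank_move p' (position 1 n x y) <->
  exists2 y', product_child y' y & p' = position 0 n x y'.
Proof.
rewrite /rank_move /position !unpairE /=; split.
  move=> /and4P[/eqP pn /eqP p1 /eqP py rx].
  exists (unpair2 (unpair2 (unpair2 p'))) => //.
  by rewrite -p1 -{1}pn -py -!/(position _ _ _ _) -positionK.
by move=> [y' rx ->]; rewrite !unpairE !eqxx rx.
Qed.

Lemma rank_move_wf : well_founded rank_move.
Proof.
have acc1 y : forall n x, Acc rank_move (position 1 n x y).
  elim/(well_founded_induction product_child_wf): y => y IH n x.
  constructor=> p /rank_move1[y' y'y ->].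
  by constructor=> p' /rank_move0[x' _ ->]; exact: IH.
move=> p; rewrite (positionK p); case: (unpair1 p) => [|[|t]].
- by constructor=> p' /rank_move0[x' _ ->].
- exact: acc1.
by constructor=> p'; rewrite /rank_move /position !unpairE /= andbF.
Qed.

(** The first player descends from [x] and loses: each step is answered by a step down from [y].
    This compares ranks without ordinals. *)
Definition rank_le (n x y : nat) : Prop := ~ winning rank_move_wf (position 0 n x y).

Lemma rank_leP n x y :
  rank_le n x y <->
  forall x', r n x' x -> exists2 y', product_child y' y & rank_le n x' y'.
Proof.
split=> [le x' x'x|h].
  apply: contrapT => no; apply: le; apply/winningE; exists (position 1 n x' y).
    by apply/rank_move0; exists x'.
  move=> /winningE[p /rank_move1[y' y'y ->] ny']; apply: no.
  by exists y'.
move=> /winningE[p /rank_move0[x' x'x ->] np]; apply: np.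
have [y' y'y le] := h x' x'x; apply/winningE; exists (position 0 n x' y') => //.
by apply/rank_move1; exists y'.
Qed.

Lemma rank_le_child n x y y' : product_child y' y -> rank_le n x y' -> rank_le n x y.
Proof.
elim/(well_founded_induction product_child_wf): y' x y => y' IH x y y'y.
move=> /rank_leP le; apply/rank_leP => x' /le[y'' y''y' le'].
by exists y' => //; exact: IH le'.
Qed.

(** Descents from [x] are matched in the well-founded product, so the comparison certifies that [x]
    is accessible for an arbitrary [n]. *)
Lemma rank_le_Acc n x y : rank_le n x y -> Acc (r n) x.
Proof.
elim/(well_founded_induction product_child_wf): y x => y IH x /rank_leP le.
by constructor=> x' /le[y' y'y /IH]; apply.
Qed.

Definition product_root (k : nat) : nat := pair_code k (pair_code 0 0).

(* Otherwise child by child the trees of index at least [k] would produce an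
   infinite branch of their product. *)
Lemma rank_le_root k : exists2 n, k <= n & rank_le n 0 (product_root k).
Proof.
apply: contrapT => no.
(* Invariant of the descent: neither a coordinate of [y] nor a root of index at least [k] has rank
   at most that of [y]. The next coordinates are children matched by no child of [y], and the new
   one is a root. *)
suff contra y : unpair1 y = k ->
    (forall i, i < unpair1 (unpair2 y) ->
      ~ rank_le (k + i) (item (unpair2 (unpair2 y)) i) y) ->
    (forall n, k <= n -> ~ rank_le n 0 y) -> False.
  apply: (contra (product_root k)); rewrite /product_root ?unpairE // => n kn le.
  by apply: no; exists n.
elim/(well_founded_induction product_child_wf): y => y IH yk yl y0.
pose L := unpair1 (unpair2 y); pose l := unpair2 (unpair2 y).
have child i : exists x', i < L -> r (k + i) x' (item l i) /\
    forall y', product_child y' y -> ~ rank_le (k + i) x' y'.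
  case: (ltnP i L) => [iL|]; last by exists 0.
  apply: contrapT => nx'; apply: (yl i iL); apply/rank_leP => x' x'x.
  apply: contrapT => ny'; apply: nx'; exists x' => _; split=> // y' y'y le.
  by apply: ny'; exists y'.
have [x' x'P] := choice child.
have [l' hl'] := item_exists (fun i => if i < L then x' i else 0) L.+1.
pose y' := pair_code k (pair_code L.+1 l').
have y'y : product_child y' y.
  rewrite /product_child /y' !unpairE yk eqxx /= -/L -/l eqxx hl' // ltnn eqxx /=.
  apply/all_iotaP => i iL; rewrite hl' ?iL; last exact: ltnW.
  by case: (x'P i iL).
have y'0 n : k <= n -> ~ rank_le n 0 y'.
  by move=> kn le; apply: (y0 n kn); exact: rank_le_child le.
apply: (IH y') => //; first by rewrite /y' unpairE.
move=> i; rewrite {1 2}/y' !unpairE ltnS => iL; rewrite hl' //.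
case: ltnP => [lt_iL|_]; last by apply: y'0; exact: leq_addr.
by have [_] := x'P i lt_iL; apply.
Qed.

Lemma infinite_unif_majorreducible_subset :
  exists B, [/\ B `<=` A, infinite_set B & unif_majorreducible B].
Proof.
have [cr _ nA] := rA.
pose win p := `[<winning rank_move_wf p>].
pose Z := strategy rank_move_wf.
pose D := graph @` [set f | forall p, Z p <= f p].
have {}cr F G H : computable_on [set set0] F -> computable_on [set set0] G ->
    computable_on [set set0] H ->
    computable_on [set set0] (fun X x => r (F X x) (G X x) (H X x)).
  move=> cF cG cH.
  apply: computable_on_ext (co_comp cr (co_pair cF (co_pair cG cH))) => X x _.
  by rewrite !unpairE.
have cmove : computable_on [set set0] (fun _ z => rank_move (unpair1 z) (unpair2 z)).
  by rewrite /rank_move /product_child; co.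
have cmove' F G : computable_on D F -> computable_on D G ->
    computable_on D (fun X x => rank_move (F X x) (G X x)).
  move=> cF cG; apply: (@co_app2 D (fun _ a b => rank_move a b)) => //.
  exact: (computable_absolute _ cmove).
have cw F : computable_on D F -> computable_on D (fun X x => win (F X x)).
  by apply: (@co_comp D (fun _ p => win p)); exact: co_winning.
pose S p p' := win p ==> rank_move p' p && ~~ win p'.
have cZ : computable_on D (fun _ => Z).
  apply: (@computable_on_ext _ (fun _ p => if win p then (minimize (S p)).+1 else 0)).
    move=> _ p _; rewrite /Z /strategy -/(win p); case: ifP => // wp; congr (minimize _).+1.
    by apply/funext => p'; rewrite /S wp.
  have cS : computable_on D (fun _ p => minimize (S p)).
    apply: (@co_minimize D (fun _ => S)); first by rewrite /S; co.
    move=> _ p _; rewrite /S; have [/asboolP/winningE[p' p'p np']|_] := boolP (win p).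
      by exists p'; rewrite p'p /=; exact/asboolP.
    by exists 0.
  by co.
pose root k n := position 0 n 0 (product_root k).
(* The bound [k <= n] makes the search for [k] finite, hence [B] decidable from the winning
   positions; since every [k] has its own [n >= k], [B] is infinite. *)
pose B := [set n | exists2 k, k <= n & rank_le n 0 (product_root k)].
have BA : B `<=` A.
  by move=> n [k _ /rank_le_Acc acc]; apply: contrapT => /nA; apply.
have infB : infinite_set B.
  apply/infinite_natP => k; have [n kn le] := rank_le_root k.
  by exists n => //; exists k.
have cB : computable_on D (fun _ => characteristic B).
  apply: (@computable_on_ext _ (fun _ n => has (fun k => ~~ win (root k n)) (iota 0 n.+1))).
    move=> _ n _; rewrite characteristicP; congr nat_of_bool.
    apply/has_iotaP/asboolP => [[k kn /asboolP le]|[k kn le]]; exists k => //.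
    exact/asboolP.
  by rewrite /root /position /product_root; co.
have [B' [B'B infB' uB']] := unif_majorreducible_subset cZ cB infB.
by exists B'; split=> //; exact: subset_trans BA.
Qed.

End Ranks.

Lemma majorenumerable_refinement A :
  majorenumerable A -> infinite_set A ->
  exists B, [/\ B `<=` A, infinite_set B & unif_majorreducible B].
Proof.
move=> /majorenumerable_forced[c [k [l ->]]] infA.
have [r wf] := forced_set_wf_family c k l.
exact: (infinite_unif_majorreducible_subset wf infA).
Qed.

(** * A c.e. set that is not introreducible *)

(** The set is listed in order of first appearance. To step back from an element, its first time is
    searched for, and then the preceding time at which a new element appeared. *)
Lemma range_regressive (k : nat -> nat) :
  computable_on [set set0] (fun _ => k) -> infinite_set (range k) ->
  regressive (range k).
Proof.
move=> ck infk.
pose fresh s := all (fun t => k t != k s) (iota 0 s).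
pose N := [set s | fresh s].
have freshP s : exists2 t, t <= s & fresh t /\ k t = k s.
  have [t /eqP kt min] := ex_minnP (ex_intro (fun t => k t == k s) s (eqxx _)).
  exists t; first exact: min.
  split=> //; apply/all_iotaP => i it; apply: contraL it => /eqP ki.
  by rewrite -leqNgt; apply: min; rewrite ki kt.
have infN : infinite_set N.
  apply/infinite_natP => m.
  have [||b hb] := @bounded_choice (fun t b => k t < b) m.
  - by move=> t b b' bb' /leq_trans; apply.
  - by move=> t _; exists (k t).+1.
  have [x bx [s _ sx]] := iffLR (infinite_natP _) infk b.
  have [t ts [ft kt]] := freshP s; exists t => //.
  by rewrite leqNgt; apply/negP => /hb; rewrite kt sx ltnNge bx.
have fresh_inj s t : fresh s -> fresh t -> k s = k t -> s = t.
  move=> /all_iotaP fs /all_iotaP ft kst; case: (ltngtP s t) => // lt.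
    by have := ft s lt; rewrite kst eqxx.
  by have := fs t lt; rewrite kst eqxx.
(* Time 0 is fresh and [previous 0] is 0, so the first element of the list is sent to itself. *)
pose previous s := nat_rect (fun _ => nat) 0 (fun t v => if fresh t then t else v) s.
have previousP s t : t < s -> fresh t -> (forall j, t < j < s -> ~~ fresh j) -> previous s = t.
  elim: s => [//|s IH]; rewrite ltnS leq_eqVlt => /predU1P[-> /= -> //|ts ft fj] /=.
  rewrite -/(previous s) (negbTE (fj s _)) ?ts ?ltnSn //.
  by apply: IH => // j /andP[tj js]; apply: fj; rewrite tj ltnW.
pose p := principal N.
have pinc n : p n < p n.+1 by exact: principal_lt_mono.
have pN n : fresh (p n) by have [] := principalP n infN.
have prevS n : previous (p n.+1) = p n.
  apply: previousP => // j /andP[nj jn].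
  apply/negP => fj; have pj := @principalE N _ j infN fj erefl.
  by move: nj jn; rewrite -pj -/p !(increasing_ltn_mono pinc); lia.
have p0 : p 0 = 0 by apply: principalE.
exists (fun n => k (p n)); split.
- move=> m n /(fresh_inj _ _ (pN m) (pN n)) pmn.
  by case: (ltngtP m n) => //; rewrite -(increasing_ltn_mono pinc) pmn ltnn.
- apply/seteqP; split=> [_ [n _ <-]|_ [s _ <-]]; first by exists (p n).
  have [t _ [ft <-]] := freshP s; exists (below N t) => //.
  by rewrite /p (@principalE N _ t).
have ck' F : computable_on [set set0] F -> computable_on [set set0] (fun X x => k (F X x)).
  exact: co_comp ck.
have cP : computable_on [set set0] (fun _ z => k (unpair2 z) == unpair1 z) by co.
have [e he] := @partial_search [set set0] (fun _ x s => k s == x) cP.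
have [f hf] : computable_on [set set0] (fun _ s => k (previous s)).
  by rewrite /previous /fresh; co.
have run_back n : run set0 e (k (p n)) (p n).
  apply/he => //; split=> // j jp; apply/eqP => kj.
  by have /all_iotaP/(_ j jp) := pN n; rewrite kj eqxx.
exists (Comp f e); split=> [|n].
  by exists (p 0) => //; have := hf set0 erefl (p 0); rewrite p0.
by exists (p n.+1) => //; have := hf set0 erefl (p n.+1); rewrite prevS.
Qed.

(** [2c + 1] enters [K] when the program with code [c] maps [c] to 0, which [univ] reports as 1. The
    even numbers are a computable subset, so introreducibility would make [K] computable; a program
    deciding [2c + 1] from [c] would then err on its own code. *)
Lemma ce_not_introreducible :
  exists K, [/\ infinite_set K, ce K, regressive K & ~ introreducible K].
Proof.
pose k t := if odd t then
    if univ (unpair1 t./2) (unpair1 t./2) (unpair2 t./2) == 1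
    then (unpair1 t./2).*2.+1 else 0
  else t.
have ck : computable_on [set set0] (fun _ => k).
  apply: (@computable_on_ext _ (fun _ t => if odd t then
    if univ (unpair1 t./2) (unpair1 t./2) (unpair2 t./2) == 1
    then (2 * unpair1 t./2).+1 else 0
  else t)).
    by move=> _ t _; rewrite /k mul2n.
  by co.
pose K := range k; pose E := [set n | ~~ odd n].
have EK : E `<=` K by move=> n /negbTE En; exists n => //; rewrite /k En.
have infE : infinite_set E.
  apply/infinite_natP => m; exists m.*2; first by rewrite -addnn leq_addr.
  by rewrite /E /= odd_double.
have infK : infinite_set K := sub_infinite_set EK infE.
have oddK c : K c.*2.+1 <-> exists s, univ c c s = 1.
  split=> [[t _]|[s cs]].
    rewrite /k; case: ifP => [_|ot] tc; last by rewrite tc /= odd_double in ot.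
    move: tc; case: eqP => [h [/double_inj tc]|//].
    by rewrite -tc; exists (unpair2 t./2).
  exists (pair_code c s).*2.+1 => //.
  by rewrite /k /= odd_double /= uphalf_double !unpairE cs.
exists K; split=> //.
- rewrite (_ : K = [set n | exists t, k t == n]).
    have ck' F : computable_on [set set0] F -> computable_on [set set0] (fun X x => k (F X x)).
      exact: co_comp ck.
    by apply: ce_search; co.
  by apply/seteqP; split=> [_ [t _ <-]|n [t /eqP <-]]; exists t.
- exact: range_regressive.
move=> /(_ E EK infE)/turing_reducibleP cK.
have {cK} cK : computable_on [set set0] (fun _ => characteristic K).
  apply: (@co_oracle [set set0] (fun _ => E) (fun _ => characteristic K)).
    apply: (@computable_on_ext _ (fun _ n => ~~ odd n)); last by co.
    by move=> _ n _; rewrite characteristicP; congr nat_of_bool; apply/idP/asboolP.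
  by apply: computable_on_sub cK => _ [X _ <-].
have [e he] : computable_on [set set0] (fun _ c => characteristic K (2 * c).+1).
  by apply: (co_comp cK); co.
pose c := program_code e; have := he set0 erefl c; rewrite mul2n.
rewrite characteristicP; case: asboolP => [/oddK[s cs]|nK].
  have : run set0 e c 0 by apply/univP; exists s.
  by move=> e0 e1; have := run_functional e0 e1.
by move=> /univP[s cs]; apply: nK; apply/oddK; exists s.
Qed.

(** * A retraceable set that is not majorenumerable *)

(** In binary, [a n] is 1 followed by the first [n] bits of [X]. Halving steps back, and [a i.+1] is
    the only element from [2 ^ i.+1] up to [2 ^ i.+2]; its last bit [X i] makes the set differ from
    [H i] there. *)
Lemma retraceable_not_majorenumerable :
  exists A, [/\ infinite_set A, retraceable A & ~ majorenumerable A].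
Proof.
pose H e := forced_set (unpair1 e) (unpair1 (unpair2 e)) (unpair2 (unpair2 e)).
pose X e := ~~ `[<exists m, [/\ H e m, odd m & 2 ^ e.+1 <= m < 2 ^ e.+2]>].
pose a := fix a n := if n is n'.+1 then a n' + a n' + X n' else 1.
have a_bounds n : 2 ^ n <= a n < 2 ^ n.+1.
  elim: n => [//|n]; rewrite /= !expnS; case: (X n) => /=; lia.
have inc n : a n < a n.+1.
  by have /andP[+ _] := a_bounds n; have := expn_gt0 2 n; rewrite /=; lia.
exists (range a); split.
- by apply/infinite_natP => m; exists (a m); [exact: increasing_geq | exists m].
- exists a; split=> //.
  have [e he] : computable_on [set set0] (fun _ x => if x <= 1 then 1 else x./2) by co.
  exists e; split=> [|n]; first exact: (he set0 erefl (a 0)).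
  have gt1 : (a n.+1 <= 1) = false.
    by have /andP[+ _] := a_bounds n.+1; have := expn_gt0 2 n; rewrite expnS; lia.
  have aE : (a n.+1)./2 = a n.
    by rewrite /= addnn addnC halfD odd_double andbF add0n doubleK; case: (X n).
  by have := he set0 erefl (a n.+1); rewrite gt1 aE.
move=> /majorenumerable_forced[c [k [l e]]].
pose i := pair_code c (pair_code k l).
have {}e : range a = H i by rewrite /H /i !unpairE.
have ai : a i.+1 = (a i).*2 + X i by rewrite /= addnn.
have [] := boolP (X i) => Xi.
  move: (Xi); rewrite /X -asbool_neg => /asboolP[]; exists (a i.+1); split.
  - by rewrite -e; exists i.+1.
  - by rewrite ai Xi oddD odd_double.
  - exact: a_bounds.
move: (Xi); rewrite /X negbK => /asboolP[m []]; rewrite -e => -[j _ <-] oj ij.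
have ji : j = i.+1.
  have := a_bounds j; case: (ltngtP j i.+1) => // lt.
    have := @leq_pexp2l 2 j.+1 i.+1 erefl lt; lia.
  have := @leq_pexp2l 2 i.+2 j erefl lt; lia.
by move: oj; rewrite ji ai (negbTE Xi) addn0 odd_double.
Qed.

(** * A uniformly introreducible set that is not regressive *)

(* One or two new elements, whose first component is the finite set [u], prevent
   [phi] from stepping back along any enumeration of a set that contains them
   and whose further elements exceed [r']. *)
Lemma nonregressive_step (phi : program) (u r : nat) :
  exists u' r', [/\ r <= r',
    forall y, bit u' y -> bit u y \/ unpair1 y = u /\ r <= unpair2 y,
    forall y, bit u y -> bit u' y,
    exists2 i, r <= i & bit u' (pair_code u i) &
    forall N : set nat, (forall y, bit u' y -> N y) ->
      (forall y, N y -> bit u' y \/ r' <= y) ->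
      forall a, injective a -> range a = N -> ~ steps_back phi a].
Proof.
pose add (T : seq nat) := bitmask (fun y => bit u y || (y \in T)) (foldr maxn u T).+1.
have addE T y : bit (add T) y = bit u y || (y \in T).
  rewrite bit_bitmask; case: (boolP (_ || _)) => [|_]; last by rewrite andbF.
  rewrite andbT ltnS => /orP[/bit_ltn/ltnW yu|].
    by elim: T => [//|x T IH] /=; rewrite leq_max IH orbT.
  by elim: T => [//|x T IH] /=; rewrite inE leq_max => /predU1P[->|/IH ->];
    rewrite ?leqnn ?orbT.
pose x i := pair_code u (r + i).
have x_new i : ~~ bit u (x i).
  by apply/negP => /bit_ltn; have := leq_pair1 u (r + i); rewrite /x; lia.
have x_inj i j : x i = x j -> i = j by move=> /pair_code_inj[_]; lia.
have add_x T i y : {subset T <= [seq x j | j <- iota 0 i]} -> bit (add T) y ->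
    bit u y \/ unpair1 y = u /\ r <= unpair2 y.
  move=> Tx; rewrite addE => /orP[|/Tx/mapP[j _ ->]]; first by left.
  by right; rewrite !unpairE leq_addr.
have value a n y : steps_back phi a -> run set0 phi (a n) y -> y = a n.-1.
  by move=> back ny; apply: run_functional ny _; case: n => [|n]; apply back.
have defined a n : steps_back phi a -> run set0 phi (a n) (a n.-1).
  by move=> back; case: n => [|n]; apply back.
have single i : {subset [:: x i] <= [seq x j | j <- iota 0 i.+1]}.
  by move=> y; rewrite inE => /eqP ->; apply/map_f; rewrite mem_iota ltnSn.
have [[i noval]|allval] := pselect (exists i, forall z, ~ run set0 phi (x i) z).
  exists (add [:: x i]), r; split=> //.
  - by move=> y; exact: add_x.
  - by move=> y uy; rewrite addE uy.
  - by exists (r + i); rewrite ?leq_addr // addE inE eqxx orbT.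
  move=> N subN _ a _ aN back.
  have : N (x i) by apply: subN; rewrite addE inE eqxx orbT.
  by rewrite -aN => -[n _ ax]; apply: (noval (a n.-1)); rewrite -ax; exact: defined.
have {allval} val_ex i : exists y, run set0 phi (x i) y.
  apply: contrapT => ny; apply: allval; exists i => y xy; apply: ny.
  by exists y.
have [z zP] := choice val_ex.
(* A value outside [D_u] and other than its argument is kept out of the set by letting [r'] exceed
   it. *)
have [[i [zu zx]]|allin] := pselect (exists i, ~~ bit u (z i) /\ z i != x i).
  exists (add [:: x i]), (maxn r (z i).+1); split.
  - exact: leq_maxl.
  - by move=> y; exact: add_x.
  - by move=> y uy; rewrite addE uy.
  - by exists (r + i); rewrite ?leq_addr // addE inE eqxx orbT.
  move=> N subN Nsub a _ aN back.
  have : N (x i) by apply: subN; rewrite addE inE eqxx orbT.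
  rewrite -aN => -[n _ ax]; have := zP i; rewrite -ax => /(value _ _ _ back) zn.
  have : N (z i) by rewrite -aN zn; exists n.-1.
  move=> /Nsub[|]; first by rewrite addE inE (negbTE zu) (negbTE zx).
  by rewrite geq_max ltnn andbF.
have zin i : bit u (z i) \/ z i = x i.
  apply: contrapT => h; apply: allin; exists i; split.
    by apply/negP => zu; apply: h; left.
  by apply/eqP => zx; apply: h; right.
(* Pigeonhole on [u.+2] new elements: elements of [D_u] are less than [u], and the class [u]
   collects the fixed points. Only [a 0] is fixed, and two elements with the same value are [a 0]
   and [a 1], whose value [a 0] is new and so outside [D_u]. *)
have [i [j [nij zij]]] : exists i j : nat, i != j /\
    (z i = x i /\ z j = x j \/ z i = z j /\ bit u (z i)).
  pose f (i : 'I_u.+2) : 'I_u.+1 :=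
    if bit u (z i) then inord (z i) else inord u.
  have /injectivePn[i [j nij fij]] : ~~ injectiveb f.
    by apply/negP => /injectiveP/leq_card; rewrite !card_ord ltnn.
  exists (nat_of_ord i), (nat_of_ord j); split=> //; move: fij; rewrite /f.
  have inz y : bit u y -> (inord y : 'I_u.+1) = y :> nat.
    by move=> /bit_ltn/ltnW; exact: inordK.
  have inu : (inord u : 'I_u.+1) = u :> nat by exact: inordK.
  case: ifP => [ui|ui]; case: ifP => [uj|uj] /(congr1 val) /=;
    rewrite ?inu ?inz // => zz.
  - by right.
  - by have := bit_ltn ui; rewrite zz ltnn.
  - by have := bit_ltn uj; rewrite -zz ltnn.
  by left; split; [case: (zin i) => //; rewrite ui | case: (zin j) => //; rewrite uj].
exists (add [:: x i; x j]), r; split=> //.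
- move=> y; apply: (@add_x _ (maxn i j).+1) => t tx.
  have [->|->] : t = x i \/ t = x j.
  + by move: tx; rewrite !inE => /orP[/eqP|/eqP]; [left | right].
  + by apply/map_f; rewrite mem_iota /= add0n ltnS leq_maxl.
  + by apply/map_f; rewrite mem_iota /= add0n ltnS leq_maxr.
- by move=> y uy; rewrite addE uy.
- by exists (r + i); rewrite ?leq_addr // addE inE eqxx orbT.
move=> N subN _ a a_inj aN back.
have : N (x i) by apply: subN; rewrite addE !inE eqxx orbT.
have : N (x j) by apply: subN; rewrite addE !inE eqxx !orbT.
rewrite -aN => -[n _ an] [m _ am].
have zm : z i = a m.-1 by apply: (value a m) => //; rewrite am.
have zn : z j = a n.-1 by apply: (value a n) => //; rewrite an.
have nmn : m != n.
  by apply: contra nij => /eqP mn; apply/eqP/x_inj; rewrite -am -an mn.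
case: zij => [[zi zj]|[zz uz]].
  have : a m.-1 = a m by rewrite -zm zi am.
  have : a n.-1 = a n by rewrite -zn zj an.
  by move=> /a_inj n0 /a_inj m0; move/eqP: nmn; lia.
have /a_inj mn : a m.-1 = a n.-1 by rewrite -zm -zn.
have : m = 0 \/ n = 0 by move/eqP: nmn; lia.
case=> e0.
  have xz : x i = z i by rewrite zm -am e0.
  by have := x_new i; rewrite xz uz.
have xz : x j = z j by rewrite zn -an e0.
by have := x_new j; rewrite xz -zz uz.
Qed.

(** An element entering at step [m] carries [u m], and all elements entering from then on are at
    least [u m], so [u m] decides every [n < u m]. An infinite subset contains an element with large
    enough first component. *)
Lemma unif_introreducible_not_regressive :
  exists A, [/\ infinite_set A, unif_introreducible A & ~ regressive A].
Proof.
have prog_ex c : exists e, (exists e', program_code e' = c) -> program_code e = c.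
  have [[e ec]|nc] := pselect (exists e', program_code e' = c); first by exists e.
  by exists Zero.
have [prog progP] := choice prog_ex.
have back_prog phi a : steps_back phi a -> steps_back (prog (program_code phi)) a.
  have codeE : program_code (prog (program_code phi)) = program_code phi.
    by apply: progP; exists phi.
  by move=> [/univP a0 /(_ _)/univP aS]; split=> [|n]; apply/univP; rewrite codeE.
have step_ex (p : nat * (nat * nat)) : exists q : nat * nat,
    [/\ p.2.2 <= q.2,
    forall y, bit q.1 y -> bit p.2.1 y \/ unpair1 y = p.2.1 /\ p.2.2 <= unpair2 y,
    forall y, bit p.2.1 y -> bit q.1 y,
    exists2 i, p.2.2 <= i & bit q.1 (pair_code p.2.1 i) &
    forall N : set nat, (forall y, bit q.1 y -> N y) ->
      (forall y, N y -> bit q.1 y \/ q.2 <= y) ->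
      forall a, injective a -> range a = N -> ~ steps_back (prog p.1) a].
  case: p => c [u r]; have [u' [r' h]] := nonregressive_step (prog c) u r.
  by exists (u', r').
have [step stepP] := choice step_ex.
pose st := fix st n := if n is n'.+1 then step (n', st n') else (0, 0).
pose u n := (st n).1; pose r n := (st n).2.
have stP n : [/\ r n <= r n.+1,
    forall y, bit (u n.+1) y -> bit (u n) y \/ unpair1 y = u n /\ r n <= unpair2 y,
    forall y, bit (u n) y -> bit (u n.+1) y,
    exists2 i, r n <= i & bit (u n.+1) (pair_code (u n) i) &
    forall N : set nat, (forall y, bit (u n.+1) y -> N y) ->
      (forall y, N y -> bit (u n.+1) y \/ r n.+1 <= y) ->
      forall a, injective a -> range a = N -> ~ steps_back (prog n) a].
  exact: (stepP (n, st n)).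
have u_inc n : u n < u n.+1.
  have [_ _ _ [i _ /bit_ltn ui] _] := stP n.
  exact: leq_ltn_trans (leq_pair1 _ _) ui.
have u_le m n : m <= n -> u m <= u n.
  by move=> mn; rewrite leqNgt (increasing_ltn_mono u_inc) -leqNgt.
have r_le m n : m <= n -> r m <= r n.
  move=> /subnK <-; elim: (n - m) => [//|d IH]; rewrite addSn.
  by have [h _ _ _ _] := stP (d + m); exact: leq_trans h.
have bit_le m n y : m <= n -> bit (u m) y -> bit (u n) y.
  move=> /subnK <-; elim: (n - m) => [//|d IH]; rewrite addSn => /IH.
  by have [_ _ h _ _] := stP (d + m); exact: h.
pose N := [set y | exists n, bit (u n) y].
have level y : N y -> exists m, [/\ bit (u m.+1) y, unpair1 y = u m & r m <= unpair2 y].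
  move=> [n]; elim: n => [|n IH]; first by move/bit_ltn.
  have [_ h _ _ _] := stP n => yn; have [/IH //|[y1 y2]] := h y yn.
  by exists n.
have later n y : N y -> bit (u n) y \/ u n <= y /\ r n <= y.
  move=> /level[m [ym y1 y2]]; have [mn|nm] := ltnP m n.
    by left; exact: bit_le ym.
  right; split.
    by apply: leq_trans (u_le _ _ nm) _; rewrite -y1 leq_unpair1.
  by apply: leq_trans (r_le _ _ nm) _; apply: leq_trans y2 (leq_unpair2 _).
have infN : infinite_set N.
  apply/infinite_natP => m; have [_ _ _ [i _ mi] _] := stP m.
  exists (pair_code (u m) i); last by exists m.+1.
  exact: leq_trans (increasing_geq u_inc m) (leq_pair1 _ _).
exists N; split=> //; last first.
  move=> [a [a_inj aN [phi /back_prog back]]].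
  have [_ _ _ _ h] := stP (program_code phi).
  apply: (h N) back => // y; first by exists (program_code phi).+1.
  by move=> /(later (program_code phi).+1)[|[_]]; [left | right].
pose D := [set C | C `<=` N /\ infinite_set C].
pose P C n c := (characteristic C c == 1) && (n < unpair1 c).
have exP C n : D C -> exists c, P C n c.
  move=> [CN /infinite_natP/(_ (u n.+2))[c uc Cc]]; exists c.
  rewrite /P (iffRL (characteristic1 C c) Cc) /=.
  have [m [cm -> _]] := level c (CN c Cc).
  apply: leq_trans (increasing_geq u_inc m); rewrite ltnNge; apply/negP => mn.
  have : bit (u n.+1) c by apply: bit_le cm.
  by move=> /bit_ltn; rewrite ltnNge (leq_trans (u_le n.+1 n.+2 (leqnSn _)) uc).
suff [e he] : computable_on D (fun _ => characteristic N).
  by exists e => C CN infC; apply: he.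
have cP : computable_on D (fun C n => minimize (P C n)).
  by apply: co_minimize => //; rewrite /P; co.
apply: (@computable_on_ext _ (fun C n => bit (unpair1 (minimize (P C n))) n)); last by co.
move=> C n DC; rewrite characteristicP; congr nat_of_bool.
have [] := minimizeP (exP C n DC); move: (minimize _) => c.
move=> /andP[/eqP/characteristic1 Cc nc] _.
have [m [_ cm _]] : exists m, [/\ bit (u m.+1) c, unpair1 c = u m & r m <= unpair2 c].
  by apply: level; case: DC => CN _; exact: CN.
rewrite cm in nc *; apply/idP/asboolP => [nm|]; first by exists m.
by move=> /(later m)[//|[]]; rewrite leqNgt nc.
Qed.

(** * A majorreducible set that is not uniformly introenumerable *)

(* A stage [t] codes a requirement, an earlier stage, a finite set, a number and
   a computation; the requirement asks that the enumeration operator whose code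
   is its first component be not a uniform introenumeration. *)
Definition requirement (t : nat) : nat := unpair1 t.
Definition parent (t : nat) : nat := unpair1 (unpair2 t).
Definition stem (t : nat) : nat := unpair1 (unpair2 (unpair2 t)).
Definition omitted (t : nat) : nat := unpair1 (unpair2 (unpair2 (unpair2 t))).
Definition used (t : nat) : nat := unpair1 (unpair2 (unpair2 (unpair2 (unpair2 t)))).
Definition steps (t : nat) : nat := unpair2 (unpair2 (unpair2 (unpair2 (unpair2 t)))).
Definition stage (e v F m u s : nat) : nat :=
  pair_code e (pair_code v (pair_code F (pair_code m (pair_code u s)))).

Definition stageE e v F m u s :
  (requirement (stage e v F m u s) = e) * (parent (stage e v F m u s) = v) *
  (stem (stage e v F m u s) = F) * (omitted (stage e v F m u s) = m) *
  (used (stage e v F m u s) = u) * (steps (stage e v F m u s) = s).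
Proof.
by rewrite /requirement /parent /stem /omitted /used /steps /stage !unpairE.
Qed.

(** Stages that act for the same requirement above the same parent share a node; a majorizing
    function is compared with a stage at its node. *)
Definition node (t : nat) : nat := pair_code (requirement t) (parent t).

(* [H] is the set of stages before [t] that act.  A stage is cancelled when a
   later one acts for a requirement that is not larger. *)
Definition alive_in (H a t : nat) : bool :=
  bit H a && all (fun b => bit H b ==> (a < b) ==> (requirement a < requirement b))
    (iota 0 t).

(** Stage 0 acts unconditionally, as the root. Passing the earlier acting stages as a canonical
    index turns the course-of-values recursion into the primitive recursion of [history]. *)
Definition may_act (H t : nat) : bool :=
  if t == 0 then true else
  [&& alive_in H (parent t) t,
      requirement (parent t) < requirement t,
      all (fun a => alive_in H a t ==>
        (requirement a <= requirement (parent t)) || (requirement t < requirement a))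
        (iota 0 t),
      all (fun i => bit (stem t) i == bit (stem (parent t)) i) (iota 0 (parent t)),
      has (fun i => (parent t <= i) && bit (stem t) i) (iota 0 (stem t)),
      0 < univ (unpair1 (requirement t)) (pair_code (used t) (omitted t)) (steps t),
      all (fun i => bit (used t) i ==> bit (stem t) i) (iota 0 (used t)),
      ~~ bit (stem t) (omitted t) &
      all (fun t' => bit H t' ==> (parent t < t') ==>
        (count (bit (stem t)) (iota 0 t') <= node t')) (iota 0 t)].

Definition history (n : nat) : nat :=
  nat_rect (fun _ => nat) 0 (fun t H => H + may_act H t * 2 ^ t) n.

Definition acts (t : nat) : bool := may_act (history t) t.

Lemma co_acts D F : computable_on D F -> computable_on D (fun X x => acts (F X x)).
Proof.
apply: (@co_comp D (fun _ t => acts t)).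
rewrite /acts /history.
have cm G H : computable_on D G -> computable_on D H ->
    computable_on D (fun X x => may_act (G X x) (H X x)).
  apply: (@co_app2 D (fun _ a b => may_act a b)).
  rewrite /may_act /alive_in /node /requirement /parent /stem /omitted /used /steps.
  by co.
by co.
Qed.
#[global] Hint Resolve co_acts : co.

Lemma bit_history n i : bit (history n) i = (i < n) && acts i.
Proof.
rewrite (_ : history n = bitmask acts n) ?bit_bitmask //.
by elim: n => [//|n IH]; rewrite bitmaskSr -IH.
Qed.

Definition alive (a t : nat) : Prop :=
  [/\ acts a, a < t & forall b, a < b < t -> acts b -> requirement a < requirement b].

Lemma alive_inP a t : reflect (alive a t) (alive_in (history t) a t).
Proof.
rewrite /alive_in bit_history; apply: (iffP andP) => [[/andP[lt_at aa] /all_iotaP h]|].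
  split=> // b /andP[ab bt] actb.
  by have := h b bt; rewrite bit_history bt actb ab.
move=> [aa lt_at h]; rewrite lt_at aa; split=> //; apply/all_iotaP => b bt.
rewrite bit_history bt /=; apply/implyP => actb; apply/implyP => ab.
by apply: h => //; rewrite ab.
Qed.

(** [parent_last] makes a requirement wait while one of its stages is alive. It also implies that
    once [t] has acted, all acting stages strictly between the parent and [t] are cancelled;
    [stem_sparse] limits the stem below exactly these. *)
Record action (t : nat) : Prop := Action {
  parent_alive : alive (parent t) t;
  parent_requirement : requirement (parent t) < requirement t;
  parent_last : forall a, alive a t ->
    requirement a <= requirement (parent t) \/ requirement t < requirement a;
  stem_parent : forall i, i < parent t -> bit (stem t) i = bit (stem (parent t)) i;
  stem_new : exists2 i, parent t <= i & bit (stem t) i;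
  omitted_univ :
    0 < univ (unpair1 (requirement t)) (pair_code (used t) (omitted t)) (steps t);
  used_stem : forall i, bit (used t) i -> bit (stem t) i;
  omitted_stem : ~~ bit (stem t) (omitted t);
  stem_sparse : forall t', parent t < t' < t -> acts t' ->
    count (bit (stem t)) (iota 0 t') <= node t' }.

Lemma actsP t : 0 < t -> acts t <-> action t.
Proof.
rewrite lt0n /acts /may_act => /negbTE ->; split.
  move=> /and5P[/alive_inP h1 h2 /all_iotaP h3 /all_iotaP h4].
  move=> /and5P[/has_iotaP h5 h6 /all_iotaP h7 h8 /all_iotaP h9]; split=> //.
  - move=> a aa; apply/orP; have [_ lt_at _] := aa.
    by apply: (implyP (h3 a lt_at)); exact/alive_inP.
  - by move=> i /h4/eqP.
  - by case: h5 => i _ /andP[? ?]; exists i.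
  - by move=> i ui; have := h7 i (bit_ltn ui); rewrite ui.
  - move=> t' /andP[vt' tt'] at'; have := h9 t' tt'.
    by rewrite bit_history tt' at' vt'.
move=> [h1 h2 h3 h4 [i vi si] h6 h7 h8 h9].
apply/and5P; split=> //; first exact/alive_inP.
- apply/all_iotaP => a _; apply/implyP => /alive_inP/h3.
  by case=> ->; rewrite ?orbT.
- by apply/all_iotaP => j jv; apply/eqP/h4.
apply/and5P; split=> //.
- by apply/has_iotaP; exists i; [exact: bit_ltn | rewrite vi].
- by apply/all_iotaP => j _; apply/implyP; exact: h7.
- apply/all_iotaP => t' tt'; rewrite bit_history tt' /=.
  by apply/implyP => at'; apply/implyP => vt'; apply: h9 => //; rewrite vt'.
Qed.

(** * Permanent stages: the true path *)

Definition permanent (a : nat) : Prop :=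
  acts a /\ forall b, a < b -> acts b -> requirement a < requirement b.

Lemma parent_leq t : parent t <= t.
Proof. exact: leq_trans (leq_unpair1 _) (leq_unpair2 _). Qed.

Lemma acts_requirement t : 0 < t -> acts t -> 0 < requirement t.
Proof. by move=> t0 /(actsP t0) act; exact: leq_trans (parent_requirement act). Qed.

Lemma permanent0 : permanent 0.
Proof.
split=> // b b0 ab.
by rewrite {1}/requirement; have := acts_requirement b0 ab; have := leq_unpair1 0; lia.
Qed.

Lemma permanent_alive a t : permanent a -> a < t -> alive a t.
Proof. by move=> [aa h] lt_at; split=> // b /andP[ab _]; exact: h. Qed.

Lemma parent_ltn t : 0 < t -> acts t -> parent t < t.
Proof. by move=> t0 /(actsP t0) act; have [] := parent_alive act. Qed.

Lemma permanent_parent b : 0 < b -> permanent b -> permanent (parent b).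
Proof.
move=> b0 [/(actsP b0) act h]; have [av _ hv] := parent_alive act.
split=> // c vc ac; have rvb := parent_requirement act.
case: (ltngtP c b) => [cb|bc|->] //; first by apply: hv => //; rewrite vc.
exact: ltn_trans (h c bc ac).
Qed.

Lemma permanent_leq_parent a b : permanent a -> permanent b -> a < b -> a <= parent b.
Proof.
move=> pa pb ab; have b0 : 0 < b := leq_ltn_trans (leq0n a) ab.
have act := iffLR (actsP b0) pb.1; rewrite leqNgt; apply/negP => va.
have rab := pa.2 b ab pb.1.
have := (permanent_parent b0 pb).2 a va pa.1.
by case: (parent_last act (permanent_alive pa ab)); lia.
Qed.

(** The first later stage with the same requirement would find [b] alive, against [parent_last];
    smaller requirements are excluded by assumption. *)
Lemma permanent_minimal v b :
  v < b -> acts b -> (forall c, v < c -> acts c -> requirement b <= requirement c) ->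
  permanent b.
Proof.
move=> vb ab min; split=> // c bc ac.
rewrite ltn_neqAle min ?andbT //; last exact: ltn_trans bc.
apply/negP => /eqP rbc.
have [d] := ex_minnP (ex_intro (fun d => [&& b < d, acts d & requirement d == requirement b])
  c (introT and3P (And3 bc ac (introT eqP (esym rbc))))).
move=> /and3P[bd ad /eqP rd] mind.
have d0 : 0 < d := leq_ltn_trans (leq0n b) bd.
have act := iffLR (actsP d0) ad.
have albd : alive b d.
  split=> // d' /andP[bd' d'd] ad'; rewrite ltn_neqAle min ?andbT //; last exact: ltn_trans bd'.
  apply/negP => /eqP rd'.
  have := mind d'; rewrite bd' ad' rd' eqxx => /(_ erefl).
  by rewrite leqNgt d'd.
by have := parent_requirement act; case: (parent_last act albd); lia.
Qed.

Lemma leq_stage_parent e v F m u s : e + v <= stage e v F m u s.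
Proof.
by apply: leq_trans (leq_pair_code _ _); rewrite leq_add2l leq_pair1.
Qed.

Lemma permanent_max n : exists v, [/\ permanent v, v <= n &
  forall a, permanent a -> a <= n -> a <= v].
Proof.
have [] := @ex_maxnP (fun a => `[<permanent a>] && (a <= n)) n.
- by exists 0; rewrite andbT; apply/asboolP; exact: permanent0.
- by move=> a /andP[].
move=> v /andP[/asboolP pv vn] max; exists v; split=> // a pa an.
by apply: max; rewrite an andbT; apply/asboolP.
Qed.

(** If nothing acted after [v], a requirement for the operator that enumerates every number from the
    empty set could act. The second component of a requirement is padding, so one larger than that
    of [v] is available. *)
Lemma acts_later v : permanent v -> exists2 t, v < t & acts t.
Proof.
move=> pv; apply: contrapT => no.
have no' t : v < t -> ~~ acts t by move=> vt; apply/negP => at_; apply: no; exists t.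
have /univP[s hs] : run set0 Zero (pair_code 0 v.+1) 0 by [].
pose e := pair_code (program_code Zero) (requirement v).+1.
have re : requirement v < e by exact: leq_pair2.
pose F := bitmask (fun i => (i == v) || bit (stem v) i) v.+1.
pose t := stage e v F v.+1 0 s.
have vt : v < t.
  by have := leq_stage_parent e v F v.+1 0 s; rewrite -/t; lia.
apply: no; exists t => //; apply/actsP; first by exact: leq_ltn_trans vt.
have past a : a < t -> acts a -> a <= v.
  by move=> _ aa; rewrite leqNgt; apply/negP => /no'; rewrite aa.
split; rewrite ?stageE.
- exact: permanent_alive.
- by [].
- move=> a [aa lt_at ha]; left; have := past a lt_at aa.
  rewrite leq_eqVlt => /predU1P[-> //|av].
  by apply/ltnW/ha; [rewrite av | exact: pv.1].
- by move=> i iv; rewrite bit_bitmask ltn_eqF //= ltnS ltnW.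
- by exists v => //; rewrite bit_bitmask ltnSn eqxx.
- by rewrite unpairE hs.
- by move=> i /bit_ltn.
- by rewrite bit_bitmask ltnn.
by move=> t' /andP[vt' t't] /(past _ t't); rewrite leqNgt vt'.
Qed.

Lemma permanent_next v : permanent v -> exists b,
  [/\ permanent b, v < b, parent b = v,
      forall c, v < c -> acts c -> requirement b <= requirement c &
      forall a, permanent a -> v < a -> b <= a].
Proof.
move=> pv; have [t vt act] := acts_later pv.
have ex_e : exists e, `[<exists b, [/\ v < b, acts b & requirement b = e]>].
  by exists (requirement t); apply/asboolP; exists t.
have [e] := ex_minnP ex_e.
move=> /asboolP[b [vb ab rb]] mine.
have minb c : v < c -> acts c -> requirement b <= requirement c.
  by move=> vc ac; rewrite rb; apply: mine; apply/asboolP; exists c.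
have pb := permanent_minimal vb ab minb.
have least a : permanent a -> v < a -> b <= a.
  move=> pa va; rewrite leqNgt; apply/negP => lt_ab.
  by have := pa.2 b lt_ab ab; rewrite ltnNge minb //; exact: pa.1.
exists b; split=> //; apply/eqP; rewrite eqn_leq (permanent_leq_parent pv pb vb) andbT.
have b0 : 0 < b := leq_ltn_trans (leq0n v) vb.
rewrite leqNgt; apply/negP => /(least _ (permanent_parent b0 pb)).
by rewrite leqNgt parent_ltn.
Qed.

Lemma permanent_cofinal n : exists2 a, n <= a & permanent a.
Proof.
elim: n => [|n [a na pa]]; first by exists 0 => //; exact: permanent0.
have [b [pb ab _ _ _]] := permanent_next pa; exists b => //.
exact: leq_ltn_trans ab.
Qed.

Lemma permanent_requirement_cofinal n : exists2 a, n <= requirement a & permanent a.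
Proof.
elim: n => [|n [a na pa]]; first by exists 0 => //; exact: permanent0.
have [b [pb ab _ _ _]] := permanent_next pa; exists b => //.
by apply: leq_ltn_trans na (pa.2 b ab pb.1).
Qed.

(** * The set built along the true path *)

Definition witness : set nat := [set i | exists2 a, permanent a & bit (stem a) i].

Lemma stem_permanent a b i :
  permanent a -> permanent b -> a <= b -> i < a -> bit (stem b) i = bit (stem a) i.
Proof.
move=> pa; elim/ltn_ind: b => b IH pb; rewrite leq_eqVlt => /predU1P[-> //|ab ia].
have b0 : 0 < b := leq_ltn_trans (leq0n a) ab.
have av := permanent_leq_parent pa pb ab.
have act := iffLR (actsP b0) pb.1.
rewrite (stem_parent act); last exact: leq_trans av.
apply: IH => //; [exact: parent_ltn pb.1 | exact: permanent_parent].
Qed.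

Lemma stem_leq a : stem a <= a.
Proof.
apply: leq_trans (leq_unpair1 _) _; apply: leq_trans (leq_unpair2 _) _.
exact: leq_unpair2.
Qed.

Lemma witness_stem a i : permanent a -> i < a -> witness i <-> bit (stem a) i.
Proof.
move=> pa ia; split=> [[c pc ci]|]; last by exists a.
have [ac|ca] := leqP a c; first by rewrite -(stem_permanent pa pc).
by rewrite (stem_permanent pc pa (ltnW ca) (leq_trans (bit_ltn ci) (stem_leq c))).
Qed.

(** A stage that is not permanent lies between two consecutive permanent stages, the first of which
    is the parent of the second; [stem_sparse] of the second applies, and its stem agrees with the
    set that far. *)
Lemma below_witness_leq t : acts t -> ~ permanent t -> below witness t <= node t.
Proof.
move=> act npt; have [v [pv vt max]] := permanent_max t.
have {}vt : v < t.
  by rewrite ltn_neqAle vt andbT; apply/eqP => e; apply: npt; rewrite -e.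
have [b [pb vb bv _ _]] := permanent_next pv.
have tb : t < b.
  rewrite ltnNge; apply/negP => bt.
  by have := max b pb bt; rewrite leqNgt vb.
have b0 : 0 < b := leq_ltn_trans (leq0n t) tb.
have := stem_sparse (iffLR (actsP b0) pb.1) _ act; rewrite bv vt tb => /(_ erefl).
apply: leq_trans; rewrite leq_eqVlt; apply/orP; left; apply/eqP.
apply: eq_in_count => i; rewrite mem_iota /= add0n => it.
by apply/asboolP/idP => /(witness_stem pb (ltn_trans it tb)).
Qed.

Lemma witness_infinite : infinite_set witness.
Proof.
apply/infinite_natP => n; have [a na pa] := permanent_cofinal n.
have [b [pb ab ba _ _]] := permanent_next pa.
have b0 : 0 < b := leq_ltn_trans (leq0n a) ab.
have [i ai si] := stem_new (iffLR (actsP b0) pb.1).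
by exists i; [rewrite ba in ai; exact: leq_trans ai | exists b].
Qed.

Lemma below_level_permanent f t :
  majorizes f witness -> acts t -> f (node t) < t -> permanent t.
Proof.
move=> fW act ft; apply: contrapT => /(below_witness_leq act).
by rewrite leqNgt -(principal_ltn _ _ witness_infinite) (leq_ltn_trans (fW _)).
Qed.

(* Either [f] is too small at the node of infinitely many stages that act, which
   are then permanent; or it eventually bounds the stages that act by their
   nodes, so that permanence is decidable in [f]. *)
Lemma witness_majorreducible : majorreducible witness.
Proof.
move=> f fW; apply/turing_reducibleP.
have cf : computable_on [set graph f] (fun X i => oracle_fun X i).
  have : computable_on (graph @` [set f]) (fun X i => oracle_fun X i).
    by apply: co_oracle_fun; co.
  by apply: computable_on_sub => _ ->; exists f.
have {}cf F : computable_on [set graph f] F ->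
    computable_on [set graph f] (fun X x => f (F X x)).
  move=> cF; apply: computable_on_ext (co_comp cf cF) => _ x ->.
  exact: oracle_funE.
have [inf|fin] := pselect (forall n, exists t, [&& n < t, acts t & f (node t) < t]).
  apply: (@computable_on_ext _ (fun _ n =>
    bit (stem (minimize (fun t => [&& n < t, acts t & f (node t) < t]))) n)).
    move=> _ n _; rewrite characteristicP; congr nat_of_bool.
    have [] := minimizeP (inf n); move: (minimize _) => t /and3P[nt act ft] _.
    have pt := below_level_permanent fW act ft.
    by apply/idP/asboolP => /(witness_stem pt nt).
  have cm : computable_on [set graph f] (fun _ n =>
      minimize (fun t => [&& n < t, acts t & f (node t) < t])).
    by apply: co_minimize => //; rewrite /node /requirement /parent; co.
  by rewrite /stem; co.
have [N fN] : exists N, forall t, N < t -> acts t -> t <= f (node t).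
  apply: contrapT => noN; apply: fin => n; apply: contrapT => no; apply: noN.
  exists n => t nt act; rewrite leqNgt; apply/negP => ft; apply: no.
  by exists t; rewrite nt act ft.
have [v0 Nv0 pv0] := permanent_cofinal N.
(* A stage after [v0] that is not permanent is followed by a permanent stage [b] with an earlier
   parent and a requirement that is not larger. As [f] bounds [b] at its node, a finite search finds
   it. *)
pose verified t := acts t && all (fun v => all (fun e => all (fun c =>
    acts c ==> (t < c) ==> (node c != pair_code e v))
  (iota 0 (f (pair_code e v)).+1)) (iota 0 (requirement t).+1)) (iota 0 t).
have verifiedP t : v0 < t -> verified t -> permanent t.
  move=> v0t /andP[act] /all_iotaP ver; apply: contrapT => npt.
  have [v [pv vt max]] := permanent_max t.
  have {}vt : v < t.
    by rewrite ltn_neqAle vt andbT; apply/eqP => e; apply: npt; rewrite -e.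
  have [b [pb vb bv minb _]] := permanent_next pv.
  have tb : t < b.
    rewrite ltnNge; apply/negP => bt.
    by have := max b pb bt; rewrite leqNgt vb.
  have rbt : requirement b <= requirement t.
    rewrite leqNgt; apply/negP => rtb; apply: npt; split=> // c tc ac.
    by apply: leq_trans rtb (minb c (ltn_trans vt tc) ac).
  have Nb : N < b by apply: leq_ltn_trans Nv0 (ltn_trans v0t tb).
  have /all_iotaP ver1 := ver v vt; have /all_iotaP ver2 := ver1 (requirement b) rbt.
  have bf : b < (f (pair_code (requirement b) v)).+1.
    by rewrite ltnS; have := fN b Nb pb.1; rewrite /node bv.
  by have := ver2 b bf; rewrite pb.1 tb /node bv eqxx.
have ver_ex n : exists t, [&& n < t, v0 < t & verified t].
  have [t] := permanent_cofinal (maxn n v0).+1; rewrite gtn_max => /andP[nt v0t] pt.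
  exists t; rewrite nt v0t /verified pt.1 !andTb.
  apply/all_iotaP => v _; apply/all_iotaP => e; rewrite ltnS => et.
  apply/all_iotaP => c _; apply/implyP => ac; apply/implyP => tc.
  apply/eqP => /pair_code_inj[re _].
  by have := pt.2 c tc ac; rewrite re ltnNge et.
apply: (@computable_on_ext _ (fun _ n =>
  bit (stem (minimize (fun t => [&& n < t, v0 < t & verified t]))) n)).
  move=> _ n _; rewrite characteristicP; congr nat_of_bool.
  have [] := minimizeP (ver_ex n); move: (minimize _) => t /and3P[nt v0t ver] _.
  have pt := verifiedP t v0t ver.
  by apply/idP/asboolP => /(witness_stem pt nt).
have cm : computable_on [set graph f] (fun _ n =>
    minimize (fun t => [&& n < t, v0 < t & verified t])).
  apply: co_minimize => //.
  by rewrite /verified /node /requirement /parent; co.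
by rewrite /stem; co.
Qed.

Lemma below_const C m n :
  m <= n -> (forall i, m <= i < n -> ~ C i) -> below C n = below C m.
Proof.
move=> /subnK <-; elim: (n - m) => [//|d IH] nC; rewrite addSn belowS asboolF ?addn0.
  by apply: IH => i /andP[mi id]; apply: nC; rewrite mi ltnW.
by apply: nC; rewrite leq_addl ltnSn.
Qed.

(* [C] has at most one element between consecutive permanent stages, so that its
   finite parts are sparse enough for any stage to act with them. *)
Lemma witness_sparse_subset v y :
  permanent v -> v <= y -> exists C,
    [/\ C `<=` witness, infinite_set C, ~ C y, forall i, i < v -> C i <-> witness i &
      forall t, v < t -> acts t -> below C t <= node t].
Proof.
move=> pv vy.
pose first a i := [/\ a <= i, witness i, i != y & forall j, a <= j < i -> witness j -> j = y].
pose C := [set i | i < v /\ witness i \/ exists a, [/\ permanent a, v <= a & first a i]].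
have CW : C `<=` witness by move=> i [[_ //]|[a [_ _ []]]].
have Cv i : i < v -> C i <-> witness i.
  move=> iv; split; first exact: CW.
  by left.
exists C; split=> //.
- apply/infinite_natP => n; have [a] := permanent_cofinal (maxn n y.+1).
  rewrite geq_max => /andP[na ya] pa.
  have [x0 ax0 Wx0] := iffLR (infinite_natP _) witness_infinite a.
  have ex_x : exists x, (a <= x) && `[<witness x>].
    by exists x0; rewrite ax0; apply/asboolP.
  have [x /andP[ax /asboolP Wx] min] := ex_minnP ex_x.
  exists x; first exact: leq_trans ax.
  right; exists a; split=> //; first exact: leq_trans vy (ltnW ya).
  split=> //; first by rewrite gtn_eqF // (leq_trans ya).
  move=> j /andP[aj jx] Wj; have := min j; rewrite aj asboolT // => /(_ erefl).
  by rewrite leqNgt jx.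
- by move=> [[yv]|[a [_ _ []]]]; [move: yv; rewrite ltnNge vy | rewrite eqxx].
move=> t vt act; have [pt|npt] := pselect (permanent t); last first.
  exact: leq_trans (below_sub t CW) (below_witness_leq act npt).
have t0 : 0 < t := leq_ltn_trans (leq0n v) vt.
have pw := permanent_parent t0 pt; have vw := permanent_leq_parent pv pt vt.
have rt := acts_requirement t0 act.
(* Below [t] there are then at most [parent t + 1] elements of [C], and [node t] is at least that
   since its requirement is positive. *)
suff one d : parent t + d <= t -> below C (parent t + d) <= (below C (parent t)).+1.
  have := one (t - parent t); rewrite subnKC ?parent_leq // => /(_ (leqnn t)).
  move=> h; apply: leq_trans h _; have := below_leq C (parent t).
  have := leq_pair_code (requirement t) (parent t); rewrite /node; lia.
suff gap i j : C i -> C j -> parent t <= i -> i < j -> j < t -> False.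
  elim: d => [|d IH] dt; first by rewrite addn0.
  rewrite addnS belowS; case: asboolP => [Cd|_]; last first.
    by rewrite addn0; apply: IH; lia.
  rewrite addn1 ltnS.
  rewrite (@below_const C (parent t) (parent t + d)) ?leq_addr // => i /andP[pi it] Ci.
  by apply: (gap i (parent t + d)) => //; lia.
move=> Ci [[jv _]|[a [pa va [aj Wj jy h]]]] ti ij jt; first by lia.
have at_ : a <= parent t.
  by apply: permanent_leq_parent => //; exact: leq_ltn_trans jt.
have iy : i = y by apply: h (CW _ Ci); rewrite ij (leq_trans at_).
case: Ci => [[iv _]|[a' [_ _ [_ _ /eqP]]]] //; lia.
Qed.

(** Let [b] follow the last permanent stage [v] with requirement below [e]. If [b] acts for [e], its
    computation enumerates a number outside the set. Otherwise the operator must enumerate an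
    element [y] from a sparse subset omitting [y], and a stage for [e] could act after [v] with a
    finite part of that subset, against the minimality of [b]. *)
Lemma witness_not_unif_introenumerable : ~ unif_introenumerable witness.
Proof.
move=> [Theta /ce_univ[c Tc] TW].
pose e := pair_code c 1.
have e0 : 0 < e by exact: leq_pair2.
have [b0 eb0 pb0] := permanent_requirement_cofinal e.
have [v [pv ve maxv]] : exists v, [/\ permanent v, requirement v < e &
    forall a, permanent a -> requirement a < e -> a <= v].
  have [] := @ex_maxnP (fun a => `[<permanent a>] && (requirement a < e)) b0.
  - exists 0; rewrite (asboolT permanent0) /=.
    by apply: leq_ltn_trans (leq_unpair1 0) e0.
  - move=> a /andP[/asboolP pa ae]; rewrite leqNgt; apply/negP => b0a.
    by have := pb0.2 a b0a pa.1; lia.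
  move=> v /andP[/asboolP pv ve] max; exists v; split=> // a pa ae.
  by apply: max; rewrite ae asboolT.
have [b [pb vb bv minb _]] := permanent_next pv.
have eb : e <= requirement b.
  by rewrite leqNgt; apply/negP => /(maxv b pb); rewrite leqNgt vb.
have bpos : 0 < b := leq_ltn_trans (leq0n v) vb.
move: eb; rewrite leq_eqVlt => /predU1P[eb|eb].
  have act := iffLR (actsP bpos) pb.1.
  have ob : omitted b < b.
    have h1 := leq_unpair1 (unpair2 (unpair2 (unpair2 b))).
    have h2 := leq_unpair2 (unpair2 (unpair2 b)).
    have h3 := leq_unpair2 (unpair2 b).
    have h4 := leq_pair_code (requirement b) (unpair2 b).
    rewrite unpairK in h4.
    by rewrite /omitted; lia.
  have : witness (omitted b).
    rewrite -(TW witness) //; last exact: witness_infinite.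
    exists (used b); split.
      by move=> i /(used_stem act) si; exists b.
    by apply/Tc; exists (steps b); have := omitted_univ act; rewrite -eb unpairE.
  by move=> /(witness_stem pb ob); rewrite (negbTE (omitted_stem act)).
have [y vy Wy] := iffLR (infinite_natP _) witness_infinite v.
have [C [CW infC nCy Cv sparse]] := witness_sparse_subset pv vy.
have : enum_apply Theta C y by rewrite TW.
move=> [u [uC /Tc[s us]]].
have [x vx Cx] := iffLR (infinite_natP _) infC v.
pose z := maxn u x.+1; pose F := trunc C z.
pose t := stage e v F y u s.
have FC i : i < z -> bit F i <-> C i by move=> iz; exact: truncE.
have vt : v < t by have := leq_stage_parent e v F y u s; rewrite -/t; lia.
have vz : v <= z by rewrite leq_max (leq_trans vx (leqnSn x)) orbT.
suff act : acts t.
  by have := minb t vt act; rewrite /t stageE leqNgt eb.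
apply/actsP; first exact: leq_ltn_trans vt.
have ry a : v < a -> acts a -> e < requirement a.
  by move=> va aa; exact: leq_trans eb (minb a va aa).
split; rewrite ?stageE.
- exact: permanent_alive.
- exact: ve.
- move=> a [aa lt_at ha]; have [av|va|->] := ltngtP a v; [left|right|by left].
    by apply/ltnW/ha; [rewrite av | exact: pv.1].
  exact: ry.
- move=> i iv; apply/idP/idP.
    by move=> /(FC i (leq_trans iv vz))/(Cv i iv)/(witness_stem pv iv).
  by move=> /(witness_stem pv iv)/(Cv i iv)/(FC i (leq_trans iv vz)).
- by exists x => //; apply/FC => //; rewrite leq_max ltnSn orbT.
- by rewrite unpairE.
- by move=> i ui; apply/FC; [rewrite leq_max (bit_ltn ui) | exact: uC].
- by apply/negP; rewrite bit_trunc => /andP[_ /asboolP].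
move=> t' /andP[vt' _] at'; apply: leq_trans (sparse t' vt' at').
apply: sub_count => i; rewrite bit_trunc => /andP[_ /asboolP Ci].
exact: mem_set.
Qed.

Lemma majorreducible_not_unif_introenumerable :
  exists A, [/\ infinite_set A, majorreducible A & ~ unif_introenumerable A].
Proof.
exists witness; split; [exact: witness_infinite | exact: witness_majorreducible |].
exact: witness_not_unif_introenumerable.
Qed.

(** * Separation of the classes *)

Lemma univ_pos_mono c x s s' : s <= s' -> 0 < univ c x s -> 0 < univ c x s'.
Proof.
move=> ss'; case e: (univ c x s) => [//|y] _.
by rewrite (univ_mono ss' e).
Qed.

Lemma enum_reducible_ce A X : enum_reducible A X -> ce X -> ce A.
Proof.
move=> [Theta /ce_univ[c Tc] <-] /ce_univ[d Xd].
pose r n w := (0 < univ c (pair_code (unpair1 w) n) (unpair2 w)) &&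
  all (fun i => bit (unpair1 w) i ==> (0 < univ d i (unpair2 w))) (iota 0 (unpair1 w)).
rewrite (_ : enum_apply _ _ = [set n | exists w, r n w]); first by apply: ce_search; rewrite /r; co.
apply/seteqP; split=> n; last first.
  move=> [w /andP[cw /all_iotaP dw]]; exists (unpair1 w); split.
    move=> i wi; apply/Xd; exists (unpair2 w).
    by have := dw i (bit_ltn wi); rewrite (_ : bit _ i = true).
  by apply/Tc; exists (unpair2 w).
move=> [u [uX /Tc[s us]]].
have [||m hm] := @bounded_choice (fun i s => bit u i -> 0 < univ d i s) u.
- by move=> i s1 s2 s12 h /h; exact: univ_pos_mono.
- move=> i _; have [/uX/Xd[s' ds']|] := boolP (bit u i); first by exists s'.
  by exists 0.
exists (pair_code u (maxn m s)); rewrite /r !unpairE.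
rewrite (univ_pos_mono (leq_maxr m s) us) /=; apply/all_iotaP => i iu.
by apply/implyP => ui; apply: univ_pos_mono (leq_maxl m s) _; exact: hm.
Qed.

(** An introenumerable set with an infinite c.e. subset is c.e., hence uniformly introenumerable,
    which the majorreducible set is not. *)
Lemma unif_majorreducible_not_ce :
  exists A, [/\ infinite_set A, unif_majorreducible A & ~ ce A].
Proof.
have [W [infW mrW nW]] := majorreducible_not_unif_introenumerable.
have meW := majorreducible_majorenumerable mrW.
have [M [MW infM uM]] := majorenumerable_refinement meW infW.
exists M; split=> // ceM; apply/nW/ce_unif_introenumerable.
by apply: enum_reducible_ce ceM; exact: majorenumerable_introenumerable.
Qed.

Definition separated (P Q : class_name) : Prop :=
  exists A : set nat, infinite_set A /\
    ((in_class P A /\ ~ in_class Q A) \/ (in_class Q A /\ ~ in_class P A)).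

Lemma separated_sym P Q : separated P Q -> separated Q P.
Proof. by move=> [A [infA [h|h]]]; exists A; split=> //; [right | left]. Qed.

Lemma separatedI A P Q :
  infinite_set A -> class_property P A -> ~ class_property Q A -> separated P Q.
Proof. by move=> infA PA nQA; exists A; split=> //; left; split=> // -[]. Qed.

Lemma separated_signature A (s : pred class_name) P Q :
  infinite_set A ->
  (forall R, if s R then class_property R A else ~ class_property R A) ->
  s P != s Q -> separated P Q.
Proof.
move=> infA sA; move: (sA P) (sA Q); case: (s P); case: (s Q) => // hP hQ _.
  exact: separatedI infA hP hQ.
by apply/separated_sym; exact: separatedI infA hQ hP.
Qed.

Lemma classes_separated P Q : P <> Q -> separated P Q.
Proof.
move=> PQ.
have [K [infK ceK regK nirK]] := ce_not_introreducible.
have [G [infG retG nmeG]] := retraceable_not_majorenumerable.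
have [W [infW mrW nuieW]] := majorreducible_not_unif_introenumerable.
have [N [infN uirN nregN]] := unif_introreducible_not_regressive.
have [M [infM umrM nceM]] := unif_majorreducible_not_ce.
have uir_ir A : unif_introreducible A -> introreducible A.
  by move=> [e he] C CA infC; exists e; exact: he.
have uie_ie A : unif_introenumerable A -> introenumerable A.
  by move=> [Theta cT hT] C CA infC; exists Theta => //; exact: hT.
have umr_mr A : unif_majorreducible A -> majorreducible A.
  by move=> [e he] f fA; exists e; exact: he.
have ume_me A : unif_majorenumerable A -> majorenumerable A.
  by move=> [Theta cT hT] f fA; exists Theta => //; exact: hT.
pose sK R := match R with
  | UnifMajorenumerable | Majorenumerable | UnifIntroenumerable | Introenumerable
  | Regressive | CE => true | _ => false end.
pose sG R := match R with
  | UnifIntroreducible | UnifIntroenumerable | Introreducible | Introenumerable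
  | Regressive | Retraceable => true | _ => false end.
pose sW R := match R with
  | Majorreducible | Majorenumerable | Introreducible | Introenumerable => true
  | _ => false end.
have KP R : if sK R then class_property R K else ~ class_property R K.
  have umeK := ce_unif_majorenumerable ceK.
  have uieK := ce_unif_introenumerable ceK.
  case: R => //=.
  - by move=> /umr_mr/majorreducible_introreducible.
  - by move=> /majorreducible_introreducible.
  - exact: ume_me.
  - by move=> /uir_ir.
  - exact: uie_ie.
  - by move=> /retraceable_unif_introreducible/uir_ir.
  by move=> cK; apply: nirK => C _ _; apply/turing_reducibleP;
     apply: computable_absolute; apply/turing_reducibleP.
have GP R : if sG R then class_property R G else ~ class_property R G.
  have uirG := retraceable_unif_introreducible retG.
  have regG := retraceable_regressive retG.
  have uieG := regressive_unif_introenumerable regG.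
  case: R => //=.
  - by move=> /unif_majorreducible_majorenumerable/ume_me.
  - by move=> /ume_me.
  - by move=> /majorreducible_majorenumerable.
  - exact: uir_ir.
  - exact: uie_ie.
  - by move=> /ce_unif_majorenumerable/ume_me.
  by move=> /computable_ce/ce_unif_majorenumerable/ume_me.
have WP R : if sW R then class_property R W else ~ class_property R W.
  have meW := majorreducible_majorenumerable mrW.
  have irW := majorreducible_introreducible mrW.
  have ieW := majorenumerable_introenumerable meW.
  case: R => //=.
  - by move=> /unif_majorreducible_majorenumerable/unif_majorenumerable_introenumerable.
  - by move=> /unif_majorenumerable_introenumerable.
  - by move=> /unif_introreducible_introenumerable.
  - by move=> /regressive_unif_introenumerable.
  - by move=> /retraceable_regressive/regressive_unif_introenumerable.
  - by move=> /ce_unif_introenumerable.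
  by move=> /computable_ce/ce_unif_introenumerable.
have [ePQ|nPQ] := eqVneq (sK P) (sK Q); last exact: (@separated_signature K sK P Q infK KP nPQ).
have [eGPQ|nPQ] := eqVneq (sG P) (sG Q); last exact: (@separated_signature G sG P Q infG GP nPQ).
have [eWPQ|nPQ] := eqVneq (sW P) (sW Q); last exact: (@separated_signature W sW P Q infW WP nPQ).
(* Membership of the three sets tells apart all but four pairs of classes, which are now separated
   one by one. *)
have uir_ret : separated UnifIntroreducible Retraceable.
  by apply: (@separatedI N UnifIntroreducible Retraceable infN uirN) => /retraceable_regressive.
have uie_reg : separated UnifIntroenumerable Regressive.
  exact: (@separatedI N UnifIntroenumerable Regressive infN
    (unif_introreducible_introenumerable uirN) nregN).
have umr_comp : separated UnifMajorreducible Computable.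
  by apply: (@separatedI M UnifMajorreducible Computable infM umrM) => /computable_ce.
have ume_ce : separated UnifMajorenumerable CE.
  exact: (@separatedI M UnifMajorenumerable CE infM
    (unif_majorreducible_majorenumerable umrM) nceM).
by case: P PQ ePQ eGPQ eWPQ; case: Q => // _ _ _ _; apply/separated_sym.
Qed.

Theorem theorem1p1 :
  (forall P Q : class_name, P <> Q ->
     exists A : set nat,
       infinite_set A /\
       ((in_class P A /\ ~ in_class Q A) \/ (in_class Q A /\ ~ in_class P A)))
  /\
  (forall P Q : class_name, major_class P -> major_class Q -> refinable P Q).
Proof.
split=> [P Q|P Q mP mQ A [infA PA]]; first exact: classes_separated.
(* The weakest of the four properties refines to the strongest, which serves all pairs. *)
have meA : majorenumerable A.
  have ume_me : unif_majorenumerable A -> majorenumerable A.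
    by move=> [Theta cT hT] f fA; exists Theta => //; exact: hT.
  case: P mP PA => //= _.
  - by move=> /unif_majorreducible_majorenumerable.
  - by move=> /majorreducible_majorenumerable.
have [B [BA infB umrB]] := majorenumerable_refinement meA infA.
exists B => //; split=> //; have umeB := unif_majorreducible_majorenumerable umrB.
case: Q mQ => //= _.
- by case: umrB => e he f fB; exists e; exact: he.
by case: umeB => Theta cT hT f fB; exists Theta => //; exact: hT.
Qed.
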